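(* There is an algorithm for fully dynamic bounded $3$-sum whose amortized processing time per operation is bounded by $O\!\left(\min\{\mathsf{oprs}, \mathsf{r}_{\mathsf{max}}^{0.5} \log \mathsf{r}_{\mathsf{max}}\}\right)$, where $\mathsf{oprs}$ is the number of operations.
   Context: Fully dynamic bounded $3$-sum: an integer bound $\mathsf{r}_{\mathsf{max}}$ is given in advance; three sets $\mathsf{A},\mathsf{B},\mathsf{C}$ of integers in $[0,\mathsf{r}_{\mathsf{max}}]$ are initially empty. Each operation is one of: (1) insert an integer $w \in [0,\mathsf{r}_{\mathsf{max}}]$ into one of $\mathsf{A},\mathsf{B},\mathsf{C}$ (not already present in that set); (2) delete a number currently present from one of $\mathsf{A},\mathsf{B},\mathsf{C}$; (3) a query asking whether there exist $a\in\mathsf{A}$, $b\in\mathsf{B}$, $c\in\mathsf{C}$ with $a+b=c$. Operations arrive online and $\mathsf{oprs}$ (total number of operations) is not known in advance. Amortized processing time is total running time divided by $\mathsf{oprs}$. *)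

(* Defs.v *)
From Stdlib Require Export Reals ZArith List Ensembles.
Export ListNotations.

Open Scope Z_scope.

(** * Word RAM

    A machine with word size [w] computes on words, i.e. integers in
    [0, 2^w).  Programs are finite syntax trees, so a program can depend
    neither on the input nor on the word size. *)

Inductive binop : Type :=
| BAdd | BSub | BMul | BDiv | BMod | BAnd | BOr | BXor | BShl | BShr | BEq | BLt.

Definition wrap (w x : Z) : Z := x mod 2 ^ w.

(** Arithmetic is modulo [2^w].  [BDiv] and [BMod] by zero return [0] and the
    dividend respectively, as in [ZArith]; comparisons return [0] or [1]. *)
Definition eval_binop (w : Z) (o : binop) (x y : Z) : Z :=
  wrap w
    match o with
    | BAdd => x + y
    | BSub => x - y
    | BMul => x * y
    | BDiv => x / y
    | BMod => x mod y
    | BAnd => Z.land x y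
    | BOr  => Z.lor x y
    | BXor => Z.lxor x y
    | BShl => Z.shiftl x y
    | BShr => Z.shiftr x y
    | BEq  => if x =? y then 1 else 0
    | BLt  => if x <? y then 1 else 0
    end.

Inductive expr : Type :=
| Const (c : Z)
| Reg (r : nat)
| Fetch (addr : expr)
| Bin (o : binop) (e1 e2 : expr).

Inductive cmd : Type :=
| Skip
| Assign (r : nat) (e : expr)
| Store (addr e : expr)
| Seq (c1 c2 : cmd)
| If (e : expr) (c1 c2 : cmd)
| While (e : expr) (c : cmd).

Record state : Type := State { regs : nat -> Z; mem : Z -> Z }.

Definition set_reg (r : nat) (v : Z) (s : state) : state :=
  State (fun r' => if Nat.eqb r' r then v else regs s r') (mem s).

Definition set_mem (a v : Z) (s : state) : state :=
  State (regs s) (fun a' => if a' =? a then v else mem s a').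

Definition zero_state : state := State (fun _ => 0) (fun _ => 0).

Fixpoint eval (w : Z) (s : state) (e : expr) : Z :=
  match e with
  | Const c => wrap w c
  | Reg r => regs s r
  | Fetch a => mem s (eval w s a)
  | Bin o e1 e2 => eval_binop w o (eval w s e1) (eval w s e2)
  end.

(** Unit cost per word operation: evaluating an expression costs one step per
    node, and every executed command and every test costs one more step. *)
Fixpoint expr_cost (e : expr) : nat :=
  match e with
  | Const _ | Reg _ => 1
  | Fetch a => S (expr_cost a)
  | Bin _ e1 e2 => S (expr_cost e1 + expr_cost e2)
  end.

(** [exec w c s t s']: started in [s], [c] halts in [s'] after [t] steps. *)
Inductive exec (w : Z) : cmd -> state -> nat -> state -> Prop :=
| exec_skip s :
    exec w Skip s 1 s
| exec_assign r e s :
    exec w (Assign r e) s (S (expr_cost e)) (set_reg r (eval w s e) s)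
| exec_store a e s :
    exec w (Store a e) s (S (expr_cost a + expr_cost e))
      (set_mem (eval w s a) (eval w s e) s)
| exec_seq c1 c2 s t1 s1 t2 s2 :
    exec w c1 s t1 s1 -> exec w c2 s1 t2 s2 ->
    exec w (Seq c1 c2) s (S (t1 + t2)) s2
| exec_if_true e c1 c2 s t s' :
    eval w s e <> 0 -> exec w c1 s t s' ->
    exec w (If e c1 c2) s (S (expr_cost e + t)) s'
| exec_if_false e c1 c2 s t s' :
    eval w s e = 0 -> exec w c2 s t s' ->
    exec w (If e c1 c2) s (S (expr_cost e + t)) s'
| exec_while_true e c s t1 s1 t2 s2 :
    eval w s e <> 0 -> exec w c s t1 s1 -> exec w (While e c) s1 t2 s2 ->
    exec w (While e c) s (S (expr_cost e + t1 + t2)) s2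
| exec_while_false e c s :
    eval w s e = 0 ->
    exec w (While e c) s (S (expr_cost e)) s.

(** * Fully dynamic bounded 3-sum *)

Inductive part : Type := PA | PB | PC.

Inductive operation : Type :=
| Insert (p : part) (x : Z)
| Delete (p : part) (x : Z)
| Query.

Definition sets : Type := part -> Ensemble Z.

Definition empty_sets : sets := fun _ => Empty_set Z.

Definition part_eq_dec (p q : part) : {p = q} + {p <> q}.
Proof. decide equality. Defined.

Definition update (S : sets) (p : part) (X : Ensemble Z) : sets :=
  fun q => if part_eq_dec q p then X else S q.

Definition apply_op (S : sets) (op : operation) : sets :=
  match op with
  | Insert p x => update S p (Add Z (S p) x)
  | Delete p x => update S p (Subtract Z (S p) x)
  | Query => S
  end.

Definition admissible (rmax : Z) (S : sets) (op : operation) : Prop :=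
  match op with
  | Insert p x => 0 <= x <= rmax /\ ~ In Z (S p) x
  | Delete p x => In Z (S p) x
  | Query => True
  end.

Fixpoint valid_ops (rmax : Z) (S : sets) (ops : list operation) : Prop :=
  match ops with
  | [] => True
  | op :: ops' => admissible rmax S op /\ valid_ops rmax (apply_op S op) ops'
  end.

Definition has_3sum (S : sets) : Prop :=
  exists a b c : Z,
    In Z (S PA) a /\ In Z (S PB) b /\ In Z (S PC) c /\ a + b = c.

(** [outs] lists the output word of every operation; only those of queries
    are constrained. *)
Fixpoint correct_outputs (S : sets) (ops : list operation) (outs : list Z)
  : Prop :=
  match ops, outs with
  | [], [] => True
  | op :: ops', o :: outs' =>
      (op = Query -> (has_3sum S /\ o = 1) \/ (~ has_3sum S /\ o = 0)) /\
      correct_outputs (apply_op S op) ops' outs'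
  | _, _ => False
  end.

(** * Online algorithms *)

(** [preprocess] is run once, with [rmax] in register 0, and [handle] once per
    operation; the machine state persists between these runs. *)
Record algorithm : Type := Algorithm { preprocess : cmd; handle : cmd }.

Definition part_code (p : part) : Z :=
  match p with PA => 0 | PB => 1 | PC => 2 end.

(** Registers 0, 1, 2 receive the kind of operation, the set and the number. *)
Definition feed (w : Z) (op : operation) (s : state) : state :=
  let put k p x :=
    set_reg 0 (wrap w k) (set_reg 1 (wrap w p) (set_reg 2 (wrap w x) s)) in
  match op with
  | Insert p x => put 0 (part_code p) x
  | Delete p x => put 1 (part_code p) x
  | Query => put 2 0 0
  end.

(** The output of an operation is read from register 0.  An operation is only
    fed after the previous one has been answered. *)
Inductive handle_all (w : Z) (c : cmd)
  : state -> list operation -> nat -> list Z -> Prop :=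
| handle_nil s : handle_all w c s [] 0 []
| handle_cons s op ops t1 s1 t2 outs :
    exec w c (feed w op s) t1 s1 ->
    handle_all w c s1 ops t2 outs ->
    handle_all w c s (op :: ops) (t1 + t2) (regs s1 0%nat :: outs).

(** [runs alg w rmax ops t outs]: the total running time on [ops], including
    preprocessing, is [t], and the outputs are [outs]. *)
Definition runs (alg : algorithm) (w rmax : Z) (ops : list operation)
    (t : nat) (outs : list Z) : Prop :=
  exists t0 s0 t1,
    exec w (preprocess alg) (set_reg 0 (wrap w rmax) zero_state) t0 s0 /\
    handle_all w (handle alg) s0 ops t1 outs /\
    t = (t0 + t1)%nat.

Definition amortized (t : nat) (ops : list operation) : R :=
  (INR t / INR (length ops))%R.

(* Main.v *)
(* Reflecting C to c' = rmax - c turns solutions of a + b = c into triples with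
   a + b + c' = rmax, which is symmetric in the three sets.  The machine keeps the
   number T of these triples, snapshots of the sets, the three pairwise convolutions
   of the snapshots, and a log of the updates made since.  Inserting or deleting x
   changes T by a convolution of the two other sets at rmax - x, which is the stored
   value corrected by one term per log entry.  When the log has length about
   sqrt(rmax) log(rmax), the snapshots and convolutions are renewed at a cost
   O(rmax log^2 rmax), quadratic in the length of the log; before that nothing has
   cost more than the number of operations.

   No roots of unity are available modulo 2^w, so the convolutions are computed by
   Nussbaumer's algorithm.  An element of R[y]/(y^(m l) + 1) is read as a polynomial of
   degree < m in x over R[y]/(y^l + 1), where x stands for the old y and y for x^m.  The
   product is computed modulo x^m - 1 and x^m + 1, and each modulus x^(2h) - y^(2e) is
   split into x^h - y^e and x^h + y^e; only additions and signed rotations are needed,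
   and every recombination yields twice the product.  With m about the square root of
   the length, the cost per coefficient satisfies t(k) <= 2 t(k/2) + O(k) for length
   2^k, so t(k) = O(k^2). *)

(* A count is kept, and not just the truth of the query, because a deletion can then be undone by
   subtraction. The difficulty with the convolutions is that 2 is not invertible modulo 2^w: the
   recombinations leave a power of two in the result, and it cannot be divided out of a residue. It
   can be divided out of an integer, so words are taken large enough to hold the scaled
   coefficients, and the power itself is read off from a coefficient that is known to be 1 before
   scaling. Up to that division all machine values are related to integers only by congruence modulo
   2^w, so negative coefficients need no representation of their own. Each recursion step is stated
   over every commutative ring that receives Z, with y any element such that y^l = -1. This freedom
   lets the ring change during the argument: the passage from one variable to two is verified over
   polynomials A[X], where a degree bound turns a congruence into an equality, and the final product
   is read in Z[X]/(X^n + 1). *)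
Require Import Defs.
From mathcomp Require all_boot all_algebra ssrZ ring zify qpoly.
From Stdlib Require Import Lia Lra.

(** * Nussbaumer's algorithm *)

(* [negrot l k g]: row-wise multiplication by y^(-k) *)
Definition negrot (l k : Z) (g : Z -> Z) (t : Z) : Z :=
  (1 - 2 * (((t mod l + k) / l) mod 2)) * g (t - t mod l + (t mod l + k) mod l).

(** With [s] = h l the offset of the upper half, f = f0 + x^h f1 is reduced to f0 + y^e f1, that is,
    modulo x^h - y^e. As [negrot] multiplies by negative powers, y^e is obtained as y^(-(2l - e)),
    using y^(2l) = 1. *)
Definition split_lo (l e s : Z) (f : Z -> Z) (t : Z) : Z :=
  f t + negrot l (2 * l - e) (fun t => f (s + t)) t.

Definition split_hi (l e s : Z) (f : Z -> Z) (t : Z) : Z :=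
  f t - negrot l (2 * l - e) (fun t => f (s + t)) t.

(** The change of variables y_old^(i + m j) = x^i y^j: position i l + j of the two-variable layout
    reads the old coefficient i + m j. *)
Definition dup_read (m l : Z) (f : Z -> Z) (t : Z) : Z :=
  f (t / l + m * (t mod l)).

Fixpoint sumZ (n : nat) (f : Z -> Z) : Z :=
  match n with O => 0 | S n => sumZ n f + f (Z.of_nat n) end.

Definition conv (f g : Z -> Z) (c : Z) : Z :=
  sumZ (Z.to_nat (c + 1)) (fun x => f x * g (c - x)).

(* The sum of [f x * g y * h z] over [x + y + z = r], [x, y, z >= 0]. *)
Definition triples (r : Z) (f g h : Z -> Z) : Z :=
  sumZ (Z.to_nat (r + 1)) (fun x => f x * conv g h (r - x)).

(** * Recombination identities in commutative rings *)

Module Negacyclic.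
Import all_boot all_algebra ssrZ mathcomp.algebra_tactics.ring mathcomp.zify.zify.
Import GRing.Theory Pdiv.CommonRing Pdiv.RingMonic.
Set Implicit Arguments. Unset Strict Implicit. Unset Printing Implicit Defensive.
Local Delimit Scope Z_scope with K.
Local Open Scope ring_scope.

Section Val.
Variables (A : comNzRingType) (phi : {rmorphism Z -> A}).

Definition val (h l : nat) (X Y : A) (f : Z -> Z) : A :=
  \sum_(i < h) \sum_(j < l) phi (f (Z.of_nat (i * l + j)%N)) * X ^+ i * Y ^+ j.

Lemma eq_val h l X Y f g :
  (forall t, (0 <= t < Z.of_nat (h * l))%K -> f t = g t) ->
  val h l X Y f = val h l X Y g.
Proof.
move=> fg; apply: eq_bigr => i _; apply: eq_bigr => j _; rewrite fg //.
have hi := ltn_ord i; have hj := ltn_ord j.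
suff : (i * l + j < h * l)%N by lia.
by have := leq_mul hi (leqnn l); rewrite mulSn; lia.
Qed.

Lemma valD h l X Y f g :
  val h l X Y (fun t => f t + g t)%K = val h l X Y f + val h l X Y g.
Proof.
rewrite /val -big_split; apply: eq_bigr => i _ /=; rewrite -big_split /=.
by apply: eq_bigr => j _; rewrite (rmorphD phi) !mulrDl.
Qed.

Lemma valB h l X Y f g :
  val h l X Y (fun t => f t - g t)%K = val h l X Y f - val h l X Y g.
Proof.
rewrite /val -sumrB; apply: eq_bigr => i _ /=; rewrite -sumrB /=.
by apply: eq_bigr => j _; rewrite (rmorphB phi) !mulrBl.
Qed.

Lemma val_double h l X Y f :
  val (h + h) l X Y f =
  val h l X Y f + X ^+ h * val h l X Y (fun t => f (Z.of_nat (h * l) + t)%K).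
Proof.
rewrite /val big_split_ord /=; congr (_ + _).
rewrite mulr_sumr; apply: eq_bigr => i _; rewrite mulr_sumr.
apply: eq_bigr => j _; rewrite mulnDl -addnA [Z.of_nat (h * l + _)]Nat2Z.inj_add exprD.
ring.
Qed.

Lemma sum_rot (F : nat -> A) l k :
  \sum_(j < l) F ((j + k) %% l)%N = \sum_(j < l) F j.
Proof.
case: l => [|l]; first by rewrite !big_ord0.
pose s (j : 'I_l.+1) : 'I_l.+1 := inord ((j + k) %% l.+1).
have sE j : s j = ((j + k) %% l.+1)%N :> nat by rewrite inordK // ltn_mod.
rewrite [RHS](reindex_inj (h := s)) /=; first by apply: eq_bigr => j _; rewrite sE.
move=> i j /(congr1 (@nat_of_ord _)) /eqP; rewrite !sE eqn_modDr !modn_small //.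
by move/eqP/val_inj.
Qed.

Lemma rotE l k g i j : (j < l)%N ->
  negrot (Z.of_nat l) (Z.of_nat k) g (Z.of_nat (i * l + j)) =
  ((-1) ^+ ((j + k) %/ l) * g (Z.of_nat (i * l + (j + k) %% l)))%R.
Proof.
move=> jl; rewrite /negrot.
have -> : (Z.of_nat (i * l + j) mod Z.of_nat l = Z.of_nat j)%K by symmetry; apply: (@Z.mod_unique_pos _ _ (Z.of_nat i)); lia.
have djk := divn_eq (j + k) l; have mjk : ((j + k) %% l < l)%N by rewrite ltn_mod; lia.
have -> : ((Z.of_nat j + Z.of_nat k) mod Z.of_nat l = Z.of_nat ((j + k) %% l))%K.
  by symmetry; apply: (@Z.mod_unique_pos _ _ (Z.of_nat ((j + k) %/ l))); nia.
have -> : ((Z.of_nat j + Z.of_nat k) / Z.of_nat l = Z.of_nat ((j + k) %/ l))%K.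
  by symmetry; apply: (@Z.div_unique_pos _ _ _ (Z.of_nat ((j + k) %% l))); nia.
have -> : (Z.of_nat (i * l + j) - Z.of_nat j + Z.of_nat ((j + k) %% l) = Z.of_nat (i * l + (j + k) %% l))%K by lia.
rewrite -signr_odd; set q := (_ %/ _)%N.
have -> : (Z.of_nat q mod 2 = Z.of_nat (odd q))%K.
  by symmetry; apply: (@Z.mod_unique_pos _ _ (Z.of_nat q./2)); have := odd_double_half q; case: (odd q); lia.
 by case: (odd q) => /=; rewrite ?expr1 ?expr0.
Qed.

(** If j + k = q l + r with r < l, then Y^j Y^k = (-1)^q Y^r. The sign (-1)^q also stands in
    [negrot], so it occurs twice and cancels. *)
Lemma val_rot h l k X Y g : Y ^+ l = -1 ->
  Y ^+ k * val h l X Y (negrot (Z.of_nat l) (Z.of_nat k) g) = val h l X Y g.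
Proof.
move=> Yl; rewrite /val mulr_sumr; apply: eq_bigr => i _.
rewrite mulr_sumr -[RHS](@sum_rot (fun j => phi (g (Z.of_nat (i * l + j))) * X ^+ i * Y ^+ j) _ k).
apply: eq_bigr => j _; rewrite rotE // rmorphM rmorphXn rmorphN1.
have Yjk : Y ^+ j * Y ^+ k = (-1) ^+ ((j + k) %/ l) * Y ^+ ((j + k) %% l).
  by rewrite -exprD {1}(divn_eq (j + k) l) exprD mulnC exprM Yl.
set q := (_ %/ _)%N in Yjk *; set r := (_ %% _)%N in Yjk *.
transitivity ((-1) ^+ q * phi (g (Z.of_nat (i * l + r))) * X ^+ i * (Y ^+ j * Y ^+ k)); first by ring.
rewrite Yjk; transitivity ((-1) ^+ (q + q) * (phi (g (Z.of_nat (i * l + r))) * X ^+ i * Y ^+ r)).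
  by rewrite exprD; ring.
by rewrite addnn -mul2n exprM sqrrN expr1n expr1n mul1r.
Qed.
End Val.

(* [f] represents the polynomial sum_(i < h, j < l) f(i l + j) x^i y^j; the
   product is taken modulo y^l + 1 and x^h - y^e. *)
Definition twisted_product (h l e sc : nat) (u v r : Z -> Z) : Prop :=
  forall (A : comNzRingType) (phi : {rmorphism Z -> A}) (X Y : A),
    Y ^+ l = -1 ->
    exists a : A, val phi h l X Y r =
      2%:R ^+ sc * (val phi h l X Y u * val phi h l X Y v) + a * (X ^+ h - Y ^+ e).

(** Chinese remaindering for H^2 - E^2 = (H - E)(H + E) with H = X^h, E = Y^e; the second modulus is
    H - Y^(e + l) because Y^l = -1. With Z = E^(-1), the recombination (1 + Z H) R0 + (1 - Z H) R1
    reduces to 2 R0 modulo H - E and to 2 R1 modulo H + E. Dividing by 2 is avoided, which is why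
    the exponent of the scaling factor grows by one. *)
Lemma split_product h l e sc u v r0 r1 r :
  (e <= 2 * l)%N ->
  twisted_product h l e sc (split_lo (Z.of_nat l) (Z.of_nat e) (Z.of_nat (h * l)) u) (split_lo (Z.of_nat l) (Z.of_nat e) (Z.of_nat (h * l)) v) r0 ->
  twisted_product h l (e + l) sc (split_hi (Z.of_nat l) (Z.of_nat e) (Z.of_nat (h * l)) u) (split_hi (Z.of_nat l) (Z.of_nat e) (Z.of_nat (h * l)) v) r1 ->
  (forall t, (0 <= t < Z.of_nat (h * l))%K -> r t = (r0 t + r1 t)%K) ->
  (forall t, (0 <= t < Z.of_nat (h * l))%K -> r (Z.of_nat (h * l) + t)%K =
    negrot (Z.of_nat l) (Z.of_nat e) (fun t => r0 t - r1 t)%K t) ->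
  twisted_product (h + h) l (e + e) sc.+1 u v r.
Proof.
move=> el P0 P1 rlo rhi A phi X Y Yl.
have [a0 E0] := P0 A phi X Y Yl; have [a1 E1] := P1 A phi X Y Yl.
have Y2l : Y ^+ (2 * l) = 1 by rewrite mulnC exprM Yl sqrrN expr1n.
have ke : (2 * Z.of_nat l - Z.of_nat e)%K = Z.of_nat (2 * l - e) by lia.
have EZ : Y ^+ e * Y ^+ (2 * l - e) = 1 by rewrite -exprD subnKC.
have rotY f : val phi h l X Y (negrot (Z.of_nat l) (Z.of_nat (2 * l - e)) f) = Y ^+ e * val phi h l X Y f.
  by rewrite -(@val_rot A phi h l (2 * l - e) X Y f Yl) mulrA EZ mul1r.
have rotZ f : val phi h l X Y (negrot (Z.of_nat l) (Z.of_nat e) f) = Y ^+ (2 * l - e) * val phi h l X Y f.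
  by rewrite -(@val_rot A phi h l e X Y f Yl) mulrA [_ * Y ^+ e]mulrC EZ mul1r.
rewrite /split_lo ke !valD !rotY in E0; rewrite /split_hi ke !valB !rotY in E1.
rewrite !val_double (eq_val phi X Y rlo) (eq_val phi X Y rhi) rotZ valB valD E0 E1.
rewrite ![_ ^+ (_ + _)]exprD Yl exprS.
move: EZ; set E := Y ^+ e; set Z := Y ^+ (_ - _) => EZ; set H := X ^+ h.
set a := val _ _ _ _ _ u; set b := val _ _ _ _ _ (fun t => u _).
set c := val _ _ _ _ _ v; set d := val _ _ _ _ _ (fun t => v _).
(* The first two terms carry over the quotients of the two parts; the last one accounts for
   replacing E^2 b d by H^2 b d. *)
exists (Z * a0 - Z * a1 - 2%:R * 2%:R ^+ sc * b * d).
set q := 2%:R ^+ sc.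
apply/subr0_eq.
transitivity ((1 - E * Z) * (a0 * (H - E) + a1 * (H + E) - 2%:R * q * H * (a * d + b * c))).
  by ring.
by rewrite EZ subrr mul0r.
Qed.


Section ValPoly.
Variables (A : comNzRingType) (phi : {rmorphism Z -> A}).
Let psi : {rmorphism Z -> {poly A}} := (polyC \o phi)%FUN.

Lemma val_polyE m l (y : A) f :
  val psi m l 'X y%:P f =
  \poly_(i < m) \sum_(j < l) phi (f (Z.of_nat (i * l + j)%N)) * y ^+ j.
Proof.
rewrite poly_def; apply: eq_bigr => i _; rewrite scaler_suml; apply: eq_bigr => j _.
by rewrite /= -mul_polyC polyCM -rmorphXn /=; ring.
Qed.

Lemma size_val m l (y : A) f : (size (val psi m l 'X y%:P f) <= m)%N.
Proof. by rewrite val_polyE size_poly. Qed.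

Lemma horner_val m l (x y : A) f : (val psi m l 'X y%:P f).[x] = val phi m l x y f.
Proof.
rewrite val_polyE horner_poly; apply: eq_bigr => i _; rewrite mulr_suml.
by apply: eq_bigr => j _; ring.
Qed.

(** Substituting Y for x and Y^m for y undoes the change of variables: x^i y^j becomes Y^(i + m j),
    and (j, i) -> i + m j is a bijection onto the indices below m l. *)
Lemma val_dup m l Y f :
  val phi m l Y (Y ^+ m) (dup_read (Z.of_nat m) (Z.of_nat l) f) = val phi 1 (m * l) 1 Y f.
Proof.
rewrite /val big_ord_recl big_ord0 addr0 /=.
case: m => [|m]; first by rewrite !big_ord0.
case: l => [|l]; first by rewrite muln0 big_ord0 big1 // => i _; rewrite big_ord0.
rewrite exchange_big /= pair_bigA /=.
have lt_ij (p : 'I_l.+1 * 'I_m.+1) : (p.2 + m.+1 * p.1 < m.+1 * l.+1)%N.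
  by have := ltn_ord p.1; have := ltn_ord p.2; nia.
pose g (p : 'I_l.+1 * 'I_m.+1) := Ordinal (lt_ij p).
rewrite [RHS](reindex g) /=; last first.
  exists (fun t : 'I_(m.+1 * l.+1) => (inord (t %/ m.+1), inord (t %% m.+1))).
    move=> [i j] _; congr pair; apply/val_inj; rewrite /= inordK ?ltn_mod //=;
    by rewrite addnC mulnC ?divnMDl ?modnMDl ?divn_small ?modn_small ?addn0 //; have := ltn_ord j; have := ltn_ord i; lia.
  move=> t _; apply/val_inj; rewrite /= !inordK ?ltn_mod ?ltn_divLR //; last by have := ltn_ord t; lia.
  by rewrite addnC mulnC -divn_eq.
apply: eq_bigr => -[j i] _ /=; rewrite expr1n mulr1 -exprM -mulrA -exprD.
congr (phi _ * _); rewrite /dup_read; congr f.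
have hi := ltn_ord i; have hj := ltn_ord j.
have -> : (Z.of_nat (i * l.+1 + j) / Z.of_nat l.+1 = Z.of_nat i)%K.
  by symmetry; apply: (@Z.div_unique_pos _ _ _ (Z.of_nat j)); lia.
have -> : (Z.of_nat (i * l.+1 + j) mod Z.of_nat l.+1 = Z.of_nat j)%K.
  by symmetry; apply: (@Z.mod_unique_pos _ _ (Z.of_nat i)); lia.
by rewrite mul0n add0n; lia.
Qed.
End ValPoly.

(** Over A[X], with X a genuine indeterminate and y the constant Y^m, the two parts give 2^(sc+1) U
    V modulo X^(2m) - 1. Both sides have degree below 2m, so the congruence is an equality, and X
    may then be specialised to Y, which returns to one variable. *)
Lemma dup_product m l e sc u v r0 r1 r :
  (0 < m)%N -> (0 < l)%N ->
  twisted_product m l 0 sc (dup_read (Z.of_nat m) (Z.of_nat l) u) (dup_read (Z.of_nat m) (Z.of_nat l) v) r0 ->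
  twisted_product m l l sc (dup_read (Z.of_nat m) (Z.of_nat l) u) (dup_read (Z.of_nat m) (Z.of_nat l) v) r1 ->
  (forall t, (0 <= t < Z.of_nat (m * l))%K ->
     let z := ((t mod Z.of_nat m) * Z.of_nat l + t / Z.of_nat m)%K in
     r t = (r0 z + r1 z + negrot (Z.of_nat l) (2 * Z.of_nat l - 1) (fun t => r0 t - r1 t) z)%K) ->
  twisted_product 1 (m * l) e sc.+1 u v r.
Proof.
move=> m0 l0 P0 P1 rE A phi X Y Yl.
pose psi : {rmorphism Z -> {poly A}} := (polyC \o phi)%FUN.
have Yml : ((Y ^+ m)%:P : {poly A}) ^+ l = -1 by rewrite -rmorphXn /= -exprM Yl rmorphN1.
have [a0 E0] := P0 _ psi 'X (Y ^+ m)%:P Yml; have [a1 E1] := P1 _ psi 'X (Y ^+ m)%:P Yml.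
have val1 f : val phi 1 (m * l) X Y f = val phi 1 (m * l) 1 Y f.
  by rewrite /val !big_ord_recl !big_ord0.
exists 0; rewrite mul0r addr0 !val1 -!val_dup.
set R0 := val _ _ _ _ _ r0 in E0; set R1 := val _ _ _ _ _ r1 in E1.
set U := val _ _ _ _ _ _ in E0 E1; set V := val _ _ _ _ _ (dup_read (Z.of_nat m) (Z.of_nat l) v) in E0 E1.
rewrite Yml expr0 in E0 E1.
have sz p : (size (val psi m l 'X (Y ^+ m)%:P p) <= m)%N by apply: size_val.
have key : (1 + 'X^m) * R0 + (1 - 'X^m) * R1 = 2%:R ^+ sc.+1 * (U * V).
  have E : (1 + 'X^m) * R0 + (1 - 'X^m) * R1 - 2%:R ^+ sc.+1 * (U * V) = (a0 - a1) * ('X^(m + m) - 1).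
    by rewrite E0 E1 exprS exprD; ring.
  have mon : ('X^(m + m) - 1 : {poly A}) \is monic by rewrite monicXnsubC // addn_gt0 m0.
  (* A nonzero multiple of a monic polynomial of degree 2m has size above 2m, over any commutative
     ring; the difference of the two sides has size at most 2m. *)
  case: (eqVneq (a0 - a1) 0) => [a01|a01]; first by apply/subr0_eq; rewrite E a01 mul0r.
  have /(congr1 (fun p : {poly A} => size p)) := E.
  rewrite size_Mmonic // size_XnsubC ?addn_gt0 ?m0 // => sE.
  have : (size ((1 + 'X^m) * R0 + (1 - 'X^m) * R1 - 2%:R ^+ sc.+1 * (U * V))%R <= m + m)%N.
    have sq (c : A) (q : {poly A}) : (size q <= m)%N -> (size ((1 + c *: 'X^m) * q : {poly A})%R <= m + m)%N.
      move=> sq; apply: (leq_trans (size_polyMleq _ _)).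
      have : (size (1 + c *: 'X^m : {poly A})%R <= m.+1)%N.
        apply: (leq_trans (size_polyD _ _)); rewrite geq_max size_poly1 /=.
        by apply: (leq_trans (size_scale_leq _ _)); rewrite size_polyXn.
      by lia.
    apply: (leq_trans (size_polyD _ _)); rewrite geq_max size_polyN; apply/andP; split.
      apply: (leq_trans (size_polyD _ _)); rewrite geq_max; apply/andP; split.
        by have := sq 1 R0 (sz _); rewrite scale1r.
      by have := sq (-1) R1 (sz _); rewrite scaleN1r.
    have -> : 2%:R ^+ sc.+1 * (U * V) = (2%:R ^+ sc.+1 : A) *: (U * V).
      by rewrite -mul_polyC rmorphXn rmorph_nat.
    apply: (leq_trans (size_scale_leq _ _)).
    apply: (leq_trans (size_polyMleq _ _)).
    by apply: (leq_trans (leq_pred _)); apply: leq_add; apply: sz.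
  by rewrite sE; move: a01; rewrite -size_poly_gt0; lia.
have := congr1 (fun p : {poly A} => p.[Y]) key.
rewrite !(hornerE, hornerXn) !horner_val.
move=> key2; transitivity ((1 + Y ^+ m) * val phi m l Y (Y ^+ m) r0 +
  (1 - Y ^+ m) * val phi m l Y (Y ^+ m) r1); last by exact: key2.
rewrite (@eq_val A phi m l Y (Y ^+ m) _ (fun t => (r0 t + r1 t + negrot (Z.of_nat l) (Z.of_nat (2 * l - 1)) (fun t => r0 t - r1 t) t)%K)).
  have Yl' : (Y ^+ m) ^+ l = -1 by rewrite -exprM.
  rewrite !valD; have := @val_rot A phi m l (2 * l - 1) Y (Y ^+ m) (fun t => r0 t - r1 t)%K Yl'.
  rewrite valB; set N := val _ _ _ _ _ (negrot _ _ _) => NE.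
  (* Rotating by 2l - 1 is multiplication by y, since y^(2l) = 1; this is the factor X^m of the
     recombination after X has become Y. *)
  have -> : N = Y ^+ m * ((Y ^+ m) ^+ (2 * l - 1) * N).
    rewrite mulrA -exprS; have -> : ((2 * l - 1).+1 = l * 2)%N by lia.
    by rewrite exprM Yl' sqrrN expr1n mul1r.
  by rewrite NE; ring.
move=> t tl; rewrite /dup_read.
have q0 : (0 <= t / Z.of_nat l < Z.of_nat m)%K.
  by split; [apply: Z.div_pos | apply: Z.div_lt_upper_bound]; lia.
have m1 : (0 <= t mod Z.of_nat l < Z.of_nat l)%K by apply: Z.mod_pos_bound; lia.
have tE : (t = Z.of_nat l * (t / Z.of_nat l) + t mod Z.of_nat l)%K by apply: Z.div_mod; lia.
rewrite rE; last by nia.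
have -> : ((t / Z.of_nat l + Z.of_nat m * (t mod Z.of_nat l)) mod Z.of_nat m = t / Z.of_nat l)%K.
  by symmetry; apply: (@Z.mod_unique_pos _ _ (t mod Z.of_nat l)%K); lia.
have -> : ((t / Z.of_nat l + Z.of_nat m * (t mod Z.of_nat l)) / Z.of_nat m = t mod Z.of_nat l)%K.
  by symmetry; apply: (@Z.div_unique_pos _ _ _ (t / Z.of_nat l)%K); lia.
rewrite (_ : t / Z.of_nat l * Z.of_nat l + t mod Z.of_nat l = t)%K; last by lia.
by congr (_ + negrot _ _ _ _)%K; lia.
Qed.

(** The formula for multiplying complex numbers. There is only one row in x, so the congruence holds
    with quotient 0 whatever [e] is. *)
Lemma base_product e u v r :
  r 0%K = (u 0 * v 0 - u 1 * v 1)%K -> r 1%K = (u 0 * v 1 + u 1 * v 0)%K ->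
  twisted_product 1 2 e 0 u v r.
Proof.
move=> r0 r1 A phi X Y Y2; exists 0; rewrite mul0r addr0 expr0 mul1r.
rewrite /val !big_ord_recl !big_ord0 /= r0 r1 !(rmorphB phi, rmorphD phi, rmorphM phi) /=.
rewrite !expr0 !mulr1 !expr1 !addr0.
set a := phi (u 0); set b := phi (u _); set c := phi (v 0); set d := phi (v _).
apply/subr0_eq; transitivity (- (b * d) * (Y ^+ 2 + 1)); first by ring.
by rewrite Y2 addNr mulr0.
Qed.

Definition polyZ (n : nat) (f : Z -> Z) : {poly Z} := \poly_(i < n) f (Z.of_nat i).

Lemma sumZE n f : sumZ n f = \sum_(i < n) f (Z.of_nat i).
Proof. by elim: n => [|n IH]; rewrite ?big_ord0 // big_ord_recr /= IH. Qed.

Lemma conv_coef n f g (c : nat) : (c < n)%N ->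
  conv f g (Z.of_nat c) = (polyZ n f * polyZ n g)`_c.
Proof.
move=> cn; rewrite /conv sumZE coefM.
have -> : Z.to_nat (Z.of_nat c + 1)%K = c.+1 by lia.
apply: eq_bigr => i _; rewrite !coef_poly.
have ic : (i <= c)%N by have := ltn_ord i; lia.
have -> : (i < n)%N by lia.
have -> : (c - i < n)%N by lia.
by congr (_ * g _)%K; lia.
Qed.

Lemma conv_comm f g c : conv f g c = conv g f c.
Proof.
case: (Z_lt_le_dec c 0) => c0.
  by rewrite /conv; have -> : Z.to_nat (c + 1)%K = 0%N by lia.
have -> : c = Z.of_nat (Z.to_nat c) by lia.
by rewrite !(@conv_coef (Z.to_nat c).+1) // mulrC.
Qed.

Lemma triples_coef (r : nat) f g h :
  triples (Z.of_nat r) f g h = (polyZ r.+1 f * (polyZ r.+1 g * polyZ r.+1 h))`_r.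
Proof.
rewrite /triples sumZE coefM.
have -> : Z.to_nat (Z.of_nat r + 1)%K = r.+1 by lia.
apply: eq_bigr => i _; have ir := ltn_ord i.
have -> : (Z.of_nat r - Z.of_nat i)%K = Z.of_nat (r - i) by lia.
by rewrite (@conv_coef r.+1) ?coef_poly ?ir //; lia.
Qed.

Lemma triples_rot r f g h : (0 <= r)%K -> triples r f g h = triples r g h f.
Proof.
move=> r0; have -> : r = Z.of_nat (Z.to_nat r) by lia.
by rewrite !triples_coef mulrC mulrA.
Qed.

(** The ring is Z[X]/(X^n + 1) with y the class of X. Both factors vanish from n/2 on, so their
    product has degree below n and is not changed by the reduction. *)
Lemma product_conv (m n sc : nat) u v r :
  (0 < m)%N -> n = (m + m)%N ->
  twisted_product 1 n 0 sc u v r ->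
  (forall t, (Z.of_nat m <= t < Z.of_nat n)%K -> u t = 0%K /\ v t = 0%K) ->
  forall t, (0 <= t < Z.of_nat n)%K -> r t = (2 ^ Z.of_nat sc * conv u v t)%K.
Proof.
move=> m0 nE P uv0 t tn.
pose h : {poly Z} := 'X^n + 1.
have n0 : (0 < n)%N by lia.
have hm : h \is monic by rewrite /h -[1]opprK -polyCN monicXnsubC.
have sh : size h = n.+1 by rewrite /h -[1]opprK -polyCN size_XnsubC.
(* The quotient is taken by [mk_monic h], which is [h] itself because [h] is monic and not
   constant. *)
have mkh : qpoly.mk_monic h = h by rewrite /qpoly.mk_monic sh hm ltnS n0.
pose phi : {rmorphism Z -> qpoly.qpoly h} := (qpoly.in_qpoly h \o polyC)%FUN.
have valE f : val phi 1 n 1 (qpoly.in_qpoly h 'X) f = qpoly.in_qpoly h (polyZ n f).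
  rewrite /val big_ord1 /polyZ poly_def raddf_sum; apply: eq_bigr => i _ /=.
  by rewrite expr1n mulr1 mul0n add0n -mul_polyC rmorphM rmorphXn.
have hX : qpoly.in_qpoly h 'X ^+ n = -1.
  rewrite -rmorphXn; apply/eqP; rewrite -subr_eq0 opprK -(rmorph1 (qpoly.in_qpoly h)) -rmorphD.
  by apply/eqP/val_inj; rewrite /= mkh rmodpp.
(* The choice x = 1 makes the modulus x^1 - y^0 vanish, so the unknown quotient disappears. *)
have [a] := P _ phi 1 _ hX.
rewrite expr1n expr0 subrr mulr0 addr0 !valE -rmorphM.
rewrite -[2%:R](rmorph_nat (qpoly.in_qpoly h)) -rmorphXn -rmorphM.
move=> /(congr1 (fun q : qpoly.qpoly h => polyseq (qpoly.polyn q))) /= /val_inj; rewrite mkh.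
have szuv : (size (polyZ n u * polyZ n v)%R <= n)%N.
  have szf f : (forall t, (Z.of_nat m <= t < Z.of_nat n)%K -> f t = 0%K) -> (size (polyZ n f) <= m)%N.
    move=> f0; apply/leq_sizeP => i mi; rewrite coef_poly; case: ltnP => // ni.
    by rewrite f0 //; lia.
  apply: (leq_trans (size_polyMleq _ _)); apply: (leq_trans (leq_pred _)).
  have su : (size (polyZ n u) <= m)%N by apply: szf => x /uv0 [].
  have sv : (size (polyZ n v) <= m)%N by apply: szf => x /uv0 [].
  by rewrite [leqRHS]nE; apply: leq_add.
rewrite !rmodp_small ?sh ?ltnS ?size_poly //; last first.
  have -> : 2%:R ^+ sc = (2%:R ^+ sc : Z)%:P by rewrite rmorphXn rmorph_nat.
  by rewrite mul_polyC; apply: (leq_trans (size_scale_leq _ _)).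
have -> : 2%:R ^+ sc = (2%:R ^+ sc : Z)%:P by rewrite rmorphXn rmorph_nat.
move=> /(congr1 (fun p : {poly Z} => p`_(Z.to_nat t))).
rewrite coefCM -conv_coef; last by lia.
rewrite coef_poly; have -> : (Z.to_nat t < n)%N by lia.
rewrite Z2Nat.id; last by lia.
move=> ->; congr (_ * _)%K.
elim: (sc) => [|k IH]; first by rewrite expr0.
by rewrite exprS IH Nat2Z.inj_succ Z.pow_succ_r //; lia.
Qed.


Lemma split_productZ h l e sc u v r0 r1 r :
  (0 < h)%K -> (0 < l)%K -> (0 <= e <= 2 * l)%K ->
  twisted_product (Z.to_nat h) (Z.to_nat l) (Z.to_nat e) sc
    (split_lo l e (h * l)%K u) (split_lo l e (h * l)%K v) r0 ->
  twisted_product (Z.to_nat h) (Z.to_nat l) (Z.to_nat (e + l)%K) sc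
    (split_hi l e (h * l)%K u) (split_hi l e (h * l)%K v) r1 ->
  (forall t, (0 <= t < h * l)%K -> r t = (r0 t + r1 t)%K) ->
  (forall t, (0 <= t < h * l)%K -> r (h * l + t)%K =
    negrot l e (fun t => r0 t - r1 t)%K t) ->
  twisted_product (Z.to_nat (2 * h)%K) (Z.to_nat l) (Z.to_nat (2 * e)%K) (S sc) u v r.
Proof.
move=> h0 l0 e0.
have hE : h = Z.of_nat (Z.to_nat h) by lia.
have lE : l = Z.of_nat (Z.to_nat l) by lia.
have eE : e = Z.of_nat (Z.to_nat e) by lia.
move: (Z.to_nat h) (Z.to_nat l) (Z.to_nat e) hE lE eE => hn ln en hE lE eE.
subst h l e.
have -> : (2 * Z.of_nat hn)%K = Z.of_nat (hn + hn) by lia.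
have -> : (2 * Z.of_nat en)%K = Z.of_nat (en + en) by lia.
have -> : (Z.of_nat hn * Z.of_nat ln)%K = Z.of_nat (hn * ln) by lia.
have -> : (Z.of_nat en + Z.of_nat ln)%K = Z.of_nat (en + ln) by lia.
rewrite !Nat2Z.id => P0 P1 r0E r1E.
by apply: split_product P0 P1 r0E r1E; lia.
Qed.

Lemma dup_productZ m l e sc u v r0 r1 r :
  (0 < m)%K -> (0 < l)%K ->
  twisted_product (Z.to_nat m) (Z.to_nat l) 0 sc (dup_read m l u) (dup_read m l v) r0 ->
  twisted_product (Z.to_nat m) (Z.to_nat l) (Z.to_nat l) sc (dup_read m l u) (dup_read m l v) r1 ->
  (forall t, (0 <= t < m * l)%K ->
     let z := ((t mod m) * l + t / m)%K in
     r t = (r0 z + r1 z + negrot l (2 * l - 1) (fun t => r0 t - r1 t) z)%K) ->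
  twisted_product 1 (Z.to_nat (m * l)%K) e (S sc) u v r.
Proof.
move=> m0 l0.
have mE : m = Z.of_nat (Z.to_nat m) by lia.
have lE : l = Z.of_nat (Z.to_nat l) by lia.
move: (Z.to_nat m) (Z.to_nat l) mE lE => mn ln mE lE; subst m l.
have -> : (Z.of_nat mn * Z.of_nat ln)%K = Z.of_nat (mn * ln) by lia.
rewrite !Nat2Z.id => P0 P1 rE.
by apply: dup_product P0 P1 rE; lia.
Qed.

Lemma product_convZ m sc u v r :
  (0 < m)%K ->
  twisted_product 1 (Z.to_nat (2 * m)%K) 0 sc u v r ->
  (forall t, (m <= t < 2 * m)%K -> u t = 0%K /\ v t = 0%K) ->
  forall t, (0 <= t < 2 * m)%K -> r t = (2 ^ Z.of_nat sc * conv u v t)%K.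
Proof.
move=> m0 P uv t tn; apply: (product_conv (m := Z.to_nat m) _ _ P); try lia.
by move=> x xm; apply: uv; lia.
Qed.

End Negacyclic.

(** * Time-bounded execution *)

Declare Scope expr_scope.
Delimit Scope expr_scope with e.
Bind Scope expr_scope with expr.
Infix "+" := (Bin BAdd) : expr_scope.
Infix "-" := (Bin BSub) : expr_scope.
Infix "*" := (Bin BMul) : expr_scope.
Infix "/" := (Bin BDiv) : expr_scope.
Notation "a 'mod' b" := (Bin BMod a b) : expr_scope.
Infix "<?" := (Bin BLt) : expr_scope.
Infix "=?" := (Bin BEq) : expr_scope.
Notation "# c" := (Const c) (at level 2, c at level 1) : expr_scope.
Notation "$ r" := (Reg r) (at level 2, r at level 1) : expr_scope.

(* Memory is split into 32 interleaved arrays, so no array needs a size. *)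
Definition addr (tag : Z) (i : expr) : expr := (#32 * i + #tag)%e.
Definition cell (tag : Z) (i : expr) : expr := Fetch (addr tag i).
Definition arr (s : state) (tag i : Z) : Z := mem s (32 * i + tag).

Definition run (w : Z) (c : cmd) (s : state) (n : Z) (Q : state -> Prop) : Prop :=
  exists t s', exec w c s t s' /\ Z.of_nat t <= n /\ Q s'.

Definition ecost (e : expr) : Z := Z.of_nat (expr_cost e).

Lemma ecost_pos e : 1 <= ecost e.
Proof. unfold ecost; destruct e; cbn [expr_cost]; lia. Qed.

Lemma run_weaken w c s n n' (Q Q' : state -> Prop) :
  run w c s n Q -> n <= n' -> (forall s', Q s' -> Q' s') -> run w c s n' Q'.
Proof. intros (t & s' & H & Hn & HQ) Hle Himp; exists t, s'; repeat split; auto; lia. Qed.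

Lemma run_assign w r e s n (Q : state -> Prop) v :
  eval w s e = v -> 1 + ecost e <= n -> Q (set_reg r v s) -> run w (Assign r e) s n Q.
Proof.
  intros <- Hn HQ; eexists _, _; split; [apply exec_assign|].
  split; [unfold ecost in *; lia | auto].
Qed.

Lemma run_seq w c1 c2 s n1 n2 n Q :
  run w c1 s n1 (fun s1 => run w c2 s1 n2 Q) -> n1 + n2 + 1 <= n ->
  run w (Seq c1 c2) s n Q.
Proof.
  intros (t1 & s1 & H1 & Hn1 & t2 & s2 & H2 & Hn2 & HQ) Hn.
  exists (S (t1 + t2)), s2; split; [econstructor; eauto | split; [lia | auto]].
Qed.

Lemma run_if w e c1 c2 s n Q m :
  (eval w s e <> 0 -> run w c1 s m Q) -> (eval w s e = 0 -> run w c2 s m Q) ->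
  1 + ecost e + m <= n -> run w (If e c1 c2) s n Q.
Proof.
  intros H1 H2 Hn; unfold ecost in Hn; destruct (Z.eq_dec (eval w s e) 0) as [E|E].
  - destruct (H2 E) as (t & s' & Hx & Ht & HQ).
    exists (S (expr_cost e + t)), s'; split; [apply exec_if_false; auto | split; [lia | auto]].
  - destruct (H1 E) as (t & s' & Hx & Ht & HQ).
    exists (S (expr_cost e + t)), s'; split; [apply exec_if_true; auto | split; [lia | auto]].
Qed.

Lemma run_while w e c s (I : Z -> state -> Prop) N k n :
  0 <= N -> I 0 s ->
  (forall i s1, 0 <= i < N -> I i s1 -> eval w s1 e <> 0 /\ run w c s1 k (I (i + 1))) ->
  (forall s1, I N s1 -> eval w s1 e = 0) ->
  N * (k + 1 + ecost e) + 1 + ecost e <= n ->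
  run w (While e c) s n (I N).
Proof.
  intros HN H0 Hstep Hend Hn.
  assert (G : forall m i s1, N - i = Z.of_nat m -> 0 <= i -> I i s1 ->
    run w (While e c) s1 (Z.of_nat m * (k + 1 + ecost e) + 1 + ecost e) (I N)).
  { induction m as [|m IH]; intros i s1 Hm Hi HI.
    - assert (i = N) by lia; subst i.
      exists (S (expr_cost e)), s1; split; [apply exec_while_false; auto|].
      split; [unfold ecost; lia | auto].
    - destruct (Hstep i s1) as (Hne & t1 & s2 & Hx & Ht & HI2); [lia | auto |].
      destruct (IH (i + 1) s2) as (t2 & s3 & Hx2 & Ht2 & HI3); [lia | lia | auto |].
      exists (S (expr_cost e + t1 + t2)), s3; split; [eapply exec_while_true; eauto|].
      split; [unfold ecost in *; lia | auto]. }
  eapply run_weaken; [apply (G (Z.to_nat N) 0 s) | | auto]; try lia; auto.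
  rewrite Z2Nat.id; lia.
Qed.

(** Commands without loops are run by a function, so that their correctness and cost reduce to
    computation. *)
Fixpoint straight (c : cmd) : bool :=
  match c with
  | Skip | Assign _ _ | Store _ _ => true
  | Seq c1 c2 | If _ c1 c2 => andb (straight c1) (straight c2)
  | While _ _ => false
  end.

Fixpoint sexec (w : Z) (c : cmd) (s : state) : state :=
  match c with
  | Skip | While _ _ => s
  | Assign r e => set_reg r (eval w s e) s
  | Store a e => set_mem (eval w s a) (eval w s e) s
  | Seq c1 c2 => sexec w c2 (sexec w c1 s)
  | If e c1 c2 => if eval w s e =? 0 then sexec w c2 s else sexec w c1 s
  end.

Fixpoint scost (c : cmd) : Z :=
  match c with
  | Skip => 1
  | Assign r e => 1 + ecost e
  | Store a e => 1 + ecost a + ecost e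
  | Seq c1 c2 => 1 + scost c1 + scost c2
  | If e c1 c2 => 1 + ecost e + Z.max (scost c1) (scost c2)
  | While _ _ => 0
  end.

Lemma run_straight w c s n (Q : state -> Prop) :
  straight c = true -> scost c <= n -> Q (sexec w c s) -> run w c s n Q.
Proof.
  revert s n Q; induction c; intros s n Q Hs Hn HQ; cbn [straight scost sexec] in *.
  - exists 1%nat, s; split; [constructor | split; [lia | auto]].
  - eexists _, _; split; [apply exec_assign | split; [unfold ecost in *; lia | auto]].
  - eexists _, _; split; [apply exec_store | split; [unfold ecost in *; lia | auto]].
  - apply andb_prop in Hs; destruct Hs.
    apply run_seq with (n1 := scost c1) (n2 := scost c2); [|lia].
    apply IHc1; [auto | lia |]. apply IHc2; [auto | lia | auto].
  - apply andb_prop in Hs; destruct Hs.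
    apply run_if with (m := Z.max (scost c1) (scost c2)); [intros E|intros E|lia].
    + apply IHc1; auto; [lia|]. apply Z.eqb_neq in E; rewrite E in HQ; auto.
    + apply IHc2; auto; [lia|]. apply Z.eqb_eq in E; rewrite E in HQ; auto.
  - discriminate.
Qed.

Definition uop (o : binop) (x y : Z) : Z :=
  match o with
  | BAdd => x + y | BSub => x - y | BMul => x * y | BDiv => x / y
  | BMod => x mod y
  | BAnd => Z.land x y | BOr  => Z.lor x y | BXor => Z.lxor x y
  | BShl => Z.shiftl x y | BShr => Z.shiftr x y
  | BEq => if x =? y then 1 else 0
  | BLt => if x <? y then 1 else 0
  end.

(** Two kinds of arithmetic are kept apart. Indices and sizes never leave [0, 2^w) and are evaluated
    over Z under the condition [safe]; coefficients may be negative or overflow and are followed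
    modulo 2^w by [eval_add], [eval_sub] and [eval_mul]. *)
Fixpoint ueval (s : state) (e : expr) : Z :=
  match e with
  | Const c => c
  | Reg r => regs s r
  | Fetch a => mem s (ueval s a)
  | Bin o a b => uop o (ueval s a) (ueval s b)
  end.

Fixpoint safe (w : Z) (s : state) (e : expr) : Prop :=
  match e with
  | Const c => 0 <= c < 2 ^ w
  | Reg r => True
  | Fetch a => safe w s a
  | Bin o a b => safe w s a /\ safe w s b /\
      0 <= uop o (ueval s a) (ueval s b) < 2 ^ w
  end.

Lemma wrap_small w x : 0 <= x < 2 ^ w -> wrap w x = x.
Proof. apply Z.mod_small. Qed.

Lemma eval_safe w s e : safe w s e -> eval w s e = ueval s e.
Proof.
  induction e; cbn; intros H; auto.
  - apply wrap_small; auto.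
  - rewrite IHe; auto.
  - destruct H as (H1 & H2 & H3); rewrite IHe1, IHe2 by auto.
    unfold eval_binop; rewrite wrap_small; destruct o; auto.
Qed.

Lemma wrap_wrap w x : wrap w (wrap w x) = wrap w x.
Proof.
  (* For negative [w] the power is 0, and reduction modulo 0 is the identity. *)
  unfold wrap; destruct (Z.eq_dec (2 ^ w) 0) as [E|E].
  - rewrite E, !Zmod_0_r; reflexivity.
  - apply Z.mod_mod; auto.
Qed.

Lemma wrap_add w x y x' y' : wrap w x = wrap w x' -> wrap w y = wrap w y' ->
  wrap w (x + y) = wrap w (x' + y').
Proof. unfold wrap; intros H1 H2; rewrite Zplus_mod, H1, H2, <- Zplus_mod; auto. Qed.

Lemma wrap_sub w x y x' y' : wrap w x = wrap w x' -> wrap w y = wrap w y' ->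
  wrap w (x - y) = wrap w (x' - y').
Proof. unfold wrap; intros H1 H2; rewrite Zminus_mod, H1, H2, <- Zminus_mod; auto. Qed.

Lemma wrap_mul w x y x' y' : wrap w x = wrap w x' -> wrap w y = wrap w y' ->
  wrap w (x * y) = wrap w (x' * y').
Proof. unfold wrap; intros H1 H2; rewrite Zmult_mod, H1, H2, <- Zmult_mod; auto. Qed.

Lemma eval_add w s a b x y :
  wrap w (eval w s a) = wrap w x -> wrap w (eval w s b) = wrap w y ->
  wrap w (eval w s (a + b)%e) = wrap w (x + y).
Proof. intros; cbn; unfold eval_binop; rewrite wrap_wrap; apply wrap_add; auto. Qed.

Lemma eval_sub w s a b x y :
  wrap w (eval w s a) = wrap w x -> wrap w (eval w s b) = wrap w y ->
  wrap w (eval w s (a - b)%e) = wrap w (x - y).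
Proof. intros; cbn; unfold eval_binop; rewrite wrap_wrap; apply wrap_sub; auto. Qed.

Lemma eval_mul w s a b x y :
  wrap w (eval w s a) = wrap w x -> wrap w (eval w s b) = wrap w y ->
  wrap w (eval w s (a * b)%e) = wrap w (x * y).
Proof. intros; cbn; unfold eval_binop; rewrite wrap_wrap; apply wrap_mul; auto. Qed.

(** * Interleaved arrays and passes over them *)

Lemma arr_set_reg r v s tag i : arr (set_reg r v s) tag i = arr s tag i.
Proof. reflexivity. Qed.

Lemma arr_set_mem a v s tag i k j : a = 32 * j + k -> 0 <= k < 32 -> 0 <= tag < 32 ->
  arr (set_mem a v s) tag i = if andb (tag =? k) (i =? j) then v else arr s tag i.
Proof.
  intros -> Hk Ht; unfold arr; cbn [mem set_mem].
  destruct (Z.eqb_spec tag k), (Z.eqb_spec i j); cbn [andb];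
    destruct (Z.eqb_spec (32 * i + tag) (32 * j + k)); auto; lia.
Qed.

Lemma eval_addr w s tag e i :
  eval w s e = i -> 0 <= i -> 0 <= tag < 32 -> 32 * i + 32 < 2 ^ w ->
  eval w s (addr tag e) = 32 * i + tag.
Proof.
  intros He Hi Ht HW; unfold addr; cbn [eval]; rewrite He; unfold eval_binop.
  rewrite (wrap_small w 32), (wrap_small w tag), (wrap_small w (32 * i)), wrap_small; lia.
Qed.

Lemma eval_cell w s tag e i :
  eval w s e = i -> 0 <= i -> 0 <= tag < 32 -> 32 * i + 32 < 2 ^ w ->
  eval w s (cell tag e) = arr s tag i.
Proof. intros; unfold cell; cbn [eval]; rewrite (eval_addr w s tag e i) by auto; reflexivity. Qed.

Lemma ecost_addr tag e : ecost (addr tag e) = 4 + ecost e.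
Proof. unfold ecost, addr; cbn [expr_cost]; lia. Qed.

Lemma run_store w tag a e s n (Q : state -> Prop) i v :
  eval w s a = i -> 0 <= i -> 0 <= tag < 32 -> 32 * i + 32 < 2 ^ w ->
  eval w s e = v -> 5 + ecost a + ecost e <= n -> Q (set_mem (32 * i + tag) v s) ->
  run w (Store (addr tag a) e) s n Q.
Proof.
  intros Ha Hi Ht HW <- Hn HQ; eexists _, _; split; [apply exec_store|].
  rewrite (eval_addr w s tag a i) by auto; pose proof (ecost_addr tag a).
  split; [unfold ecost in *; lia | auto].
Qed.

(** The only loop that fills arrays: register 28 counts, and the expression [e] computes the entry
    from it. *)
Definition gather (tag : Z) (dst n e : expr) : cmd :=
  Seq (Assign 28 (#0))
    (While ($28 <? n)
      (Seq (Store (addr tag (dst + $28)) e) (Assign 28 ($28 + #1))))%e.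

(** The entries are described by a relation [P] because most of them are known only modulo 2^w. The
    hypothesis on [e] may use everything but register 28 and the window being written, so sources
    must lie outside the window. *)
Lemma run_gather w s tag dst n e d N (P : Z -> Z -> Prop) m :
  0 <= N -> 0 <= d -> 0 <= tag < 32 -> 32 * (d + N) + 32 < 2 ^ w ->
  (forall s', (forall r, r <> 28%nat -> regs s' r = regs s r) ->
     (forall k i, 0 <= k < 32 -> k <> tag \/ i < d \/ d + N <= i -> arr s' k i = arr s k i) ->
     0 <= regs s' 28 <= N ->
     eval w s' dst = d /\ eval w s' n = N /\
     (regs s' 28 < N -> P (regs s' 28) (eval w s' e))) ->
  (N + 1) * (18 + ecost dst + ecost n + ecost e) <= m ->
  run w (gather tag dst n e) s m (fun s' =>
    (forall r, r <> 28%nat -> regs s' r = regs s r) /\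
    (forall k i, 0 <= k < 32 -> k <> tag \/ i < d \/ d + N <= i -> arr s' k i = arr s k i) /\
    (forall t, 0 <= t < N -> P t (arr s' tag (d + t)))).
Proof.
  intros HN Hd Ht HW HE Hm.
  pose proof (ecost_pos dst); pose proof (ecost_pos n); pose proof (ecost_pos e).
  pose (I := fun (t : Z) (s' : state) =>
    (forall r, r <> 28%nat -> regs s' r = regs s r) /\
    (forall k i, 0 <= k < 32 -> k <> tag \/ i < d \/ d + N <= i -> arr s' k i = arr s k i) /\
    regs s' 28 = t /\
    (forall t', 0 <= t' < t -> P t' (arr s' tag (d + t')))).
  apply run_seq with (n1 := 2) (n2 := (N + 1) * (15 + ecost dst + ecost n + ecost e)); [|nia].
  apply run_straight; [reflexivity | cbn; lia |].
  cbn [sexec eval]; rewrite wrap_small by lia.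
  eapply run_weaken with (n := (N + 1) * (15 + ecost dst + ecost n + ecost e));
    [eapply run_while with (I := I) (N := N)
        (k := 12 + ecost dst + ecost e) | lia |].
  - exact HN.
  - unfold I; split; [|split; [|split]].
    + intros r Hr; cbn; destruct (Nat.eqb_spec r 28); congruence.
    + intros; apply arr_set_reg.
    + reflexivity.
    + intros; lia.
  - intros i s1 Hi (Hr & Ha & H28 & Hf).
    destruct (HE s1 Hr Ha) as (E1 & E2 & E3); [lia|].
    rewrite H28 in E3; specialize (E3 ltac:(lia)).
    split.
    + cbn [eval]; rewrite E2, H28; unfold eval_binop.
      rewrite (proj2 (Z.ltb_lt i N)), wrap_small; lia.
    + apply run_straight; [reflexivity | cbn [scost]; unfold ecost, addr; cbn [expr_cost]; lia |].
      cbn [sexec].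
      rewrite (eval_addr w s1 tag _ (d + i)); [| cbn [eval]; rewrite E1, H28; unfold eval_binop; apply wrap_small; lia | lia | lia | lia].
      assert (E4 : eval w (set_mem (32 * (d + i) + tag) (eval w s1 e) s1) ($28 + #1)%e = i + 1).
      { cbn [eval regs set_mem]; rewrite H28; unfold eval_binop.
        rewrite (wrap_small w 1), wrap_small; lia. }
      rewrite E4; unfold I; split; [|split; [|split]].
      * intros r Hr'; cbn; destruct (Nat.eqb_spec r 28); [congruence | auto].
      * intros k j Hk Hj; rewrite arr_set_reg, (arr_set_mem _ _ _ _ _ tag (d + i)) by (auto; lia).
        destruct (Z.eqb_spec k tag), (Z.eqb_spec j (d + i)); cbn [andb]; try (apply Ha; auto; fail); lia.
      * reflexivity.
      * intros t' Ht'; rewrite arr_set_reg, (arr_set_mem _ _ _ _ _ tag (d + i)) by (auto; lia).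
        rewrite Z.eqb_refl; cbn [andb]; destruct (Z.eqb_spec (d + t') (d + i)).
        -- replace t' with i by lia; auto.
        -- apply Hf; lia.
  - intros s1 (Hr & Ha & H28 & Hf).
    destruct (HE s1 Hr Ha) as (E1 & E2 & _); [lia|].
    cbn [eval]; rewrite E2, H28; unfold eval_binop; rewrite Z.ltb_irrefl.
    apply wrap_small; lia.
  - unfold ecost; cbn [expr_cost]; unfold ecost in *; nia.
  - intros s' (Hr & Ha & H28 & Hf); auto.
Qed.

(** * The product program *)

Lemma eval_eq w s e v : safe w s e -> ueval s e = v -> eval w s e = v.
Proof. intros H <-; apply eval_safe; auto. Qed.

Lemma row_index_bound h l k t : 0 <= t < h * l -> 0 < l ->
  0 <= t - t mod l + (t mod l + k) mod l < h * l.
Proof.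
  intros Ht Hl.
  pose proof (Z.mod_pos_bound (t mod l + k) l Hl).
  pose proof (Z.mod_pos_bound t l Hl); pose proof (Z.div_mod t l ltac:(lia)).
  assert (t / l < h) by (apply Z.div_lt_upper_bound; lia).
  assert (0 <= t / l) by (apply Z.div_pos; lia).
  nia.
Qed.

(** The sign -1 becomes the word 2^w - 1, so products with it are right only modulo 2^w. *)
Definition rsign (l k t : expr) : expr := (#1 - #2 * (((t mod l + k) / l) mod #2))%e.
Definition ridx (l k t : expr) : expr := (t - t mod l + (t mod l + k) mod l)%e.

Section Rot.
Variables (w : Z) (s : state) (el ek et : expr) (l k t : Z).
Hypotheses (Hel : eval w s el = l) (Hek : eval w s ek = k) (Het : eval w s et = t).
Hypotheses (Hl : 0 < l) (Hk : 0 <= k) (Ht : 0 <= t) (HW : 2 + t + l + k < 2 ^ w).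

Lemma eval_ridx : eval w s (ridx el ek et) = t - t mod l + (t mod l + k) mod l.
Proof.
  pose proof (Z.mod_pos_bound (t mod l + k) l Hl).
  pose proof (Z.mod_pos_bound t l Hl).
  pose proof (Z.mod_le t l Ht Hl).
  unfold ridx; cbn [eval]; rewrite Hel, Hek, Het; unfold eval_binop.
  rewrite (wrap_small w (t mod l)), (wrap_small w (t - t mod l)),
    (wrap_small w (t mod l + k)), (wrap_small w ((t mod l + k) mod l)), wrap_small; lia.
Qed.

Lemma eval_rot G g :
  wrap w (eval w s G) = wrap w (g (t - t mod l + (t mod l + k) mod l)) ->
  wrap w (eval w s (rsign el ek et * G)%e) = wrap w (negrot l k g t).
Proof.
  intros HG; apply eval_mul; [|exact HG].
  pose proof (Z.mod_pos_bound t l Hl).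
  pose proof (Z.mod_le t l Ht Hl).
  assert (0 <= (t mod l + k) / l <= t mod l + k).
  { split; [apply Z.div_pos; lia|]. apply Z.div_le_upper_bound; nia. }
  pose proof (Z.mod_pos_bound ((t mod l + k) / l) 2 ltac:(lia)).
  apply eval_sub; [cbn [eval]; apply wrap_wrap|].
  apply eval_mul; [cbn [eval]; apply wrap_wrap|].
  f_equal; cbn [eval]; rewrite Hel, Hek, Het; unfold eval_binop.
  rewrite (wrap_small w 2), (wrap_small w (t mod l)), (wrap_small w (t mod l + k)),
    (wrap_small w ((t mod l + k) / l)), wrap_small; lia.
Qed.
End Rot.

(* An entry of the stack of pending tasks, at index [k]: the factors at position [p] of
   arrays 11 and 12 are to be multiplied ([ty = 0]), or the products of their two parts
   recombined ([ty = 1]), modulo y^l + 1 and x^h - y^e. *)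
Definition frame (s : state) (k ty p h l e : Z) : Prop :=
  arr s 13 k = ty /\ arr s 14 k = p /\ arr s 15 k = h /\ arr s 16 k = l /\ arr s 17 k = e.

Definition push (ty p h l e : expr) : cmd :=
  Seq (Store (addr 13 ($20)) ty) (Seq (Store (addr 14 ($20)) p)
  (Seq (Store (addr 15 ($20)) h) (Seq (Store (addr 16 ($20)) l)
  (Seq (Store (addr 17 ($20)) e) (Assign 20 ($20 + #1)))))).

Lemma run_push w s ety ep eh el ee k ty p h l e n (Q : state -> Prop) :
  regs s 20 = k -> 0 <= k -> 32 * k + 64 < 2 ^ w ->
  (forall s', (forall r, regs s' r = regs s r) ->
    eval w s' ety = ty /\ eval w s' ep = p /\ eval w s' eh = h /\ eval w s' el = l /\ eval w s' ee = e) ->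
  40 + ecost ety + ecost ep + ecost eh + ecost el + ecost ee <= n ->
  (forall s', (forall r, r <> 20%nat -> regs s' r = regs s r) -> regs s' 20 = k + 1 ->
     frame s' k ty p h l e ->
     (forall tag i, 0 <= tag < 32 -> tag < 13 \/ 17 < tag \/ i <> k -> arr s' tag i = arr s tag i) ->
     Q s') ->
  run w (push ety ep eh el ee) s n Q.
Proof.
  intros Hk Hk0 HW HE Hn HQ.
  assert (E20 : forall s', (forall r, regs s' r = regs s r) -> eval w s' ($20)%e = k).
  { intros s' Hr; cbn [eval]; rewrite Hr; auto. }
  unfold push.
  assert (C20 : ecost ($20)%e = 1) by reflexivity.
  apply run_seq with (n1 := 6 + ecost ety) (n2 := n - 7 - ecost ety); [|lia].
  eapply run_store with (i := k); [apply E20; auto | lia | lia | lia | apply HE; auto | lia |].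
  apply run_seq with (n1 := 6 + ecost ep) (n2 := n - 14 - ecost ety - ecost ep); [|lia].
  eapply run_store with (i := k); [apply E20; auto | lia | lia | lia | apply HE; auto | lia |].
  apply run_seq with (n1 := 6 + ecost eh) (n2 := n - 21 - ecost ety - ecost ep - ecost eh); [|lia].
  eapply run_store with (i := k); [apply E20; auto | lia | lia | lia | apply HE; auto | lia |].
  apply run_seq with (n1 := 6 + ecost el) (n2 := n - 28 - ecost ety - ecost ep - ecost eh - ecost el); [|lia].
  eapply run_store with (i := k); [apply E20; auto | lia | lia | lia | apply HE; auto | lia |].
  apply run_seq with (n1 := 6 + ecost ee) (n2 := 5); [|lia].
  eapply run_store with (i := k); [apply E20; auto | lia | lia | lia | apply HE; auto | lia |].
  apply run_assign with (v := k + 1); [| cbv; congruence |].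
  { apply eval_eq; cbn [safe ueval uop regs set_mem]; rewrite Hk; repeat split; lia. }
  apply HQ.
  - intros r Hr; cbn; destruct (Nat.eqb_spec r 20); [congruence | auto].
  - reflexivity.
  - unfold frame; repeat split; rewrite arr_set_reg, !(arr_set_mem _ _ _ _ _ _ k) by (eauto; lia);
      cbn [Z.eqb Pos.eqb]; rewrite !Z.eqb_refl; reflexivity.
  - intros tag i Ht Hi.
    rewrite arr_set_reg.
    rewrite (arr_set_mem _ _ _ _ _ 17 k), (arr_set_mem _ _ _ _ _ 16 k), (arr_set_mem _ _ _ _ _ 15 k),
      (arr_set_mem _ _ _ _ _ 14 k), (arr_set_mem _ _ _ _ _ 13 k) by (auto; lia).
    destruct (Z.eqb_spec i k).
    + repeat match goal with |- context [tag =? ?c] => destruct (Z.eqb_spec tag c) end; cbn [andb]; auto; lia.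
    + rewrite !Bool.andb_false_r; auto.
Qed.

(** Registers of the product program: 20 is the height of the stack, 21 to 25 hold the fields of the
    current entry, 26 and 27 the two sides of the rectangle in the change of variables, 28 the loop
    counter, 29 the place of the two parts and 30 the size of one part. The entry to be split stores
    the exponent 2e of x^(2h) - y^(2e), hence the halving. *)
Definition split_rot : expr := (#2 * $24 - $25 / #2)%e.
Definition split_hi_expr (tag : Z) : expr :=
  (rsign ($24) split_rot ($28) * cell tag ($22 + $30 + ridx ($24) split_rot ($28)))%e.

Definition split_step (tag : Z) : cmd :=
  Seq (gather tag ($29) ($30) (cell tag ($22 + $28) + split_hi_expr tag))%e
      (gather tag ($29 + $30) ($30) (cell tag ($22 + $28) - split_hi_expr tag))%e.

Definition dup_expr (tag : Z) : expr := cell tag ($22 + ($28 / $27 + $26 * ($28 mod $27)))%e.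

(** Both copies are equal: the factors have degree below m in x and are already reduced modulo x^m -
    1 and modulo x^m + 1. *)
Definition dup_step (tag : Z) : cmd :=
  Seq (gather tag ($29) ($30) (dup_expr tag))%e
      (gather tag ($29 + $30) ($30) (dup_expr tag))%e.

Definition split_merge : cmd :=
  Seq (gather 11 ($22) ($30) (cell 11 ($29 + $28) + cell 11 ($29 + $30 + $28)))%e
      (gather 11 ($22 + $30) ($30)
         (rsign ($24) ($25 / #2) ($28) *
            (cell 11 ($29 + ridx ($24) ($25 / #2) ($28)) -
             cell 11 ($29 + $30 + ridx ($24) ($25 / #2) ($28)))))%e.

(** The inverse of the index map of [dup_read]: the old coefficient t = i + m j lies at i l + j. *)
Definition dup_index : expr := (($28 mod $26) * $27 + $28 / $26)%e.

Definition dup_merge : cmd :=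
  gather 11 ($22) ($30)
    (cell 11 ($29 + dup_index) + cell 11 ($29 + $30 + dup_index) +
       rsign ($27) (#2 * $27 - #1) dup_index *
         (cell 11 ($29 + ridx ($27) (#2 * $27 - #1) dup_index) -
          cell 11 ($29 + $30 + ridx ($27) (#2 * $27 - #1) dup_index)))%e.

Ltac ev_with :=
  repeat match goal with H : regs _ _ = _ |- _ => rewrite H end.

Ltac ev := apply eval_eq; cbn [safe ueval uop regs set_mem set_reg Nat.eqb]; ev_with; [repeat split; try lia | try lia].

Ltac costs :=
  repeat match goal with |- context [ecost ?e] => let v := eval cbv in (ecost e) in change (ecost e) with v end.

(** * The array passes of one task *)

Section Steps.
Variables (w : Z) (s : state) (p h l e sz c0 M : Z).
Hypotheses (HM : 32 * M + 64 < 2 ^ w) (H22 : regs s 22 = p) (H29 : regs s 29 = c0)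
  (H30 : regs s 30 = sz) (Hsz : sz = h * l) (Hh : 0 < h) (Hl : 0 < l)
  (Hp : 0 <= p) (Hpc : p + sz <= c0) (HcM : c0 + 2 * sz + 4 * l <= M).

Lemma run_split_step tag u :
  regs s 24 = l -> regs s 25 = 2 * e -> 0 <= e < l -> p + 2 * sz <= c0 ->
  0 <= tag < 32 ->
  (forall t, 0 <= t < 2 * sz -> wrap w (arr s tag (p + t)) = wrap w (u t)) ->
  run w (split_step tag) s ((sz + 1) * 400) (fun s' =>
    (forall r, r <> 28%nat -> regs s' r = regs s r) /\
    (forall k i, 0 <= k < 32 -> k <> tag \/ i < c0 \/ c0 + 2 * sz <= i -> arr s' k i = arr s k i) /\
    (forall t, 0 <= t < sz -> wrap w (arr s' tag (c0 + t)) = wrap w (split_lo l e sz u t)) /\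
    (forall t, 0 <= t < sz -> wrap w (arr s' tag (c0 + sz + t)) = wrap w (split_hi l e sz u t))).
Proof.
  intros H24 H25 He Hpc0 Htag Hu.
  assert (Hsz0 : 0 < sz) by nia.
  assert (Hlsz : l <= sz) by nia.
  (* Only the array below [c0] is assumed unchanged, so this serves the second pass as well, after
     the first has written from [c0] on. *)
  assert (K : forall s' t, (forall r, r <> 28%nat -> regs s' r = regs s r) ->
     (forall k i, 0 <= k < 32 -> k <> tag \/ i < c0 -> arr s' k i = arr s k i) ->
     regs s' 28 = t -> 0 <= t < sz ->
     wrap w (eval w s' (cell tag ($22 + $28)%e)) = wrap w (u t) /\
     wrap w (eval w s' (split_hi_expr tag)) =
       wrap w (negrot l (2 * l - e) (fun t => u (sz + t)) t)).
  { intros s' t Hr Ha H28 Ht.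
    assert (G22 : regs s' 22 = p) by (rewrite Hr by discriminate; auto).
    assert (G24 : regs s' 24 = l) by (rewrite Hr by discriminate; auto).
    assert (G25 : regs s' 25 = 2 * e) by (rewrite Hr by discriminate; auto).
    assert (G30 : regs s' 30 = sz) by (rewrite Hr by discriminate; auto).
    assert (De : 2 * e / 2 = e) by (rewrite Z.mul_comm; apply Z.div_mul; lia).
    assert (Er : eval w s' split_rot = 2 * l - e) by (unfold split_rot; ev; rewrite ?De; lia).
    split.
    - rewrite (eval_cell w s' tag _ (p + t)); [|ev|lia|lia|lia].
      rewrite Ha by lia; apply Hu; lia.
    - apply eval_rot; [cbn [eval]; auto | auto | cbn [eval]; auto | lia | lia | lia | lia | ].
      pose proof (row_index_bound h l (2 * l - e) t ltac:(lia) Hl) as Hb.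
      set (x := t - t mod l + _) in *.
      rewrite (eval_cell w s' tag _ (p + sz + x)); [|  | lia|lia|lia].
      + rewrite Ha by lia; rewrite <- Z.add_assoc; apply Hu; lia.
      + cbn [eval]. fold (eval w s' (ridx ($24) split_rot ($28))).
        rewrite (eval_ridx w s' _ _ _ l (2 * l - e) t); [ | cbn [eval]; auto | auto | cbn [eval]; auto | lia.. ].
        fold x; unfold eval_binop; rewrite G22, G30, (wrap_small w (p + sz)), wrap_small; lia. }
  unfold split_step.
  apply run_seq with (n1 := (sz + 1) * 199) (n2 := (sz + 1) * 199); [|lia].
  eapply run_weaken.
  { apply run_gather with (d := c0) (N := sz) (m := (sz + 1) * 199)
      (P := fun t v => wrap w v = wrap w (split_lo l e sz u t)); try lia; [|costs; lia].
    intros s' Hr Ha Ht. split; [cbn [eval]; rewrite Hr by discriminate; auto|].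
    split; [cbn [eval]; rewrite Hr by discriminate; auto|].
    intros Htn. destruct (K s' (regs s' 28) Hr ltac:(intros; apply Ha; lia) eq_refl ltac:(lia)).
    apply eval_add; auto. }
  { lia. }
  intros s1 (Hr1 & Ha1 & Hv1).
  eapply run_weaken.
  { apply run_gather with (d := c0 + sz) (N := sz) (m := (sz + 1) * 199)
      (P := fun t v => wrap w v = wrap w (split_hi l e sz u t)); try lia; [|costs; lia].
    intros s' Hr Ha Ht.
    assert (Hr' : forall r, r <> 28%nat -> regs s' r = regs s r).
    { intros r Hr28; rewrite Hr, Hr1 by auto; auto. }
    split; [ev; rewrite !Hr' by discriminate; lia|].
    split; [cbn [eval]; rewrite Hr' by discriminate; auto|].
    intros Htn.
    destruct (K s' (regs s' 28) Hr') as (E1 & E2); [|auto|lia|].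
    { intros; rewrite Ha, Ha1 by lia; auto. }
    apply eval_sub; auto. }
  { lia. }
  intros s2 (Hr2 & Ha2 & Hv2); split; [|split; [|split]].
  - intros r Hr; rewrite Hr2, Hr1; auto.
  - intros k i Hk Hi; rewrite Ha2, Ha1 by lia; auto.
  - intros t Ht; rewrite Ha2 by lia; auto.
  - intros t Ht; apply Hv2; auto.
Qed.

Lemma run_split_merge r0 r1 :
  regs s 24 = l -> regs s 25 = 2 * e -> 0 <= e < l -> p + 2 * sz <= c0 ->
  (forall t, 0 <= t < sz -> wrap w (arr s 11 (c0 + t)) = wrap w (r0 t)) ->
  (forall t, 0 <= t < sz -> wrap w (arr s 11 (c0 + sz + t)) = wrap w (r1 t)) ->
  run w split_merge s ((sz + 1) * 400) (fun s' =>
    (forall r, r <> 28%nat -> regs s' r = regs s r) /\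
    (forall k i, 0 <= k < 32 -> k <> 11 \/ i < p \/ p + 2 * sz <= i -> arr s' k i = arr s k i) /\
    (forall t, 0 <= t < sz -> wrap w (arr s' 11 (p + t)) = wrap w (r0 t + r1 t)) /\
    (forall t, 0 <= t < sz -> wrap w (arr s' 11 (p + sz + t)) =
       wrap w (negrot l e (fun t => r0 t - r1 t) t))).
Proof.
  intros H24 H25 He Hpc0 Hr0 Hr1.
  assert (Hsz0 : 0 < sz) by nia.
  assert (Hlsz : l <= sz) by nia.
  unfold split_merge.
  apply run_seq with (n1 := (sz + 1) * 199) (n2 := (sz + 1) * 199); [|lia].
  eapply run_weaken.
  { apply run_gather with (d := p) (N := sz) (m := (sz + 1) * 199)
      (P := fun t v => wrap w v = wrap w (r0 t + r1 t)); try lia; [|costs; lia].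
    intros s' Hr Ha Ht.
    assert (G29 : regs s' 29 = c0) by (rewrite Hr by discriminate; auto).
    assert (G30 : regs s' 30 = sz) by (rewrite Hr by discriminate; auto).
    split; [cbn [eval]; rewrite Hr by discriminate; auto|].
    split; [cbn [eval]; auto|].
    intros Htn; apply eval_add.
    - rewrite (eval_cell w s' 11 _ (c0 + regs s' 28)); [|ev|lia|lia|lia].
      rewrite Ha by lia; apply Hr0; lia.
    - rewrite (eval_cell w s' 11 _ (c0 + sz + regs s' 28)); [|ev|lia|lia|lia].
      rewrite Ha by lia; apply Hr1; lia. }
  { lia. }
  intros s1 (Hq1 & Ha1 & Hv1).
  eapply run_weaken.
  { apply run_gather with (d := p + sz) (N := sz) (m := (sz + 1) * 199)
      (P := fun t v => wrap w v = wrap w (negrot l e (fun t => r0 t - r1 t) t)); try lia; [|costs; lia].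
    intros s' Hr Ha Ht.
    assert (Hr' : forall r, r <> 28%nat -> regs s' r = regs s r).
    { intros r Hr28; rewrite Hr, Hq1 by auto; auto. }
    assert (G22 : regs s' 22 = p) by (rewrite Hr' by discriminate; auto).
    assert (G24 : regs s' 24 = l) by (rewrite Hr' by discriminate; auto).
    assert (G25 : regs s' 25 = 2 * e) by (rewrite Hr' by discriminate; auto).
    assert (G29 : regs s' 29 = c0) by (rewrite Hr' by discriminate; auto).
    assert (G30 : regs s' 30 = sz) by (rewrite Hr' by discriminate; auto).
    assert (De : 2 * e / 2 = e) by (rewrite Z.mul_comm; apply Z.div_mul; lia).
    assert (Er : eval w s' ($25 / #2)%e = e) by (ev; rewrite ?De; lia).
    split; [ev|]. split; [cbn [eval]; auto|].
    intros Htn.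
    apply eval_rot; [cbn [eval]; auto | auto | cbn [eval]; auto | lia | lia | lia | lia | ].
    pose proof (row_index_bound h l e (regs s' 28) ltac:(lia) Hl) as Hb.
    assert (Ex := eval_ridx w s' ($24) ($25 / #2) ($28) l e (regs s' 28) G24 Er eq_refl Hl ltac:(lia) ltac:(lia) ltac:(lia)).
    set (x := regs s' 28 - _ + _) in *.
    apply eval_sub.
    - rewrite (eval_cell w s' 11 _ (c0 + x)); [|  | lia|lia|lia].
      + rewrite Ha, Ha1 by lia; apply Hr0; lia.
      + change (eval_binop w BAdd (regs s' 29) (eval w s' (ridx ($24) ($25 / #2) ($28))) = c0 + x).
        rewrite Ex, G29; unfold eval_binop; rewrite wrap_small; lia.
    - rewrite (eval_cell w s' 11 _ (c0 + sz + x)); [|  | lia|lia|lia].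
      + rewrite Ha, Ha1 by lia; apply Hr1; lia.
      + change (eval_binop w BAdd (eval_binop w BAdd (regs s' 29) (regs s' 30)) (eval w s' (ridx ($24) ($25 / #2) ($28))) = c0 + sz + x).
        rewrite Ex, G29, G30; unfold eval_binop; rewrite (wrap_small w (c0 + sz)), wrap_small; lia. }
  { lia. }
  intros s2 (Hr2 & Ha2 & Hv2); split; [|split; [|split]].
  - intros r Hr; rewrite Hr2, Hq1; auto.
  - intros k i Hk Hi; rewrite Ha2, Ha1 by lia; auto.
  - intros t Ht; rewrite Ha2 by lia; auto.
  - intros t Ht; apply Hv2; auto.
Qed.

Lemma dup_index_bound t : 0 <= t < sz ->
  0 <= t / l < h /\ 0 <= t mod l < l /\ 0 <= t / l + h * (t mod l) < sz.
Proof.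
  intros Ht; pose proof (Z.mod_pos_bound t l Hl).
  assert (0 <= t / l < h) by (split; [apply Z.div_pos | apply Z.div_lt_upper_bound]; lia).
  repeat split; nia.
Qed.

Lemma run_dup_step tag u :
  regs s 26 = h -> regs s 27 = l -> 0 <= tag < 32 ->
  (forall t, 0 <= t < sz -> wrap w (arr s tag (p + t)) = wrap w (u t)) ->
  run w (dup_step tag) s ((sz + 1) * 400) (fun s' =>
    (forall r, r <> 28%nat -> regs s' r = regs s r) /\
    (forall k i, 0 <= k < 32 -> k <> tag \/ i < c0 \/ c0 + 2 * sz <= i -> arr s' k i = arr s k i) /\
    (forall t, 0 <= t < sz -> wrap w (arr s' tag (c0 + t)) = wrap w (dup_read h l u t)) /\
    (forall t, 0 <= t < sz -> wrap w (arr s' tag (c0 + sz + t)) = wrap w (dup_read h l u t))).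
Proof.
  intros H26 H27 Htag Hu.
  assert (Hsz0 : 0 < sz) by nia.
  assert (K : forall s' t, (forall r, r <> 28%nat -> regs s' r = regs s r) ->
     (forall k i, 0 <= k < 32 -> k <> tag \/ i < c0 -> arr s' k i = arr s k i) ->
     regs s' 28 = t -> 0 <= t < sz ->
     wrap w (eval w s' (dup_expr tag)) = wrap w (dup_read h l u t)).
  { intros s' t Hr Ha H28 Ht.
    assert (G22 : regs s' 22 = p) by (rewrite Hr by discriminate; auto).
    assert (G26 : regs s' 26 = h) by (rewrite Hr by discriminate; auto).
    assert (G27 : regs s' 27 = l) by (rewrite Hr by discriminate; auto).
    destruct (dup_index_bound t Ht) as (B1 & B2 & B3).
    unfold dup_expr; rewrite (eval_cell w s' tag _ (p + (t / l + h * (t mod l)))); [|ev; nia|lia|lia|lia].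
    rewrite Ha by lia; apply Hu; lia. }
  unfold dup_step.
  apply run_seq with (n1 := (sz + 1) * 199) (n2 := (sz + 1) * 199); [|lia].
  eapply run_weaken.
  { apply run_gather with (d := c0) (N := sz) (m := (sz + 1) * 199)
      (P := fun t v => wrap w v = wrap w (dup_read h l u t)); try lia; [|costs; lia].
    intros s' Hr Ha Ht. split; [cbn [eval]; rewrite Hr by discriminate; auto|].
    split; [cbn [eval]; rewrite Hr by discriminate; auto|].
    intros Htn; apply (K s' (regs s' 28) Hr ltac:(intros; apply Ha; lia) eq_refl ltac:(lia)). }
  { lia. }
  intros s1 (Hr1 & Ha1 & Hv1).
  eapply run_weaken.
  { apply run_gather with (d := c0 + sz) (N := sz) (m := (sz + 1) * 199)
      (P := fun t v => wrap w v = wrap w (dup_read h l u t)); try lia; [|costs; lia].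
    intros s' Hr Ha Ht.
    assert (Hr' : forall r, r <> 28%nat -> regs s' r = regs s r).
    { intros r Hr28; rewrite Hr, Hr1 by auto; auto. }
    split; [ev; rewrite !Hr' by discriminate; lia|].
    split; [cbn [eval]; rewrite Hr' by discriminate; auto|].
    intros Htn; apply (K s' (regs s' 28) Hr'); [|auto|lia].
    intros; rewrite Ha, Ha1 by lia; auto. }
  { lia. }
  intros s2 (Hr2 & Ha2 & Hv2); split; [|split; [|split]].
  - intros r Hr; rewrite Hr2, Hr1; auto.
  - intros k i Hk Hi; rewrite Ha2, Ha1 by lia; auto.
  - intros t Ht; rewrite Ha2 by lia; auto.
  - intros t Ht; apply Hv2; auto.
Qed.

Lemma run_dup_merge r0 r1 :
  regs s 26 = h -> regs s 27 = l ->
  (forall t, 0 <= t < sz -> wrap w (arr s 11 (c0 + t)) = wrap w (r0 t)) ->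
  (forall t, 0 <= t < sz -> wrap w (arr s 11 (c0 + sz + t)) = wrap w (r1 t)) ->
  run w dup_merge s ((sz + 1) * 400) (fun s' =>
    (forall r, r <> 28%nat -> regs s' r = regs s r) /\
    (forall k i, 0 <= k < 32 -> k <> 11 \/ i < p \/ p + sz <= i -> arr s' k i = arr s k i) /\
    (forall t, 0 <= t < sz -> let z := (t mod h) * l + t / h in
       wrap w (arr s' 11 (p + t)) =
       wrap w (r0 z + r1 z + negrot l (2 * l - 1) (fun t => r0 t - r1 t) z))).
Proof.
  intros H26 H27 Hr0 Hr1.
  assert (Hsz0 : 0 < sz) by nia.
  assert (Hlsz : l <= sz) by nia.
  assert (Hhsz : h <= sz) by nia.
  unfold dup_merge; apply run_gather with (d := p) (N := sz)
    (P := fun t v => let z := (t mod h) * l + t / h in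
       wrap w v = wrap w (r0 z + r1 z + negrot l (2 * l - 1) (fun t => r0 t - r1 t) z));
    try lia; [|costs; lia].
  intros s' Hr Ha Ht.
  assert (G22 : regs s' 22 = p) by (rewrite Hr by discriminate; auto).
  assert (G26 : regs s' 26 = h) by (rewrite Hr by discriminate; auto).
  assert (G27 : regs s' 27 = l) by (rewrite Hr by discriminate; auto).
  assert (G29 : regs s' 29 = c0) by (rewrite Hr by discriminate; auto).
  assert (G30 : regs s' 30 = sz) by (rewrite Hr by discriminate; auto).
  split; [cbn [eval]; auto|]. split; [cbn [eval]; auto|].
  intros Htn.
  set (t := regs s' 28) in *; set (z := (t mod h) * l + t / h); cbv zeta.
  assert (Bm := Z.mod_pos_bound t h Hh).
  assert (Bq : 0 <= t / h < l) by (split; [apply Z.div_pos | apply Z.div_lt_upper_bound]; lia).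
  assert (Bz : 0 <= z < sz) by (unfold z; nia).
  assert (Hml : 0 <= t mod h * l < sz) by nia.
  assert (Ez : eval w s' dup_index = z).
  { unfold dup_index; apply eval_eq; cbn [safe ueval uop]; fold t; ev_with; [repeat split; unfold z in *; lia | reflexivity]. }
  assert (Ek : eval w s' (#2 * $27 - #1)%e = 2 * l - 1) by ev.
  pose proof (row_index_bound h l (2 * l - 1) z ltac:(lia) Hl) as Hb.
  assert (Ex := eval_ridx w s' ($27) (#2 * $27 - #1) dup_index l (2 * l - 1) z G27 Ek Ez Hl ltac:(lia) ltac:(lia) ltac:(lia)).
  apply eval_add; [apply eval_add|].
  - rewrite (eval_cell w s' 11 _ (c0 + z)); [| |lia|lia|lia].
    + rewrite Ha by lia; apply Hr0; lia.
    + change (eval_binop w BAdd (regs s' 29) (eval w s' dup_index) = c0 + z).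
      rewrite Ez, G29; unfold eval_binop; rewrite wrap_small; lia.
  - rewrite (eval_cell w s' 11 _ (c0 + sz + z)); [| |lia|lia|lia].
    + rewrite Ha by lia; apply Hr1; lia.
    + change (eval_binop w BAdd (eval_binop w BAdd (regs s' 29) (regs s' 30)) (eval w s' dup_index) = c0 + sz + z).
      rewrite Ez, G29, G30; unfold eval_binop; rewrite (wrap_small w (c0 + sz)), wrap_small; lia.
  - apply eval_rot; [auto | auto | auto | lia | lia | lia | lia | ].
    set (x := z - _ + _) in *.
    apply eval_sub.
    + rewrite (eval_cell w s' 11 _ (c0 + x)); [|  | lia|lia|lia].
      * rewrite Ha by lia; apply Hr0; lia.
      * change (eval_binop w BAdd (regs s' 29) (eval w s' (ridx ($27) (#2 * $27 - #1) dup_index)) = c0 + x).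
        rewrite Ex, G29; unfold eval_binop; rewrite wrap_small; lia.
    + rewrite (eval_cell w s' 11 _ (c0 + sz + x)); [|  | lia|lia|lia].
      * rewrite Ha by lia; apply Hr1; lia.
      * change (eval_binop w BAdd (eval_binop w BAdd (regs s' 29) (regs s' 30)) (eval w s' (ridx ($27) (#2 * $27 - #1) dup_index)) = c0 + sz + x).
        rewrite Ex, G29, G30; unfold eval_binop; rewrite (wrap_small w (c0 + sz)), wrap_small; lia.
Qed.
End Steps.

(** * The stack of tasks and its loop *)

Definition load : cmd :=
  Seq (Assign 20 ($20 - #1)) (Seq (Assign 21 (cell 13 ($20))) (Seq (Assign 22 (cell 14 ($20)))
  (Seq (Assign 23 (cell 15 ($20))) (Seq (Assign 24 (cell 16 ($20))) (Seq (Assign 25 (cell 17 ($20)))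
  (Assign 29 ($22 + #2 * ($23 * $24)))))))).

(** Doubling m and halving l as long as 4 m <= l splits the exponent of a power of two into its
    lower and upper half, without computing a logarithm. *)
Definition halves : cmd :=
  Seq (Assign 26 (#1)) (Seq (Assign 27 ($24))
    (While (#4 * $26 <? $27 + #1)
      (Seq (Assign 26 (#2 * $26)) (Assign 27 ($27 / #2)))))%e.

(** The recombination is pushed first and so runs after both parts. The exponents e and e + l stand
    for x^h - y^e and x^h + y^e. *)
Definition split_forward : cmd :=
  Seq (split_step 11) (Seq (split_step 12) (Seq (push (#1) ($22) ($23) ($24) ($25))
  (Seq (push (#0) ($29 + $30) ($23 / #2) ($24) ($25 / #2 + $24))
       (push (#0) ($29) ($23 / #2) ($24) ($25 / #2))))).

Definition dup_forward : cmd :=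
  Seq (dup_step 11) (Seq (dup_step 12) (Seq (push (#1) ($22) ($23) ($24) ($25))
  (Seq (push (#0) ($29 + $30) ($26) ($27) ($27))
       (push (#0) ($29) ($26) ($27) (#0))))).

(** Both coefficients are computed before either is stored, because the product overwrites the first
    factor. *)
Definition base_step : cmd :=
  Seq (Assign 26 (cell 11 ($22) * cell 12 ($22) - cell 11 ($22 + #1) * cell 12 ($22 + #1)))
  (Seq (Assign 27 (cell 11 ($22) * cell 12 ($22 + #1) + cell 11 ($22 + #1) * cell 12 ($22)))
  (Seq (Store (addr 11 ($22)) ($26)) (Store (addr 11 ($22 + #1)) ($27))))%e.

Definition task_step : cmd :=
  Seq load (If (#1 <? $23)
    (Seq (Assign 30 ($23 * $24 / #2)) (If ($21) split_merge split_forward))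
    (If (#2 <? $24)
      (Seq (Assign 30 ($24)) (Seq halves (If ($21) dup_merge dup_forward)))
      base_step))%e.

Definition task_loop : cmd := While ($20) task_step.

(* Partial executions of the loop are described by what any continuation adds to them,
   because [exec] relates only initial and final states. *)
Definition reaches (w : Z) (s : state) (n : Z) (Q : state -> Prop) : Prop :=
  exists s', Q s' /\ forall j R, run w task_loop s' j R -> run w task_loop s (n + j) R.

Lemma reaches_here w s n (Q : state -> Prop) : 0 <= n -> Q s -> reaches w s n Q.
Proof. intros Hn HQ; exists s; split; auto; intros j R H; eapply run_weaken; eauto; lia. Qed.

Lemma reaches_step w s n m Q :
  regs s 20 <> 0 -> run w task_step s n (fun s1 => reaches w s1 m Q) ->
  reaches w s (n + m + 2) Q.
Proof.
  intros H20 (t & s1 & Hx & Ht & s' & HQ & Hc); exists s'; split; auto.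
  intros j R HR; destruct (Hc j R HR) as (t2 & s2 & Hx2 & Ht2 & HR2).
  exists (S (expr_cost ($20)%e + t + t2)), s2; split.
  - apply exec_while_true with (s1 := s1); auto.
  - split; [cbn [expr_cost]; lia | auto].
Qed.

Lemma reaches_trans w s n m Q :
  reaches w s n (fun s1 => reaches w s1 m Q) -> reaches w s (n + m) Q.
Proof.
  intros (s1 & (s2 & HQ & H2) & H1); exists s2; split; auto.
  intros j R HR; rewrite <- Z.add_assoc; auto.
Qed.

Lemma reaches_weaken w s n n' (Q Q' : state -> Prop) :
  reaches w s n Q -> n <= n' -> (forall s', Q s' -> Q' s') -> reaches w s n' Q'.
Proof.
  intros (s1 & HQ & H1) Hn HI; exists s1; split; auto.
  intros j R HR; eapply run_weaken; [apply H1; eauto | lia | auto].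
Qed.

Definition keep (s s' : state) : Prop :=
  forall r, (r < 20 \/ 31 < r)%nat -> regs s' r = regs s r.

Definition loaded (s s' : state) (k ty p h l e : Z) : Prop :=
  regs s' 20 = k /\ regs s' 21 = ty /\ regs s' 22 = p /\ regs s' 23 = h /\
  regs s' 24 = l /\ regs s' 25 = e /\ regs s' 29 = p + 2 * (h * l) /\
  keep s s' /\ mem s' = mem s.

Lemma run_load w M s k ty p h l e n (Q : state -> Prop) :
  32 * M + 64 < 2 ^ w -> regs s 20 = k + 1 -> frame s k ty p h l e ->
  0 <= k <= M -> 0 <= p -> 0 < h -> 0 < l -> p + 2 * (h * l) <= M ->
  60 <= n -> (forall s', loaded s s' k ty p h l e -> Q s') -> run w load s n Q.
Proof.
  intros HM H20 (F1 & F2 & F3 & F4 & F5) Hk Hp Hh Hl HpM Hn HQ.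
  assert (0 < h * l) by nia.
  unfold load.
  apply run_seq with (n1 := 4) (n2 := n - 5); [|lia].
  apply run_assign with (v := k); [ev | cbv; congruence |].
  apply run_seq with (n1 := 7) (n2 := n - 13); [|lia].
  apply run_assign with (v := ty);
    [rewrite (eval_cell w _ 13 _ k); [auto | reflexivity | lia | lia | lia] | costs; lia |].
  apply run_seq with (n1 := 7) (n2 := n - 21); [|lia].
  apply run_assign with (v := p);
    [rewrite (eval_cell w _ 14 _ k); [auto | reflexivity | lia | lia | lia] | costs; lia |].
  apply run_seq with (n1 := 7) (n2 := n - 29); [|lia].
  apply run_assign with (v := h);
    [rewrite (eval_cell w _ 15 _ k); [auto | reflexivity | lia | lia | lia] | costs; lia |].
  apply run_seq with (n1 := 7) (n2 := n - 37); [|lia].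
  apply run_assign with (v := l);
    [rewrite (eval_cell w _ 16 _ k); [auto | reflexivity | lia | lia | lia] | costs; lia |].
  apply run_seq with (n1 := 7) (n2 := n - 45); [|lia].
  apply run_assign with (v := e);
    [rewrite (eval_cell w _ 17 _ k); [auto | reflexivity | lia | lia | lia] | costs; lia |].
  (* The parts are placed two lengths further on: the length just behind the task may belong to its
     sibling, whose factors are still waiting there. *)
  apply run_assign with (v := p + 2 * (h * l)); [ev | costs; lia |].
  apply HQ; unfold loaded; repeat split; try reflexivity.
  intros r Hr; cbn [regs set_reg].
  repeat match goal with |- context [Nat.eqb r ?c] => destruct (Nat.eqb_spec r c); [lia|] end; reflexivity.
Qed.

Lemma run_halves w s kl n (Q : state -> Prop) :
  1 <= kl -> regs s 24 = 2 ^ kl -> 8 * 2 ^ kl < 2 ^ w -> 30 + 30 * kl <= n ->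
  (forall s', (forall r, r <> 26%nat -> r <> 27%nat -> regs s' r = regs s r) -> mem s' = mem s ->
     regs s' 26 = 2 ^ (kl / 2) -> regs s' 27 = 2 ^ (kl - kl / 2) -> Q s') ->
  run w halves s n Q.
Proof.
  intros Hkl H24 HW Hn HQ.
  assert (Hd : kl = 2 * (kl / 2) + kl mod 2) by (apply Z.div_mod; lia).
  assert (Hd2 := Z.mod_pos_bound kl 2 ltac:(lia)).
  assert (0 < 2 ^ kl) by (apply Z.pow_pos_nonneg; lia).
  unfold halves.
  apply run_seq with (n1 := 2) (n2 := n - 3); [|lia].
  apply run_assign with (v := 1); [ev | cbv; congruence |].
  apply run_seq with (n1 := 2) (n2 := n - 6); [|lia].
  apply run_assign with (v := 2 ^ kl); [ev | cbv; congruence |].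
  assert (Hpow : forall i, 0 <= i <= kl / 2 -> 0 < 2 ^ i <= 2 ^ kl /\ 0 < 2 ^ (kl - i) <= 2 ^ kl).
  { intros i Hi; repeat split; try (apply Z.pow_pos_nonneg; lia); apply Z.pow_le_mono_r; lia. }
  set (I := fun i s' => (forall r, r <> 26%nat -> r <> 27%nat -> regs s' r = regs s r) /\ mem s' = mem s /\
     regs s' 26 = 2 ^ i /\ regs s' 27 = 2 ^ (kl - i)).
  eapply run_weaken with (n := n - 6); [|lia|].
  { apply run_while with (I := I) (N := kl / 2) (k := 9).
    - lia.
    - unfold I; split; [|split; [|split]]; try reflexivity.
      + intros r H1 H2; cbn [regs set_reg]; destruct (Nat.eqb_spec r 27), (Nat.eqb_spec r 26); congruence.
      + cbn [regs set_reg Nat.eqb]; f_equal; lia.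
    - intros i s1 Hi (Hr & Hm & H26 & H27).
      destruct (Hpow i ltac:(lia)) as (P1 & P2).
      assert (4 * 2 ^ i <= 2 ^ (kl - i)).
      { replace (4 * 2 ^ i) with (2 ^ (i + 2)) by (rewrite Z.pow_add_r by lia; lia).
        apply Z.pow_le_mono_r; lia. }
      assert (D : 2 ^ (kl - i) / 2 = 2 ^ (kl - (i + 1))).
      { replace (kl - i) with (kl - (i + 1) + 1) by lia.
        rewrite (Z.pow_add_r 2 (kl - (i + 1)) 1) by lia; change (2 ^ 1) with 2; apply Z.div_mul; lia. }
      assert (S2 : 2 * 2 ^ i = 2 ^ (i + 1)) by (rewrite Z.pow_add_r by lia; lia).
      assert (0 < 2 ^ (kl - (i + 1))) by (apply Z.pow_pos_nonneg; lia).
      assert (2 ^ (kl - (i + 1)) <= 2 ^ kl) by (apply Z.pow_le_mono_r; lia).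
      split.
      + rewrite (eval_eq w s1 _ 1); [lia| |]; cbn [safe ueval uop]; rewrite H26, H27;
          rewrite (proj2 (Z.ltb_lt _ _)) by lia; [repeat split; lia | reflexivity].
      + apply run_seq with (n1 := 4) (n2 := 4); [|lia].
        apply run_assign with (v := 2 ^ (i + 1)); [ev | cbv; congruence |].
        apply run_assign with (v := 2 ^ (kl - (i + 1))); [ev | cbv; congruence |].
        unfold I; split; [|split; [|split]]; try reflexivity; [|exact Hm].
        intros r R1 R2; cbn [regs set_reg]; destruct (Nat.eqb_spec r 27), (Nat.eqb_spec r 26); try congruence; auto.
    - intros s1 (Hr & Hm & H26 & H27).
      destruct (Hpow (kl / 2) ltac:(lia)) as (P1 & P2).
      assert (2 ^ (kl - kl / 2) < 4 * 2 ^ (kl / 2)).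
      { replace (4 * 2 ^ (kl / 2)) with (2 ^ (kl / 2 + 2)) by (rewrite Z.pow_add_r by lia; lia).
        apply Z.pow_lt_mono_r; lia. }
      apply eval_eq; cbn [safe ueval uop]; rewrite H26, H27, (proj2 (Z.ltb_ge _ _)) by lia; [repeat split; lia | reflexivity].
    - costs; lia. }
  intros s' (Hr & Hm & H26 & H27); auto.
Qed.

Definition wrap_eq_on (w : Z) (s : state) (tag a n : Z) (f : Z -> Z) : Prop :=
  forall t, 0 <= t < n -> wrap w (arr s tag (a + t)) = wrap w (f t).

Lemma run_push_tasks w s k p h l e p1 p0 h' l' e1 e0 x1 x0 xh xl y1 y0 n (Q : state -> Prop) :
  regs s 20 = k -> 0 <= k -> 32 * (k + 2) + 64 < 2 ^ w ->
  regs s 22 = p -> regs s 23 = h -> regs s 24 = l -> regs s 25 = e ->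
  (forall s', (forall r, r <> 20%nat -> regs s' r = regs s r) ->
    eval w s' x1 = p1 /\ eval w s' x0 = p0 /\ eval w s' xh = h' /\ eval w s' xl = l' /\
    eval w s' y1 = e1 /\ eval w s' y0 = e0) ->
  1 < 2 ^ w ->
  140 + ecost x1 + ecost x0 + ecost xh + ecost xl + ecost xh + ecost xl + ecost y1 + ecost y0 <= n ->
  (forall s', (forall r, r <> 20%nat -> regs s' r = regs s r) -> regs s' 20 = k + 3 ->
     frame s' k 1 p h l e -> frame s' (k + 1) 0 p1 h' l' e1 -> frame s' (k + 2) 0 p0 h' l' e0 ->
     (forall tag i, 0 <= tag < 32 -> tag < 13 \/ 17 < tag \/ i < k -> arr s' tag i = arr s tag i) ->
     Q s') ->
  run w (Seq (push (#1) ($22) ($23) ($24) ($25))%e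
    (Seq (push (#0)%e x1 xh xl y1) (push (#0)%e x0 xh xl y0))) s n Q.
Proof.
  intros H20 Hk HW H22 H23 H24 H25 HE H1 Hn HQ.
  pose proof (ecost_pos x1); pose proof (ecost_pos x0); pose proof (ecost_pos xh);
  pose proof (ecost_pos xl); pose proof (ecost_pos y1); pose proof (ecost_pos y0).
  apply run_seq with (n1 := 45) (n2 := n - 46); [|lia].
  apply run_push with (k := k) (ty := 1) (p := p) (h := h) (l := l) (e := e);
    [auto | lia | lia | | costs; lia |].
  { intros s' Hr; cbn [eval]; rewrite !Hr, wrap_small by lia; auto. }
  intros s1 R1 K1 F1 A1.
  apply run_seq with (n1 := 41 + ecost x1 + ecost xh + ecost xl + ecost y1)
    (n2 := 41 + ecost x0 + ecost xh + ecost xl + ecost y0); [|lia].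
  apply run_push with (k := k + 1) (ty := 0) (p := p1) (h := h') (l := l') (e := e1);
    [auto | lia | lia | | costs; lia |].
  { intros s' Hr; destruct (HE s') as (? & ? & ? & ? & ? & ?); [intros; rewrite Hr, R1; auto|].
    cbn [eval]; rewrite wrap_small by lia; auto. }
  intros s2 R2 K2 F2 A2.
  apply run_push with (k := k + 2) (ty := 0) (p := p0) (h := h') (l := l') (e := e0);
    [lia | lia | lia | | costs; lia |].
  { intros s' Hr; destruct (HE s') as (? & ? & ? & ? & ? & ?); [intros; rewrite Hr, R2, R1; auto|].
    cbn [eval]; rewrite wrap_small by lia; auto. }
  intros s3 R3 K3 F3 A3.
  apply HQ.
  - intros; rewrite R3, R2, R1; auto.
  - lia.
  - unfold frame in *; rewrite !A3, !A2 by lia; auto.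
  - unfold frame in *; rewrite !A3 by lia; auto.
  - auto.
  - intros tag i Ht Hi; rewrite A3, A2, A1 by lia; auto.
Qed.

Definition forward_post (w : Z) (s s' : state) (k p h l e c0 sz h' l' e0 e1 : Z)
    (u0 u1 v0 v1 : Z -> Z) : Prop :=
  keep s s' /\ regs s' 20 = k + 3 /\ frame s' k 1 p h l e /\
  frame s' (k + 1) 0 (c0 + sz) h' l' e1 /\ frame s' (k + 2) 0 c0 h' l' e0 /\
  wrap_eq_on w s' 11 c0 sz u0 /\ wrap_eq_on w s' 11 (c0 + sz) sz u1 /\
  wrap_eq_on w s' 12 c0 sz v0 /\ wrap_eq_on w s' 12 (c0 + sz) sz v1 /\
  (forall tag i, 0 <= tag < 32 ->
     tag < 11 \/ 17 < tag \/ tag <= 12 /\ i < c0 \/ 13 <= tag /\ i < k ->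
     arr s' tag i = arr s tag i).

Lemma arr_mem s s' : mem s' = mem s -> forall tag i, arr s' tag i = arr s tag i.
Proof. unfold arr; intros ->; auto. Qed.

Ltac lookup H := rewrite ?H by discriminate.

Lemma run_split_forward w M s k p h l e u v :
  32 * M + 64 < 2 ^ w -> 0 <= k -> k + 3 <= M -> 0 <= p -> 0 < h -> 2 <= l -> 0 <= e < l ->
  let sz := h * l in let c0 := p + 4 * sz in
  c0 + 2 * sz + 4 * l <= M ->
  regs s 20 = k + 1 -> frame s k 0 p (2 * h) l (2 * e) ->
  wrap_eq_on w s 11 p (2 * sz) u -> wrap_eq_on w s 12 p (2 * sz) v ->
  run w task_step s (1600 * sz) (fun s' =>
    forward_post w s s' k p (2 * h) l (2 * e) c0 sz h l e (e + l)
      (split_lo l e sz u) (split_hi l e sz u) (split_lo l e sz v) (split_hi l e sz v)).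
Proof.
  intros HM Hk HkM Hp Hh Hl He sz c0 HcM H20 HF Hu Hv.
  assert (Hsz : 2 <= sz) by (unfold sz; nia).
  assert (Hlsz : l <= sz) by (unfold sz; nia).
  assert (Hhsz : 2 * h <= sz) by (unfold sz; nia).
  assert (D1 : 2 * h * l / 2 = sz).
  { unfold sz; replace (2 * h * l) with (h * l * 2) by lia; apply Z.div_mul; lia. }
  assert (Dh : 2 * h / 2 = h) by (rewrite Z.mul_comm; apply Z.div_mul; lia).
  assert (De : 2 * e / 2 = e) by (rewrite Z.mul_comm; apply Z.div_mul; lia).
  assert (S2 : 2 * h * l = 2 * sz) by (unfold sz; lia).
  apply run_seq with (n1 := 60) (n2 := 1600 * sz - 61); [|lia].
  eapply run_load with (M := M); eauto; try lia.
  intros s1 (L20 & L21 & L22 & L23 & L24 & L25 & L29 & LK & LM).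
  apply run_if with (m := 1600 * sz - 70); [intros _ | intros E; exfalso | costs; lia].
  2: { revert E; rewrite (eval_eq w s1 _ 1); [lia | | ]; cbn [safe ueval uop]; rewrite L23, (proj2 (Z.ltb_lt _ _)) by lia; [repeat split; lia | auto]. }
  apply run_seq with (n1 := 10) (n2 := 1600 * sz - 81); [|lia].
  apply run_assign with (v := sz); [ev; lia | costs; lia |].
  apply run_if with (m := 1600 * sz - 83); [intros E; exfalso; apply E; exact L21 | intros _ | costs; lia].
  set (s2 := set_reg 30 sz s1).
  assert (R2 : forall r, r <> 30%nat -> regs s2 r = regs s1 r).
  { intros r Hr; cbn; destruct (Nat.eqb_spec r 30); congruence. }
  assert (A2 : forall tag i, arr s2 tag i = arr s tag i) by (intros; unfold s2; rewrite arr_set_reg; apply arr_mem; auto).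
  assert (L29' : regs s1 29 = c0) by (unfold c0; lia).
  assert (St : forall s' tag f, (forall r, r <> 28%nat -> regs s' r = regs s2 r) -> 0 <= tag < 32 ->
     wrap_eq_on w s' tag p (2 * sz) f ->
     run w (split_step tag) s' ((sz + 1) * 400) (fun s'' =>
    (forall r, r <> 28%nat -> regs s'' r = regs s' r) /\
    (forall k i, 0 <= k < 32 -> k <> tag \/ i < c0 \/ c0 + 2 * sz <= i -> arr s'' k i = arr s' k i) /\
    (forall t, 0 <= t < sz -> wrap w (arr s'' tag (c0 + t)) = wrap w (split_lo l e sz f t)) /\
    (forall t, 0 <= t < sz -> wrap w (arr s'' tag (c0 + sz + t)) = wrap w (split_hi l e sz f t)))).
  { intros s' tag f Hr Ht Hf.
    apply run_split_step with (p := p) (h := h) (M := M); lookup Hr; lookup R2; auto; try lia. }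
  apply run_seq with (n1 := (sz + 1) * 400) (n2 := (sz + 1) * 400 + 300); [|lia].
  eapply run_weaken; [apply (St s2 11 u); auto; [lia|] | lia |].
  { intros t Ht; rewrite A2; apply Hu; auto. }
  intros s3 (R3 & A3 & V3a & V3b).
  apply run_seq with (n1 := (sz + 1) * 400) (n2 := 200); [|lia].
  eapply run_weaken; [apply (St s3 12 v); auto; [lia|] | lia |].
  { intros t Ht; rewrite A3, A2 by lia; apply Hv; auto. }
  intros s4 (R4 & A4 & V4a & V4b).
  assert (R41 : forall r, r <> 28%nat -> r <> 30%nat -> regs s4 r = regs s1 r).
  { intros r Hr Hr'; rewrite R4, R3, R2 by auto; auto. }
  assert (R430 : regs s4 30 = sz) by (rewrite R4, R3 by discriminate; reflexivity).
  eapply run_push_tasks with (k := k) (p := p) (h := 2 * h) (l := l) (e := 2 * e)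
    (p1 := c0 + sz) (p0 := c0) (h' := h) (l' := l) (e1 := e + l) (e0 := e);
    try (rewrite R41 by discriminate; auto; fail); try lia.
  { intros s' Hr.
    assert (G22 : regs s' 23 = 2 * h) by (rewrite Hr, R41 by discriminate; auto).
    assert (G24 : regs s' 24 = l) by (rewrite Hr, R41 by discriminate; auto).
    assert (G25 : regs s' 25 = 2 * e) by (rewrite Hr, R41 by discriminate; auto).
    assert (G29 : regs s' 29 = c0) by (rewrite Hr, R41 by discriminate; auto).
    assert (G30 : regs s' 30 = sz) by (rewrite Hr by discriminate; auto).
    repeat split; ev; lia. }
  { costs; lia. }
  intros s5 R5 K5 F5a F5b F5c A5.
  unfold forward_post; split; [|split; [|split; [|split; [|split]]]]; auto.
  { intros r Hr; rewrite R5, R41, LK by lia; auto. }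
  unfold wrap_eq_on; split; [|split; [|split; [|split]]].
  - intros t Ht; rewrite A5, A4 by lia; auto.
  - intros t Ht; rewrite A5, A4 by lia; auto.
  - intros t Ht; rewrite A5 by lia; auto.
  - intros t Ht; rewrite A5 by lia; auto.
  - intros tag i Ht Hi; rewrite A5, A4, A3, A2 by lia; auto.
Qed.

Lemma run_split_recombine w M s k p h l e r0 r1 :
  32 * M + 64 < 2 ^ w -> 0 <= k -> k + 3 <= M -> 0 <= p -> 0 < h -> 2 <= l -> 0 <= e < l ->
  let sz := h * l in let c0 := p + 4 * sz in
  c0 + 2 * sz + 4 * l <= M ->
  regs s 20 = k + 1 -> frame s k 1 p (2 * h) l (2 * e) ->
  wrap_eq_on w s 11 c0 sz r0 -> wrap_eq_on w s 11 (c0 + sz) sz r1 ->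
  run w task_step s (1000 * sz) (fun s' =>
    keep s s' /\ regs s' 20 = k /\
    wrap_eq_on w s' 11 p sz (fun t => r0 t + r1 t) /\
    wrap_eq_on w s' 11 (p + sz) sz (negrot l e (fun t => r0 t - r1 t)) /\
    (forall tag i, 0 <= tag < 32 -> tag <> 11 \/ i < p \/ p + 2 * sz <= i ->
       arr s' tag i = arr s tag i)).
Proof.
  intros HM Hk HkM Hp Hh Hl He sz c0 HcM H20 HF Hu Hv.
  assert (Hsz : 2 <= sz) by (unfold sz; nia).
  assert (Hlsz : l <= sz) by (unfold sz; nia).
  assert (Hhsz : 2 * h <= sz) by (unfold sz; nia).
  assert (D1 : 2 * h * l / 2 = sz).
  { unfold sz; replace (2 * h * l) with (h * l * 2) by lia; apply Z.div_mul; lia. }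
  assert (S2 : 2 * h * l = 2 * sz) by (unfold sz; lia).
  apply run_seq with (n1 := 60) (n2 := 1000 * sz - 61); [|lia].
  eapply run_load with (M := M); eauto; try lia.
  intros s1 (L20 & L21 & L22 & L23 & L24 & L25 & L29 & LK & LM).
  apply run_if with (m := 1000 * sz - 70); [intros _ | intros E; exfalso | costs; lia].
  2: { revert E; rewrite (eval_eq w s1 _ 1); [lia | | ]; cbn [safe ueval uop]; rewrite L23, (proj2 (Z.ltb_lt _ _)) by lia; [repeat split; lia | auto]. }
  apply run_seq with (n1 := 10) (n2 := 1000 * sz - 81); [|lia].
  apply run_assign with (v := sz); [ev; lia | costs; lia |].
  apply run_if with (m := 1000 * sz - 83); [intros _ | intros E; exfalso | costs; lia].
  2: { cbn [eval regs set_reg Nat.eqb] in E; lia. }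
  set (s2 := set_reg 30 sz s1).
  assert (R2 : forall r, r <> 30%nat -> regs s2 r = regs s1 r).
  { intros r Hr; cbn; destruct (Nat.eqb_spec r 30); congruence. }
  assert (A2 : forall tag i, arr s2 tag i = arr s tag i) by (intros; unfold s2; rewrite arr_set_reg; apply arr_mem; auto).
  eapply run_weaken.
  { apply run_split_merge with (p := p) (h := h) (l := l) (e := e) (c0 := c0) (M := M) (sz := sz) (r0 := r0) (r1 := r1);
      lookup R2; auto; try (unfold sz, c0 in *; lia).
    - intros t Ht; rewrite A2; apply Hu; auto.
    - intros t Ht; rewrite A2; apply Hv; auto. }
  { lia. }
  intros s3 (R3 & A3 & V3 & V4); split; [|split; [|split; [|split]]]; auto.
  - intros r Hr; rewrite R3, R2, LK by lia; auto.
  - rewrite R3, R2 by discriminate; auto.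
  - intros tag i Ht Hi; rewrite A3, A2 by lia; auto.
Qed.

Lemma half_bounds kl : 2 <= kl ->
  2 ^ (kl / 2) * 2 ^ (kl - kl / 2) = 2 ^ kl /\ 2 <= 2 ^ (kl / 2) /\ 2 <= 2 ^ (kl - kl / 2) /\
  2 ^ (kl / 2) <= 2 ^ (kl - kl / 2).
Proof.
  intros H.
  assert (Hd : kl = 2 * (kl / 2) + kl mod 2) by (apply Z.div_mod; lia).
  assert (Hd2 := Z.mod_pos_bound kl 2 ltac:(lia)).
  repeat split.
  - rewrite <- Z.pow_add_r by lia; f_equal; lia.
  - change 2 with (2 ^ 1) at 1; apply Z.pow_le_mono_r; lia.
  - change 2 with (2 ^ 1) at 1; apply Z.pow_le_mono_r; lia.
  - apply Z.pow_le_mono_r; lia.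
Qed.

Lemma kl_le_pow kl : 0 <= kl -> kl < 2 ^ kl.
Proof. intros; apply Z.pow_gt_lin_r; lia. Qed.

Lemma run_dup_prefix w M s k ty p kl e n (Q : state -> Prop) :
  32 * M + 64 < 2 ^ w -> 0 <= k -> k + 3 <= M -> 0 <= p -> 2 <= kl ->
  let sz := 2 ^ kl in let c0 := p + 2 * sz in let m := 2 ^ (kl / 2) in let lq := 2 ^ (kl - kl / 2) in
  c0 + 8 * sz <= M ->
  regs s 20 = k + 1 -> frame s k ty p 1 sz e ->
  (forall s', keep s s' -> mem s' = mem s -> regs s' 20 = k -> regs s' 21 = ty -> regs s' 22 = p ->
     regs s' 23 = 1 -> regs s' 24 = sz -> regs s' 25 = e -> regs s' 26 = m -> regs s' 27 = lq ->
     regs s' 29 = c0 -> regs s' 30 = sz ->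
     run w (If ($21)%e dup_merge dup_forward) s' n Q) ->
  run w task_step s (n + 30 * sz + 150) Q.
Proof.
  intros HM Hk HkM Hp Hkl sz c0 m lq HcM H20 HF HQ.
  assert (Hsz : 4 <= sz) by (unfold sz; change 4 with (2 ^ 2); apply Z.pow_le_mono_r; lia).
  assert (Hklsz : kl < sz) by (apply kl_le_pow; lia).
  apply run_seq with (n1 := 60) (n2 := n + 30 * sz + 89); [|lia].
  eapply run_load with (M := M); eauto; try lia.
  intros s1 (L20 & L21 & L22 & L23 & L24 & L25 & L29 & LK & LM).
  apply run_if with (m := n + 30 * sz + 80); [intros E; exfalso | intros _ | costs; lia].
  { apply E; apply eval_eq; cbn [safe ueval uop]; rewrite L23; cbn; repeat split; lia. }
  apply run_if with (m := n + 30 * sz + 70); [intros _ | intros E; exfalso | costs; lia].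
  2: { revert E; rewrite (eval_eq w s1 _ 1); [lia | | ]; cbn [safe ueval uop]; rewrite L24, (proj2 (Z.ltb_lt _ _)) by lia; [repeat split; lia | auto]. }
  apply run_seq with (n1 := 10) (n2 := n + 30 * sz + 55); [|lia].
  apply run_assign with (v := sz); [auto | costs; lia |].
  apply run_seq with (n1 := 30 * sz + 50) (n2 := n); [|lia].
  apply run_halves with (kl := kl); [lia | auto | fold sz; lia | lia |].
  intros s2 R2 M2 H26 H27.
  assert (R2' : forall r, r <> 26%nat -> r <> 27%nat -> r <> 30%nat -> regs s2 r = regs s1 r).
  { intros r Ha Hb Hc; rewrite R2 by auto; cbn; destruct (Nat.eqb_spec r 30); congruence. }
  apply HQ; auto; try (rewrite R2' by discriminate; auto).
  - intros r Hr; rewrite R2', LK by lia; auto.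
  - rewrite M2; auto.
  - unfold c0; lia.
  - rewrite R2 by discriminate; reflexivity.
Qed.

Lemma run_dup_forward w M s k p kl e u v :
  32 * M + 64 < 2 ^ w -> 0 <= k -> k + 3 <= M -> 0 <= p -> 2 <= kl ->
  let sz := 2 ^ kl in let c0 := p + 2 * sz in let m := 2 ^ (kl / 2) in let lq := 2 ^ (kl - kl / 2) in
  c0 + 8 * sz <= M ->
  regs s 20 = k + 1 -> frame s k 0 p 1 sz e ->
  wrap_eq_on w s 11 p sz u -> wrap_eq_on w s 12 p sz v ->
  run w task_step s (1400 * sz) (fun s' =>
    forward_post w s s' k p 1 sz e c0 sz m lq 0 lq
      (dup_read m lq u) (dup_read m lq u) (dup_read m lq v) (dup_read m lq v)).
Proof.
  intros HM Hk HkM Hp Hkl sz c0 m lq HcM H20 HF Hu Hv.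
  destruct (half_bounds kl Hkl) as (B1 & B2 & B3 & B4); fold sz m lq in B1, B2, B3, B4.
  assert (Hsz : 4 <= sz) by (unfold sz; change 4 with (2 ^ 2); apply Z.pow_le_mono_r; lia).
  eapply run_weaken; [eapply run_dup_prefix with (n := 1200 * sz) (M := M) (kl := kl) (p := p) (k := k) (e := e); eauto | fold sz; lia | intros s' Hs'; exact Hs'].
  fold sz c0 m lq.
  intros s2 LK LM L20 L21 L22 L23 L24 L25 L26 L27 L29 L30.
  apply run_if with (m := 1200 * sz - 2); [intros E; exfalso; apply E; exact L21 | intros _ | costs; lia].
  assert (A2 : forall tag i, arr s2 tag i = arr s tag i) by (intros; apply arr_mem; auto).
  assert (St : forall s' tag f, (forall r, r <> 28%nat -> regs s' r = regs s2 r) -> 0 <= tag < 32 ->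
     wrap_eq_on w s' tag p sz f ->
     run w (dup_step tag) s' ((sz + 1) * 400) (fun s'' =>
    (forall r, r <> 28%nat -> regs s'' r = regs s' r) /\
    (forall k i, 0 <= k < 32 -> k <> tag \/ i < c0 \/ c0 + 2 * sz <= i -> arr s'' k i = arr s' k i) /\
    (forall t, 0 <= t < sz -> wrap w (arr s'' tag (c0 + t)) = wrap w (dup_read m lq f t)) /\
    (forall t, 0 <= t < sz -> wrap w (arr s'' tag (c0 + sz + t)) = wrap w (dup_read m lq f t)))).
  { intros s' tag f Hr Ht Hf.
    apply run_dup_step with (p := p) (M := M); lookup Hr; auto; try nia. }
  apply run_seq with (n1 := (sz + 1) * 400) (n2 := (sz + 1) * 400 + 300); [|lia].
  eapply run_weaken; [apply (St s2 11 u); auto; [lia|] | lia |].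
  { intros t Ht; rewrite A2; apply Hu; auto. }
  intros s3 (R3 & A3 & V3a & V3b).
  apply run_seq with (n1 := (sz + 1) * 400) (n2 := 200); [|lia].
  eapply run_weaken; [apply (St s3 12 v); auto; [lia|] | lia |].
  { intros t Ht; rewrite A3, A2 by lia; apply Hv; auto. }
  intros s4 (R4 & A4 & V4a & V4b).
  assert (R42 : forall r, r <> 28%nat -> regs s4 r = regs s2 r).
  { intros r Hr; rewrite R4, R3 by auto; auto. }
  eapply run_push_tasks with (k := k) (p := p) (h := 1) (l := sz) (e := e)
    (p1 := c0 + sz) (p0 := c0) (h' := m) (l' := lq) (e1 := lq) (e0 := 0);
    try (rewrite R42 by discriminate; auto; fail); try lia.
  { intros s' Hr.
    assert (G26 : regs s' 26 = m) by (rewrite Hr, R42 by discriminate; auto).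
    assert (G27 : regs s' 27 = lq) by (rewrite Hr, R42 by discriminate; auto).
    assert (G29 : regs s' 29 = c0) by (rewrite Hr, R42 by discriminate; auto).
    assert (G30 : regs s' 30 = sz) by (rewrite Hr, R42 by discriminate; auto).
    repeat split; ev; lia. }
  { costs; lia. }
  intros s5 R5 K5 F5a F5b F5c A5.
  unfold forward_post; split; [|split; [|split; [|split; [|split]]]]; auto.
  { intros r Hr; rewrite R5, R42, LK by lia; auto. }
  unfold wrap_eq_on; split; [|split; [|split; [|split]]].
  - intros t Ht; rewrite A5, A4 by lia; auto.
  - intros t Ht; rewrite A5, A4 by lia; auto.
  - intros t Ht; rewrite A5 by lia; auto.
  - intros t Ht; rewrite A5 by lia; auto.
  - intros tag i Ht Hi; rewrite A5, A4, A3, A2 by lia; auto.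
Qed.

Lemma run_dup_recombine w M s k p kl e r0 r1 :
  32 * M + 64 < 2 ^ w -> 0 <= k -> k + 3 <= M -> 0 <= p -> 2 <= kl ->
  let sz := 2 ^ kl in let c0 := p + 2 * sz in let m := 2 ^ (kl / 2) in let lq := 2 ^ (kl - kl / 2) in
  c0 + 8 * sz <= M ->
  regs s 20 = k + 1 -> frame s k 1 p 1 sz e ->
  wrap_eq_on w s 11 c0 sz r0 -> wrap_eq_on w s 11 (c0 + sz) sz r1 ->
  run w task_step s (1000 * sz) (fun s' =>
    keep s s' /\ regs s' 20 = k /\
    wrap_eq_on w s' 11 p sz (fun t => let z := (t mod m) * lq + t / m in
      r0 z + r1 z + negrot lq (2 * lq - 1) (fun t => r0 t - r1 t) z) /\
    (forall tag i, 0 <= tag < 32 -> tag <> 11 \/ i < p \/ p + sz <= i ->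
       arr s' tag i = arr s tag i)).
Proof.
  intros HM Hk HkM Hp Hkl sz c0 m lq HcM H20 HF Hu Hv.
  destruct (half_bounds kl Hkl) as (B1 & B2 & B3 & B4); fold sz m lq in B1, B2, B3, B4.
  assert (Hsz : 4 <= sz) by (unfold sz; change 4 with (2 ^ 2); apply Z.pow_le_mono_r; lia).
  eapply run_weaken; [eapply run_dup_prefix with (n := 800 * sz) (M := M) (kl := kl) (p := p) (k := k) (e := e); eauto | fold sz; lia | intros s' Hs'; exact Hs'].
  fold sz c0 m lq.
  intros s2 LK LM L20 L21 L22 L23 L24 L25 L26 L27 L29 L30.
  apply run_if with (m := 800 * sz - 2); [intros _ | intros E; exfalso | costs; lia].
  2: { cbn [eval] in E; lia. }
  assert (A2 : forall tag i, arr s2 tag i = arr s tag i) by (intros; apply arr_mem; auto).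
  eapply run_weaken.
  { apply run_dup_merge with (p := p) (h := m) (l := lq) (c0 := c0) (M := M) (sz := sz) (r0 := r0) (r1 := r1);
      auto; try nia.
    - intros t Ht; rewrite A2; apply Hu; auto.
    - intros t Ht; rewrite A2; apply Hv; auto. }
  { lia. }
  intros s3 (R3 & A3 & V3); split; [|split; [|split]]; auto.
  - intros r Hr; rewrite R3, LK by lia; auto.
  - rewrite R3 by discriminate; auto.
  - intros tag i Ht Hi; rewrite A3, A2 by lia; auto.
Qed.

Lemma run_base w M s k p e u v :
  32 * M + 64 < 2 ^ w -> 0 <= k -> k + 3 <= M -> 0 <= p -> p + 8 <= M ->
  regs s 20 = k + 1 -> frame s k 0 p 1 2 e ->
  wrap_eq_on w s 11 p 2 u -> wrap_eq_on w s 12 p 2 v ->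
  run w task_step s 200 (fun s' =>
    keep s s' /\ regs s' 20 = k /\
    wrap w (arr s' 11 p) = wrap w (u 0 * v 0 - u 1 * v 1) /\
    wrap w (arr s' 11 (p + 1)) = wrap w (u 0 * v 1 + u 1 * v 0) /\
    (forall tag i, 0 <= tag < 32 -> tag <> 11 \/ i < p \/ p + 2 <= i ->
       arr s' tag i = arr s tag i)).
Proof.
  intros HM Hk HkM Hp HpM H20 HF Hu Hv.
  apply run_seq with (n1 := 60) (n2 := 139); [|lia].
  eapply run_load with (M := M); eauto; try lia.
  intros s1 (L20 & L21 & L22 & L23 & L24 & L25 & L29 & LK & LM).
  apply run_if with (m := 130); [intros E; exfalso | intros _ | costs; lia].
  { apply E; apply eval_eq; cbn [safe ueval uop]; rewrite L23; cbn; repeat split; lia. }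
  apply run_if with (m := 120); [intros E; exfalso | intros _ | costs; lia].
  { apply E; apply eval_eq; cbn [safe ueval uop]; rewrite L24; cbn; repeat split; lia. }
  assert (C : forall s', regs s' 22 = p -> mem s' = mem s -> 
    wrap w (eval w s' (cell 11 ($22))%e) = wrap w (u 0) /\ wrap w (eval w s' (cell 11 ($22 + #1))%e) = wrap w (u 1) /\
    wrap w (eval w s' (cell 12 ($22))%e) = wrap w (v 0) /\ wrap w (eval w s' (cell 12 ($22 + #1))%e) = wrap w (v 1)).
  { intros s' G22 Gm.
    assert (E1 : eval w s' ($22 + #1)%e = p + 1) by ev.
    rewrite !(eval_cell w s' _ ($22) p), !(eval_cell w s' _ ($22 + #1) (p + 1)) by (auto; lia).
    rewrite !(arr_mem s s') by auto.
    rewrite <- !Hu, <- !Hv, !Z.add_0_r by lia; auto. }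
  destruct (C s1) as (C1 & C2 & C3 & C4); auto.
  apply run_seq with (n1 := 33) (n2 := 80); [|lia].
  eapply run_assign; [reflexivity | costs; lia |].
  apply run_seq with (n1 := 33) (n2 := 40); [|lia].
  eapply run_assign; [reflexivity | costs; lia |].
  set (x := eval w s1 _); set (y := eval w _ _).
  assert (X : wrap w x = wrap w (u 0 * v 0 - u 1 * v 1)) by (apply eval_sub; apply eval_mul; auto).
  assert (Y : wrap w y = wrap w (u 0 * v 1 + u 1 * v 0)).
  { unfold y; destruct (C (set_reg 26 x s1)) as (C5 & C6 & C7 & C8); auto.
    apply eval_add; apply eval_mul; auto. }
  clearbody x y.
  apply run_seq with (n1 := 10) (n2 := 12); [|lia].
  apply run_store with (i := p) (v := x); try lia; auto; [costs; lia|].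
  apply run_store with (i := p + 1) (v := y); try lia; auto; [ev | costs; lia|].
  split; [|split; [|split; [|split]]].
  - intros r Hr; cbn [regs set_reg set_mem].
    destruct (Nat.eqb_spec r 27); [lia|]; destruct (Nat.eqb_spec r 26); [lia|]; apply LK; auto.
  - exact L20.
  - rewrite (arr_set_mem _ _ _ _ _ 11 (p + 1)), (arr_set_mem _ _ _ _ _ 11 p) by (auto; lia).
    rewrite Z.eqb_refl, (proj2 (Z.eqb_neq p (p + 1))) by lia; cbn; rewrite Z.eqb_refl; auto.
  - rewrite (arr_set_mem _ _ _ _ _ 11 (p + 1)) by (auto; lia).
    rewrite !Z.eqb_refl; auto.
  - intros tag i Ht Hi.
    rewrite (arr_set_mem _ _ _ _ _ 11 (p + 1)), (arr_set_mem _ _ _ _ _ 11 p) by (auto; lia).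
    destruct (Z.eqb_spec tag 11), (Z.eqb_spec i (p + 1)), (Z.eqb_spec i p); cbn [andb]; try lia;
      rewrite !arr_set_reg; apply arr_mem; auto.
Qed.

(** * Correctness, cost and stack depth of the recursion *)

Definition task_post (w : Z) (s s' : state) (k p h l e : Z) (sc : nat) (u v : Z -> Z) : Prop :=
  keep s s' /\ regs s' 20 = k /\
  (exists r, Negacyclic.twisted_product (Z.to_nat h) (Z.to_nat l) (Z.to_nat e) sc u v r /\
     wrap_eq_on w s' 11 p (h * l) r) /\
  (forall tag i, 0 <= tag < 32 ->
     tag < 11 \/ 17 < tag \/ tag = 11 /\ (i < p \/ p + h * l <= i < p + 2 * (h * l)) \/
     tag = 12 /\ i < p + 2 * (h * l) \/ 13 <= tag /\ i < k ->
     arr s' tag i = arr s tag i).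

(* [cost] bounds the running time and [depth] the growth of the stack. *)
Definition solves (w M h l : Z) (sc : nat) (cost depth : Z) : Prop :=
  forall e k p s u v, 0 <= k -> k + depth <= M -> 0 <= p -> p + 5 * (h * l) + 11 * l <= M ->
    (h | e) -> 0 <= e < 2 * l -> regs s 20 = k + 1 -> frame s k 0 p h l e ->
    wrap_eq_on w s 11 p (h * l) u -> wrap_eq_on w s 12 p (h * l) v ->
    reaches w s cost (fun s' => task_post w s s' k p h l e sc u v).

(** The first part, at [c0], works beyond [c0 + 2 * (h * l)] and thus spares the factors of the
    second, at [c0 + h * l]; the second leaves array 11 below its own position alone and thus spares
    the product of the first. The entry at height [k] lies below both and is met last. *)
Lemma two_children w M h l sc cost depth s k p ph pl pe c0 e0 e1 u0 u1 v0 v1 n1 n2 Q :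
  solves w M h l sc cost depth ->
  0 <= k -> k + 2 + depth <= M -> 0 <= c0 -> 0 < h * l -> c0 + 6 * (h * l) + 11 * l <= M ->
  (h | e0) -> 0 <= e0 < 2 * l -> (h | e1) -> 0 <= e1 < 2 * l ->
  regs s 20 = k + 1 ->
  run w task_step s n1
    (fun s' => forward_post w s s' k p ph pl pe c0 (h * l) h l e0 e1 u0 u1 v0 v1) ->
  (forall s' r0 r1, keep s s' -> regs s' 20 = k + 1 -> frame s' k 1 p ph pl pe ->
     Negacyclic.twisted_product (Z.to_nat h) (Z.to_nat l) (Z.to_nat e0) sc u0 v0 r0 ->
     Negacyclic.twisted_product (Z.to_nat h) (Z.to_nat l) (Z.to_nat e1) sc u1 v1 r1 ->
     wrap_eq_on w s' 11 c0 (h * l) r0 -> wrap_eq_on w s' 11 (c0 + h * l) (h * l) r1 ->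
     (forall tag i, 0 <= tag < 32 ->
       tag < 11 \/ 17 < tag \/ tag <= 12 /\ i < c0 \/ 13 <= tag /\ i < k ->
       arr s' tag i = arr s tag i) ->
     run w task_step s' n2 Q) ->
  reaches w s (n1 + n2 + 2 * cost + 4) Q.
Proof.
  intros HS Hk HkM Hc0 Hhl HcM He0 He0' He1 He1' H20 HF HM.
  eapply reaches_weaken with (n := n1 + (cost + (cost + (n2 + 0 + 2))) + 2); [|lia | intros s' Hs'; exact Hs'].
  apply reaches_step; [lia|].
  eapply run_weaken; [exact HF | lia |].
  intros s1 (K1 & G1 & F1 & Fb & Fa & U0 & U1 & V0 & V1 & A1).
  apply reaches_trans.
  eapply reaches_weaken; [eapply HS with (k := k + 2) (p := c0) (e := e0); eauto; try lia | lia |].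
  intros s2 (K2 & G2 & (r0 & P0 & R0) & A2).
  apply reaches_trans.
  assert (Fb' : frame s2 (k + 1) 0 (c0 + h * l) h l e1).
  { unfold frame in *; rewrite !A2 by lia; auto. }
  assert (F1' : frame s2 k 1 p ph pl pe).
  { unfold frame in *; rewrite !A2 by lia; auto. }
  eapply reaches_weaken; [eapply HS with (k := k + 1) (p := c0 + h * l) (e := e1) (u := u1) (v := v1); eauto; try lia | lia |].
  { intros t Ht; rewrite A2 by lia; auto. }
  { intros t Ht; rewrite A2 by lia; auto. }
  intros s3 (K3 & G3 & (r1 & P1 & R1) & A3).
  apply reaches_step; [lia|].
  eapply run_weaken with (n := n2); [eapply HM with (r0 := r0) (r1 := r1) | lia | intros s4 HQ; apply reaches_here; [lia | exact HQ]]; auto.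
  - intros r Hr; rewrite K3, K2, K1; auto.
  - unfold frame in *; rewrite !A3 by lia; auto.
  - intros t Ht; rewrite A3 by lia; auto.
  - intros tag i Ht Hi; rewrite A3, A2, A1 by lia; auto.
Qed.

(** A solution of both recurrences: splitting x^(2h) gives T(kh + 1, kl) = 2 T(kh, kl) + 6000 h l
    exactly, with h = 2^kh and l = 2^kl. In the change of variables the summand -1 doubles, which
    leaves 3000 units per coefficient for the passes. *)
Definition task_cost (kh kl : Z) : Z := 3000 * 2 ^ (kh + kl) * (2 * kl * kl - 1 + kh).
Definition task_depth (kh kl : Z) : Z := 2 * (2 * kl + kh) + 3.

Lemma solves_base w M : 32 * M + 64 < 2 ^ w -> solves w M (2 ^ 0) (2 ^ 1) 0 (task_cost 0 1) (task_depth 0 1).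
Proof.
  intros HM e k p s u v Hk HkM Hp HpM He He' H20 HF Hu Hv.
  change (2 ^ 0) with 1 in *; change (2 ^ 1) with 2 in *; change (1 * 2) with 2 in *;
  change (task_depth 0 1) with 7 in *; change (task_cost 0 1) with 6000 in *.
  eapply reaches_weaken with (n := 200 + 0 + 2).
  { apply reaches_step; [lia|].
    eapply run_weaken; [eapply run_base with (M := M) (p := p) (k := k) (u := u) (v := v); eauto; lia | apply Z.le_refl |].
    intros s' Hs'; apply reaches_here; [lia | exact Hs']. }
  { lia. }
  intros s' (K & G & V0 & V1 & A); split; [exact K | split; [exact G | split]].
  - exists (fun t => if t =? 0 then u 0 * v 0 - u 1 * v 1 else u 0 * v 1 + u 1 * v 0); split.
    + apply Negacyclic.base_product; reflexivity.
    + intros t Ht; assert (t = 0 \/ t = 1) as [-> | ->] by lia; [rewrite Z.add_0_r|]; auto.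
  - intros tag i Ht Hi; apply A; lia.
Qed.

(** That h divides e is what makes e even at every level of splitting; passing to e + l preserves
    the divisibility because h also divides l. *)
Lemma solves_split w M kh kl sc :
  32 * M + 64 < 2 ^ w -> 0 <= kh -> kh + 1 <= kl ->
  solves w M (2 ^ kh) (2 ^ kl) sc (task_cost kh kl) (task_depth kh kl) ->
  solves w M (2 ^ (kh + 1)) (2 ^ kl) (S sc) (task_cost (kh + 1) kl) (task_depth (kh + 1) kl).
Proof.
  intros HM Hkh Hkl HS e k p s u v Hk HkM Hp HpM (q & Hq) He H20 HF Hu Hv.
  set (h := 2 ^ kh) in *; set (l := 2 ^ kl) in *.
  assert (Hh : 0 < h) by (apply Z.pow_pos_nonneg; lia).
  assert (E2 : 2 ^ (kh + 1) = 2 * h) by (rewrite Z.pow_add_r by lia; unfold h; lia).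
  assert (Hl : 2 <= l) by (unfold l; change 2 with (2 ^ 1) at 1; apply Z.pow_le_mono_r; lia).
  assert (Hhl : (h | l)).
  { exists (2 ^ (kl - kh)); unfold h, l; rewrite <- Z.pow_add_r by lia; f_equal; lia. }
  rewrite E2 in *.
  assert (Ee : e = 2 * (q * h)) by lia; set (e' := q * h) in *.
  rewrite Ee in *; clear Ee Hq.
  set (sz := h * l) in *.
  assert (S2 : 2 * h * l = 2 * sz) by (unfold sz; lia); rewrite S2 in *.
  assert (Hlsz : l <= sz) by (unfold sz; nia).
  assert (Cost : task_cost (kh + 1) kl = 2 * task_cost kh kl + 6000 * sz).
  { unfold task_cost, sz, h, l; rewrite <- Z.pow_add_r by lia.
    replace (kh + 1 + kl) with (kh + kl + 1) by lia; rewrite (Z.pow_add_r 2 (kh + kl) 1) by lia.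
    change (2 ^ 1) with 2; ring. }
  eapply reaches_weaken with (n := 1600 * sz + 1000 * sz + 2 * task_cost kh kl + 4); [| lia | intros s' Hs'; exact Hs'].
  assert (Hd : task_depth (kh + 1) kl = task_depth kh kl + 2) by (unfold task_depth; lia).
  assert (Hd3 : 3 <= task_depth kh kl) by (unfold task_depth; lia).
  eapply two_children with (c0 := p + 4 * sz) (h := h) (l := l) (k := k) (p := p) (ph := 2 * h) (pl := l)
    (pe := 2 * e') (e0 := e') (e1 := e' + l) (u0 := split_lo l e' sz u) (u1 := split_hi l e' sz u)
    (v0 := split_lo l e' sz v) (v1 := split_hi l e' sz v); eauto; fold sz; try lia.
  - exists q; reflexivity.
  - apply Z.divide_add_r; [exists q; reflexivity | auto].
  - apply run_split_forward with (M := M); auto; fold sz; lia.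
  - intros s' r0 r1 K G F P0 P1 R0 R1 A.
    eapply run_weaken; [eapply (run_split_recombine w M s' k p h l e' r0 r1); auto; fold sz; lia | apply Z.le_refl |].
    fold sz; intros s'' (K2 & G2 & V1 & V2 & A2).
    split; [|split; [exact G2 | split]].
    + intros r Hr; rewrite K2, K; auto.
    + exists (fun t => if t <? sz then r0 t + r1 t else negrot l e' (fun t => r0 t - r1 t) (t - sz)); split.
      * apply Negacyclic.split_productZ with (r0 := r0) (r1 := r1); auto; try lia; fold sz.
        -- intros t Ht; rewrite (proj2 (Z.ltb_lt t sz)) by lia; auto.
        -- intros t Ht; rewrite (proj2 (Z.ltb_ge (sz + t) sz)) by lia; f_equal; lia.
      * rewrite S2; intros t Ht; cbv beta; destruct (Z.ltb_spec t sz).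
        -- apply V1; lia.
        -- replace (p + t) with (p + sz + (t - sz)) by lia; apply V2; lia.
    + rewrite S2; intros tag i Ht Hi; rewrite A2 by lia; apply A; lia.
Qed.

(** The exponents of the parts are 0 and [lq], where y^lq = -1 turns x^m - y^lq into x^m + 1. As m
    <= lq are powers of two, m divides both exponents, as the later splittings require. *)
Lemma solves_dup w M kl sc :
  32 * M + 64 < 2 ^ w -> 2 <= kl ->
  solves w M (2 ^ (kl / 2)) (2 ^ (kl - kl / 2)) sc
    (task_cost (kl / 2) (kl - kl / 2)) (task_depth (kl / 2) (kl - kl / 2)) ->
  solves w M (2 ^ 0) (2 ^ kl) (S sc) (task_cost 0 kl) (task_depth 0 kl).
Proof.
  intros HM Hkl HS e k p s u v Hk HkM Hp HpM _ He H20 HF Hu Hv.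
  destruct (half_bounds kl Hkl) as (B1 & B2 & B3 & B4).
  assert (Hd : kl = 2 * (kl / 2) + kl mod 2) by (apply Z.div_mod; lia).
  assert (Hd2 := Z.mod_pos_bound kl 2 ltac:(lia)).
  change (2 ^ 0) with 1 in *.
  set (a := kl / 2) in *; set (b := kl - a) in *; set (m := 2 ^ a) in *; set (lq := 2 ^ b) in *.
  set (sz := 2 ^ kl) in *.
  assert (Hab : kl = a + b) by lia.
  rewrite Z.mul_1_l in *.
  assert (Hd3 : task_depth a b + 2 <= task_depth 0 kl) by (unfold task_depth; lia).
  assert (Hd4 : 3 <= task_depth a b) by (unfold task_depth; lia).
  assert (Hlq : 2 * lq <= sz) by nia.
  assert (Hsz : 4 <= sz) by nia.
  assert (Cost : 2400 * sz + 2 * task_cost a b + 4 <= task_cost 0 kl).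
  { unfold task_cost; rewrite Z.add_0_l, <- Hab; fold sz.
    (* Here b is kl/2 rounded up and a is kl/2 rounded down; the inequality is tight at kl = 3. *)
    assert (4 * b * b + 2 * a <= 2 * kl * kl) by nia.
    assert (sz * (2 * (2 * b * b - 1 + a) + 1) <= sz * (2 * kl * kl - 1 + 0)) by (apply Z.mul_le_mono_nonneg_l; lia).
    lia. }
  eapply reaches_weaken with (n := 1400 * sz + 1000 * sz + 2 * task_cost a b + 4); [| lia | intros s' Hs'; exact Hs'].
  eapply two_children with (c0 := p + 2 * sz) (h := m) (l := lq) (k := k) (p := p) (ph := 1) (pl := sz)
    (pe := e) (e0 := 0) (e1 := lq) (u0 := dup_read m lq u) (u1 := dup_read m lq u)
    (v0 := dup_read m lq v) (v1 := dup_read m lq v); eauto; try lia.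
  - apply Z.divide_0_r.
  - exists (2 ^ (b - a)); unfold m, lq; rewrite <- Z.pow_add_r by lia; f_equal; lia.
  - rewrite B1; apply run_dup_forward with (M := M); auto; fold sz; lia.
  - intros s' r0 r1 K G F P0 P1 R0 R1 A; rewrite B1 in *.
    eapply run_weaken; [eapply (run_dup_recombine w M s' k p kl e r0 r1); auto; fold a b m lq sz; auto; lia | apply Z.le_refl |].
    fold a b m lq sz; intros s'' (K2 & G2 & V & A2).
    split; [|split; [exact G2 | split]].
    + intros r Hr; rewrite K2, K; auto.
    + eexists; split; [| rewrite Z.mul_1_l; exact V].
      rewrite <- B1; apply Negacyclic.dup_productZ with (r0 := r0) (r1 := r1); auto; try lia.
    + rewrite Z.mul_1_l; intros tag i Ht Hi; rewrite A2 by lia; apply A; lia.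
Qed.

(** The measure 2 kl + kh drops by one when x^h is split and by kl/2 >= 1 in the change of
    variables. It therefore bounds the exponent of the scaling factor too, and with two pending
    entries per level it gives [task_depth]. *)
Lemma solves_exists w M n : 32 * M + 64 < 2 ^ w -> forall kh kl,
  0 <= kh <= kl -> 1 <= kl -> 2 * kl + kh <= Z.of_nat n ->
  exists sc, Z.of_nat sc <= 2 * kl + kh /\
    solves w M (2 ^ kh) (2 ^ kl) sc (task_cost kh kl) (task_depth kh kl).
Proof.
  intros HM; induction n as [|n IH]; intros kh kl Hkh Hkl Hn; [lia|].
  destruct (Z.eq_dec kh 0) as [->|H0].
  - destruct (Z.eq_dec kl 1) as [->|H1].
    + exists 0%nat; split; [lia | apply solves_base; auto].
    + assert (Hd : kl = 2 * (kl / 2) + kl mod 2) by (apply Z.div_mod; lia).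
      assert (Hd2 := Z.mod_pos_bound kl 2 ltac:(lia)).
      destruct (IH (kl / 2) (kl - kl / 2)) as (sc & Hsc & HS); try lia.
      exists (S sc); split; [lia | apply solves_dup; auto; lia].
  - destruct (IH (kh - 1) kl) as (sc & Hsc & HS); try lia.
    exists (S sc); split; [lia|].
    replace kh with (kh - 1 + 1) by lia; apply solves_split; auto; lia.
Qed.

(** * Counting triples *)

Lemma sumZ_ext n f g : (forall i, 0 <= i < Z.of_nat n -> f i = g i) -> sumZ n f = sumZ n g.
Proof.
  induction n as [|n IH]; intros H; cbn [sumZ]; [reflexivity|].
  rewrite IH, (H (Z.of_nat n)) by (intros; try apply H; lia); reflexivity.
Qed.

Lemma sumZ_add n f g : sumZ n (fun i => f i + g i) = sumZ n f + sumZ n g.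
Proof. induction n; cbn [sumZ]; lia. Qed.

Lemma sumZ_zero n f : (forall i, 0 <= i < Z.of_nat n -> f i = 0) -> sumZ n f = 0.
Proof.
  intros H; induction n as [|n IH]; cbn [sumZ]; [reflexivity|].
  rewrite IH, (H (Z.of_nat n)) by (intros; try apply H; lia); reflexivity.
Qed.

Lemma sumZ_single n x f : 0 <= x < Z.of_nat n ->
  (forall i, 0 <= i < Z.of_nat n -> i <> x -> f i = 0) -> sumZ n f = f x.
Proof.
  intros Hx H; induction n as [|n IH]; cbn [sumZ]; [lia|].
  destruct (Z.eq_dec x (Z.of_nat n)) as [->|Hn].
  - rewrite sumZ_zero by (intros; apply H; lia); lia.
  - rewrite IH, (H (Z.of_nat n)) by (intros; try apply H; lia); lia.
Qed.

Lemma sumZ_bounds n f b : (forall i, 0 <= i < Z.of_nat n -> 0 <= f i <= b) ->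
  0 <= sumZ n f <= Z.of_nat n * b.
Proof.
  intros H; induction n as [|n IH]; cbn [sumZ]; [lia|].
  assert (0 <= f (Z.of_nat n) <= b) by (apply H; lia).
  assert (0 <= sumZ n f <= Z.of_nat n * b) by (apply IH; intros; apply H; lia).
  lia.
Qed.

Lemma sumZ_pos n f : (forall i, 0 <= i < Z.of_nat n -> 0 <= f i) ->
  (sumZ n f <> 0 <-> exists i, 0 <= i < Z.of_nat n /\ f i <> 0).
Proof.
  intros H; induction n as [|n IH]; cbn [sumZ].
  - split; [lia | intros (i & Hi & _); lia].
  - assert (0 <= f (Z.of_nat n)) by (apply H; lia).
    assert (Hs : 0 <= sumZ n f).
    { clear IH; induction n as [|n IH]; cbn [sumZ]; [lia|].
      assert (0 <= f (Z.of_nat n)) by (apply H; lia).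
      assert (0 <= sumZ n f) by (apply IH; intros; apply H; lia). lia. }
    specialize (IH ltac:(intros; apply H; lia)).
    split.
    + intros Hn; destruct (Z.eq_dec (f (Z.of_nat n)) 0).
      * destruct (proj1 IH ltac:(lia)) as (i & Hi & Hf); exists i; split; [lia | auto].
      * exists (Z.of_nat n); split; [lia | auto].
    + intros (i & Hi & Hf); destruct (Z.eq_dec i (Z.of_nat n)) as [->|Hne]; [lia|].
      assert (sumZ n f <> 0) by (apply IH; exists i; split; [lia | auto]); lia.
Qed.

Lemma conv_ext f f' g g' c :
  (forall t, 0 <= t <= c -> f t = f' t) -> (forall t, 0 <= t <= c -> g t = g' t) ->
  conv f g c = conv f' g' c.
Proof.
  intros Hf Hg; apply sumZ_ext; intros i Hi; rewrite Hf, Hg by lia; reflexivity.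
Qed.

Lemma conv_update f f' g c x d :
  0 <= x -> (forall t, 0 <= t -> f' t = f t + (if t =? x then d else 0)) ->
  conv f' g c = conv f g c + (if x <=? c then d * g (c - x) else 0).
Proof.
  intros Hx Hf; unfold conv.
  rewrite (sumZ_ext _ _ (fun i => f i * g (c - i) + (if i =? x then d else 0) * g (c - i))).
  2: { intros i Hi; rewrite Hf by lia; ring. }
  rewrite sumZ_add; f_equal.
  destruct (Z.leb_spec x c).
  - rewrite (sumZ_single _ x); [rewrite Z.eqb_refl; reflexivity | lia |].
    intros i Hi Hne; rewrite (proj2 (Z.eqb_neq i x)) by auto; lia.
  - apply sumZ_zero; intros i Hi; rewrite (proj2 (Z.eqb_neq i x)) by lia; lia.
Qed.

Lemma conv_bounds f g c : 0 <= c ->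
  (forall t, 0 <= t -> 0 <= f t <= 1) -> (forall t, 0 <= t -> 0 <= g t <= 1) ->
  0 <= conv f g c <= c + 1.
Proof.
  intros Hc Hf Hg.
  assert (0 <= conv f g c <= Z.of_nat (Z.to_nat (c + 1)) * 1); [|lia].
  apply sumZ_bounds; intros i Hi.
  specialize (Hf i ltac:(lia)); specialize (Hg (c - i) ltac:(lia)); nia.
Qed.

Lemma triples_update r f f' g h x d :
  0 <= x <= r -> (forall t, 0 <= t -> f' t = f t + (if t =? x then d else 0)) ->
  triples r f' g h = triples r f g h + d * conv g h (r - x).
Proof.
  intros Hx Hf; unfold triples.
  rewrite (sumZ_ext _ _ (fun i => f i * conv g h (r - i) + (if i =? x then d else 0) * conv g h (r - i))).
  2: { intros i Hi; rewrite Hf by lia; ring. }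
  rewrite sumZ_add; f_equal.
  rewrite (sumZ_single _ x); [rewrite Z.eqb_refl; reflexivity | lia |].
  intros i Hi Hne; rewrite (proj2 (Z.eqb_neq i x)) by auto; lia.
Qed.

(** This keeps the count below 2^w, so that the word holding it is zero only if the count is. *)
Lemma triples_bounds r f g h : 0 <= r ->
  (forall t, 0 <= t -> 0 <= f t <= 1) -> (forall t, 0 <= t -> 0 <= g t <= 1) ->
  (forall t, 0 <= t -> 0 <= h t <= 1) -> 0 <= triples r f g h <= (r + 1) * (r + 1).
Proof.
  intros Hr Hf Hg Hh.
  assert (0 <= triples r f g h <= Z.of_nat (Z.to_nat (r + 1)) * (r + 1)); [|lia].
  apply sumZ_bounds; intros i Hi.
  specialize (Hf i ltac:(lia)); pose proof (conv_bounds g h (r - i) ltac:(lia) Hg Hh).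
  assert (f i = 0 \/ f i = 1) as [-> | ->] by lia; lia.
Qed.

Lemma triples_nonzero r f g h : 0 <= r ->
  (forall t, 0 <= t -> 0 <= f t <= 1) -> (forall t, 0 <= t -> 0 <= g t <= 1) ->
  (forall t, 0 <= t -> 0 <= h t <= 1) ->
  (triples r f g h <> 0 <->
   exists x y, 0 <= x /\ 0 <= y /\ x + y <= r /\ f x = 1 /\ g y = 1 /\ h (r - x - y) = 1).
Proof.
  intros Hr Hf Hg Hh.
  assert (C : forall c, 0 <= c -> (conv g h c <> 0 <-> exists y, 0 <= y <= c /\ g y = 1 /\ h (c - y) = 1)).
  { intros c Hc; unfold conv; rewrite sumZ_pos.
    - split.
      + intros (y & Hy & Hn); exists y; specialize (Hg y ltac:(lia)); specialize (Hh (c - y) ltac:(lia)).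
        split; [lia|].
        assert (g y = 0 \/ g y = 1) as [E | E] by lia; rewrite E in Hn; lia.
      + intros (y & Hy & H1 & H2); exists y; rewrite H1, H2; lia.
    - intros i Hi; specialize (Hg i ltac:(lia)); specialize (Hh (c - i) ltac:(lia)); nia. }
  unfold triples; rewrite sumZ_pos.
  - split.
    + intros (x & Hx & Hn).
      destruct (proj1 (C (r - x) ltac:(lia)) ltac:(nia)) as (y & Hy & H1 & H2).
      exists x, y; specialize (Hf x ltac:(lia)).
      assert (f x = 0 \/ f x = 1) as [E | E] by lia; [rewrite E in Hn; lia|].
      repeat split; auto; lia.
    + intros (x & y & Hx & Hy & Hxy & H1 & H2 & H3); exists x; split; [lia|].
      assert (conv g h (r - x) <> 0) by (apply C; [lia|]; exists y; repeat split; auto; lia).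
      rewrite H1; lia.
  - intros i Hi; specialize (Hf i ltac:(lia)); pose proof (conv_bounds g h (r - i) ltac:(lia) Hg Hh).
  assert (f i = 0 \/ f i = 1) as [-> | ->] by lia; lia.
Qed.

(* [lp], [lx], [ls]: part, value and sign bit of the logged updates. *)
Definition log_delta (lp lx ls : Z -> Z) (p t i : Z) : Z :=
  if andb (lp i =? p) (lx i =? t) then 1 - 2 * ls i else 0.

Definition log_conv (lp lx ls g : Z -> Z) (p c i : Z) : Z :=
  if andb (lp i =? p) (lx i <=? c) then (1 - 2 * ls i) * g (c - lx i) else 0.

Lemma conv_log lp lx ls p f f' g c n :
  (forall i, 0 <= i < Z.of_nat n -> 0 <= lx i) ->
  (forall t, 0 <= t -> f' t = f t + sumZ n (log_delta lp lx ls p t)) ->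
  conv f' g c = conv f g c + sumZ n (log_conv lp lx ls g p c).
Proof.
  revert f'; induction n as [|n IH]; intros f' Hx Hf; cbn [sumZ].
  - rewrite Z.add_0_r; apply conv_ext; auto; intros t Ht; rewrite Hf by lia; cbn; lia.
  - cbn [sumZ] in Hf.
    rewrite Z.add_assoc, <- (IH (fun t => f t + sumZ n (log_delta lp lx ls p t))) by (auto; intros; apply Hx; lia).
    assert (Hn := Hx (Z.of_nat n) ltac:(lia)).
    unfold log_delta at 2 in Hf; unfold log_conv.
    destruct (lp (Z.of_nat n) =? p); cbn [andb] in *.
    + apply conv_update; auto; intros t Ht; rewrite Hf by auto.
      rewrite (Z.eqb_sym t); lia.
    + rewrite Z.add_0_r; apply conv_ext; auto; intros t Ht; rewrite Hf by lia; lia.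
Qed.

(** The data lie in [0, P], so a mark times an entry has degree in [3P, 4P] and a product of entries
    at most 2P: only the two marks meet in degree 6P. The mark 3P is still below half of the length
    8P of the product. *)
Lemma conv_marked f g P :
  0 < P -> (forall x, P < x -> f x = 0 /\ g x = 0) ->
  let mark h x := if x =? 3 * P then 1 else h x in
  (forall t, 0 <= t <= P -> conv (mark f) (mark g) t = conv f g t) /\
  conv (mark f) (mark g) (6 * P) = 1.
Proof.
  intros HP Hz mark; split.
  - intros t Ht; apply conv_ext; intros x Hx; unfold mark; rewrite (proj2 (Z.eqb_neq _ _)) by lia; auto.
  - unfold conv; rewrite (sumZ_single _ (3 * P)); [|lia|].
    + unfold mark; rewrite Z.eqb_refl, (proj2 (Z.eqb_eq _ _)) by lia; lia.
    + intros i Hi Hne; unfold mark; rewrite (proj2 (Z.eqb_neq i _)), (proj2 (Z.eqb_neq (6 * P - i) _)) by lia.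
      destruct (Z_lt_le_dec P i).
      * rewrite (proj1 (Hz i ltac:(lia))); lia.
      * rewrite (proj2 (Hz (6 * P - i) ltac:(lia))); lia.
Qed.

(** * Updates and rebuilding *)

Definition product : cmd :=
  Seq (Assign 20 (#0)) (Seq (push (#0) (#0) (#1) (#8 * $4) (#0))%e task_loop).

(** The task has h = 1 and l = 2^(kl+1): its memory 5 l + 11 l is 32 * 2^kl, and its stack depth is
    4 kl + 7. *)
Lemma product_spec w M kl : 32 * M + 64 < 2 ^ w -> 0 <= kl -> 32 * 2 ^ kl + 4 * kl + 7 <= M ->
  exists sc, Z.of_nat sc <= 2 * (kl + 1) /\ forall s u v,
    8 * regs s 4 = 2 * 2 ^ kl ->
    (forall t, 2 ^ kl <= t < 2 * 2 ^ kl -> u t = 0 /\ v t = 0) ->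
    wrap_eq_on w s 11 0 (2 * 2 ^ kl) u -> wrap_eq_on w s 12 0 (2 * 2 ^ kl) v ->
    run w product s (task_cost 0 (kl + 1) + 100) (fun s' => keep s s' /\
      wrap_eq_on w s' 11 0 (2 * 2 ^ kl) (fun t => 2 ^ Z.of_nat sc * conv u v t) /\
      (forall tag i, 0 <= tag < 32 -> tag < 11 \/ 17 < tag -> arr s' tag i = arr s tag i)).
Proof.
  intros HM Hkl HB.
  destruct (solves_exists w M (Z.to_nat (2 * (kl + 1))) HM 0 (kl + 1)) as (sc & Hsc & HS); try lia.
  exists sc; split; [lia|]. intros s u v H4 Huv Hu Hv.
  assert (H2 : 2 ^ (kl + 1) = 2 * 2 ^ kl) by (rewrite Z.pow_add_r by lia; lia).
  assert (Hp : 0 < 2 ^ kl) by (apply Z.pow_pos_nonneg; lia).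
  rewrite H2 in HS; change (2 ^ 0) with 1 in HS.
  unfold product; apply run_seq with (n1 := 2) (n2 := task_cost 0 (kl + 1) + 90); [|lia].
  apply run_assign with (v := 0); [ev | costs; lia |].
  apply run_seq with (n1 := 60) (n2 := task_cost 0 (kl + 1) + 2); [|lia].
  apply run_push with (k := 0) (ty := 0) (p := 0) (h := 1) (l := 2 * 2 ^ kl) (e := 0);
    [reflexivity | lia | lia | | costs; lia |].
  { intros s' Hr; split; [ev|]; split; [ev|]; split; [ev|]; split; [|ev].
    assert (G4 : 8 * regs s' 4 = 2 * 2 ^ kl) by (rewrite Hr; exact H4).
    apply eval_eq; cbn [safe ueval uop]; rewrite ?G4; [repeat split; lia | reflexivity]. }
  intros s1 R1 K1 F1 A1.
  destruct (HS 0 0 0 s1 u v) as (s2 & (K2 & G2 & (r & P & V) & A2) & HL); auto; try lia.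
  - unfold task_depth; lia.
  - exists 0; lia.
  - rewrite Z.mul_1_l; intros t Ht; rewrite A1, arr_set_reg by lia; auto.
  - rewrite Z.mul_1_l; intros t Ht; rewrite A1, arr_set_reg by lia; auto.
  - apply HL; exists 2%nat, s2; split; [apply exec_while_false; exact G2 | split; [lia|]].
    split; [|split].
    + intros q Hq; rewrite K2, R1 by lia; cbn; destruct (Nat.eqb_spec q 20); [lia | auto].
    + rewrite Z.mul_1_l in V; intros t Ht; rewrite V by auto.
      f_equal; eapply (Negacyclic.product_convZ (m := 2 ^ kl)); eauto.
    + intros tag i Ht Hi; rewrite A2, A1 by lia; apply arr_set_reg.
Qed.

Definition nxt (j : Z) : Z := (j + 1) mod 3.
Definition prv (j : Z) : Z := (j + 2) mod 3.

(* The marks make coefficient 6P of the product the scaling factor 2^sc.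
   Adding 0 reduces the entries of array 11, known only modulo 2^w, to words. *)
Definition rebuild_part (j : Z) : cmd :=
  Seq (gather 11 (#0) (#8 * $4) (cell (nxt j) ($28)))%e
  (Seq (gather 12 (#0) (#8 * $4) (cell (prv j) ($28)))%e
  (Seq (gather (3 + j) (#0) ($3 + #1) (cell j ($28)))%e
  (Seq (Store (addr 11 (#3 * $4)%e) (#1))
  (Seq (Store (addr 12 (#3 * $4)%e) (#1))
  (Seq product
  (Seq (Assign 14 (cell 11 (#6 * $4) + #0))%e
       (gather (6 + j) (#0) ($3 + #1) ((cell 11 ($28) + #0) / $14))%e)))))).

Definition zero_one (r : Z) (f : Z -> Z) : Prop :=
  (forall t, 0 <= t -> 0 <= f t <= 1) /\ (forall t, r < t -> f t = 0).

Lemma run_rebuild_part w s j r L :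
  32 * (256 * 2 ^ L) + 64 < 2 ^ w -> 64 * 2 ^ L * 2 ^ L * (2 ^ L + 1) < 2 ^ w ->
  0 <= j < 3 -> 1 <= L -> 0 <= r <= 2 ^ L -> regs s 3 = r -> regs s 4 = 2 ^ L ->
  (forall q, 0 <= q < 3 -> zero_one r (arr s q)) ->
  run w (rebuild_part j) s (task_cost 0 (L + 3) + 3000 * 2 ^ L) (fun s' =>
    (forall q, (q < 14)%nat -> regs s' q = regs s q) /\
    (forall tag i, 0 <= tag < 32 -> tag <> 6 + j -> tag < 11 \/ 17 < tag ->
        tag <> 3 + j \/ i < 0 \/ r < i -> arr s' tag i = arr s tag i) /\
    (forall t, 0 <= t <= r -> arr s' (3 + j) t = arr s j t) /\
    (forall z, 0 <= z <= r -> arr s' (6 + j) z = conv (arr s (nxt j)) (arr s (prv j)) z)).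
Proof.
  intros HW HW2 Hj HL Hr H3 H4 Hc.
  set (P := 2 ^ L) in *.
  assert (HP : 2 <= P) by (unfold P; change 2 with (2 ^ 1) at 1; apply Z.pow_le_mono_r; lia).
  assert (HPL : L < P) by (apply kl_le_pow; lia).
  assert (H4P : 2 ^ (L + 2) = 4 * P) by (unfold P; rewrite Z.pow_add_r by lia; lia).
  destruct (product_spec w (256 * P) (L + 2)) as (sc & Hsc & HX); [lia | lia | lia |].
  replace (L + 2 + 1) with (L + 3) in * by lia; rewrite H4P in HX.
  assert (HC : 0 <= task_cost 0 (L + 3)).
  { unfold task_cost; apply Z.mul_nonneg_nonneg; [|nia].
    apply Z.mul_nonneg_nonneg; [lia | apply Z.pow_nonneg; lia]. }
  assert (Hn : 0 <= nxt j < 3) by (apply Z.mod_pos_bound; lia).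
  assert (Hp : 0 <= prv j < 3) by (apply Z.mod_pos_bound; lia).
  destruct (Hc (nxt j) Hn) as (N1 & N0); destruct (Hc (prv j) Hp) as (P1 & P0).
  set (T := task_cost 0 (L + 3)) in *.
  assert (C : forall tag, ecost (cell tag ($28)%e) = 6) by reflexivity.
  apply run_seq with (n1 := 400 * P) (n2 := T + 2500 * P); [|lia].
  eapply run_weaken.
  { apply run_gather with (d := 0) (N := 8 * P) (P := fun t v => v = arr s (nxt j) t) (m := 400 * P);
      [lia | lia | lia | lia | | costs; lia].
    intros s' R A B. assert (G4 : regs s' 4 = P) by (rewrite R by discriminate; auto).
    split; [ev|]. split; [ev|]. intros Hlt.
    rewrite (eval_cell w s' _ _ (regs s' 28)) by (auto; lia). apply A; lia. }
  { lia. }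
  intros s1 (R1 & A1 & V1).
  apply run_seq with (n1 := 400 * P) (n2 := T + 2000 * P); [|lia].
  eapply run_weaken.
  { apply run_gather with (d := 0) (N := 8 * P) (P := fun t v => v = arr s (prv j) t) (m := 400 * P);
      [lia | lia | lia | lia | | costs; lia].
    intros s' R A B. assert (G4 : regs s' 4 = P) by (rewrite R, R1 by discriminate; auto).
    split; [ev|]. split; [ev|]. intros Hlt.
    rewrite (eval_cell w s' _ _ (regs s' 28)) by (auto; lia). rewrite A, A1 by lia; reflexivity. }
  { lia. }
  intros s2 (R2 & A2 & V2).
  apply run_seq with (n1 := 100 * P) (n2 := T + 1800 * P); [|lia].
  eapply run_weaken.
  { apply run_gather with (d := 0) (N := r + 1) (P := fun t v => v = arr s j t) (m := 100 * P);
      [lia | lia | lia | lia | | costs; lia].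
    intros s' R A B. assert (G4 : regs s' 3 = r) by (rewrite R, R2, R1 by discriminate; auto).
    split; [ev|]. split; [ev|]. intros Hlt.
    rewrite (eval_cell w s' _ _ (regs s' 28)) by (auto; lia). rewrite A, A2, A1 by lia; reflexivity. }
  { lia. }
  intros s3 (R3 & A3 & V3).
  assert (R30 : forall q, q <> 28%nat -> regs s3 q = regs s q).
  { intros q Hq; rewrite R3, R2, R1 by auto; auto. }
  assert (A30 : forall tag i, 0 <= tag < 32 -> tag <> 11 -> tag <> 12 ->
    tag <> 3 + j \/ i < 0 \/ r < i -> arr s3 tag i = arr s tag i).
  { intros tag i Ht H11 H12 Hi; rewrite A3, A2, A1 by lia; auto. }
  assert (G4 : regs s3 4 = P) by (rewrite R30 by discriminate; auto).
  apply run_seq with (n1 := 12) (n2 := T + 1700 * P); [|lia].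
  apply run_store with (i := 3 * P) (v := 1); [ev | lia | lia | lia | ev | costs; lia |].
  apply run_seq with (n1 := 12) (n2 := T + 1600 * P); [|lia].
  apply run_store with (i := 3 * P) (v := 1); [ev | lia | lia | lia | ev | costs; lia |].
  set (s5 := set_mem _ _ _).
  assert (A5 : forall tag i, 0 <= tag < 32 -> arr s5 tag i =
    if andb (tag =? 12) (i =? 3 * P) then 1 else if andb (tag =? 11) (i =? 3 * P) then 1 else arr s3 tag i).
  { intros tag i Ht; unfold s5; rewrite !(arr_set_mem _ _ _ _ _ _ (3 * P)) by (eauto; lia); reflexivity. }
  assert (R5 : forall q, q <> 28%nat -> regs s5 q = regs s q) by (intros; apply R30; auto).
  clearbody s5.
  set (u := fun x => if x =? 3 * P then 1 else arr s (nxt j) x).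
  set (v := fun x => if x =? 3 * P then 1 else arr s (prv j) x).
  destruct (conv_marked (arr s (nxt j)) (arr s (prv j)) P) as (CM & CS); [lia | |].
  { intros x Hx; split; [apply N0 | apply P0]; lia. }
  fold u v in CM, CS.
  apply run_seq with (n1 := T + 100) (n2 := 1400 * P); [|lia].
  eapply run_weaken; [apply (HX s5 u v) | lia |].
  { rewrite R5 by discriminate; lia. }
  { intros t Ht; unfold u, v; rewrite (proj2 (Z.eqb_neq _ _)) by lia; split; [apply N0 | apply P0]; lia. }
  { intros t Ht; rewrite A5 by lia; change (11 =? 12) with false; change (11 =? 11) with true; cbn [andb].
    unfold u; rewrite Z.add_0_l; destruct (Z.eqb_spec t (3 * P)); [reflexivity|].
    f_equal; rewrite A3, A2 by lia; apply V1; lia. }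
  { intros t Ht; rewrite A5 by lia; change (12 =? 12) with true; change (12 =? 11) with false; cbn [andb].
    unfold v; rewrite Z.add_0_l; destruct (Z.eqb_spec t (3 * P)); [reflexivity|].
    f_equal; rewrite A3 by lia; apply V2; lia. }
  intros s6 (K6 & V6 & A6).
  set (S := 2 ^ Z.of_nat sc) in *.
  (* The exponent is at most 2 (L + 3), and 2^(2L + 6) = 64 P^2. *)
  assert (HS : 0 < S <= 64 * P * P).
  { split; [apply Z.pow_pos_nonneg; lia|].
    replace (64 * P * P) with (2 ^ (2 * (L + 3))); [apply Z.pow_le_mono_r; lia|].
    replace (2 * (L + 3)) with (L + L + 6) by lia; rewrite !Z.pow_add_r by lia; unfold P; lia. }
  assert (CB : forall z, 0 <= z <= P -> 0 <= conv (arr s (nxt j)) (arr s (prv j)) z <= P + 1).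
  { intros z Hz; pose proof (conv_bounds (arr s (nxt j)) (arr s (prv j)) z ltac:(lia) N1 P1); lia. }
  (* A scaled coefficient is at most 64 P^2 (P + 1) < 2^w, so the residue is the integer itself and
     the later division is exact. *)
  assert (V6' : forall z, 0 <= z <= P -> wrap w (arr s6 11 z) = S * conv (arr s (nxt j)) (arr s (prv j)) z).
  { intros z Hz; rewrite <- (Z.add_0_l z) at 1; rewrite V6, CM by lia.
    specialize (CB z Hz); apply wrap_small; nia. }
  assert (V6S : wrap w (arr s6 11 (6 * P)) = S).
  { rewrite <- (Z.add_0_l (6 * P)); rewrite V6, CS, Z.mul_1_r by lia.
    apply wrap_small; nia. }
  apply run_seq with (n1 := 20) (n2 := 1200 * P); [|lia].
  assert (G46 : regs s6 4 = P) by (rewrite K6, R5 by (lia || discriminate); auto).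
  assert (G36 : regs s6 3 = r) by (rewrite K6, R5 by (lia || discriminate); auto).
  apply run_assign with (v := S); [| costs; lia |].
  { rewrite <- V6S; cbn [eval].
    change (eval_binop w BAdd (eval w s6 (cell 11 (#6 * $4)%e)) (wrap w 0) = wrap w (arr s6 11 (6 * P))).
    rewrite (eval_cell w s6 11 _ (6 * P)); [| ev | lia | lia | lia].
    unfold eval_binop; rewrite (wrap_small w 0), Z.add_0_r; lia. }
  eapply run_weaken.
  { apply run_gather with (d := 0) (N := r + 1) (m := 1200 * P)
      (P := fun z v => v = conv (arr s (nxt j)) (arr s (prv j)) z);
      [lia | lia | lia | lia | | costs; lia].
    intros s' R A B.
    assert (G3 : regs s' 3 = r) by (rewrite R by discriminate; exact G36).
    assert (G14 : regs s' 14 = S) by (rewrite R by discriminate; reflexivity).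
    split; [ev|]. split; [ev|]. intros Hlt.
    change (eval_binop w BDiv (eval_binop w BAdd (eval w s' (cell 11 ($28)%e)) (wrap w 0)) (regs s' 14) =
      conv (arr s (nxt j)) (arr s (prv j)) (regs s' 28)).
    rewrite (eval_cell w s' _ _ (regs s' 28)) by (auto; lia).
    rewrite A, arr_set_reg by lia.
    unfold eval_binop; rewrite (wrap_small w 0), Z.add_0_r, V6', G14, (Z.mul_comm S), Z.div_mul by lia.
    specialize (CB (regs s' 28) ltac:(lia)); apply wrap_small; lia. }
  { lia. }
  intros s8 (R8 & A8 & V8); split; [|split; [|split]].
  - intros q Hq; rewrite R8 by lia; cbn; destruct (Nat.eqb_spec q 14); [lia|].
    rewrite K6, R5 by lia; auto.
  - intros tag i Ht H6 H11 Hi; rewrite A8, arr_set_reg, A6, A5 by lia.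
    rewrite (proj2 (Z.eqb_neq tag 12)), (proj2 (Z.eqb_neq tag 11)) by lia; cbn [andb].
    apply A30; lia.
  - intros t Ht; rewrite A8, arr_set_reg, A6, A5 by lia.
    rewrite (proj2 (Z.eqb_neq (3 + j) 12)), (proj2 (Z.eqb_neq (3 + j) 11)) by lia; cbn [andb].
    apply V3; lia.
  - intros z Hz; apply V8; lia.
Qed.

Definition rebuild : cmd :=
  Seq (rebuild_part 0) (Seq (rebuild_part 1) (Seq (rebuild_part 2) (Assign 6 (#0)))).

(** For f' = f + df and g' = g + dg one has f' * g' = f * g + df * g' + f * dg, with * the
    convolution. Hence an entry of part [nxt j] is paired with the current set [prv j], and an entry
    of part [prv j] with the snapshot of [nxt j]. The first test discards entries for which r - x -
    y is negative. *)
Definition scan_entry (j : Z) : cmd :=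
  Seq (Assign 10 (cell 10 ($9))) (Seq (Assign 11 (cell 9 ($9)))
  (Seq (Assign 12 (#1 - #2 * cell 18 ($9))%e)
  (Seq (If ($3 <? $2 + $10)%e Skip
    (Seq (Assign 13 ($3 - $2 - $10))
      (If ($11 =? #(nxt j))%e (Assign 8 ($8 + $12 * cell (prv j) ($13))%e)
      (If ($11 =? #(prv j))%e (Assign 8 ($8 + $12 * cell (3 + nxt j) ($13))%e) Skip))))
  (Assign 9 ($9 + #1))))).

(** The kind in register 0 is also the membership bit of the number before the update, 0 for an
    insertion and 1 for a deletion. So 1 - $0 is the new bit, and logging $0 records the sign of the
    change. *)
Definition update_part (j : Z) : cmd :=
  Seq (Assign 8 (cell (6 + j) ($3 - $2)%e)) (Seq (Assign 9 (#0))
  (Seq (While ($9 <? $6)%e (scan_entry j))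
  (Seq (If ($0) (Assign 7 ($7 - $8)) (Assign 7 ($7 + $8)))
  (Seq (Store (addr j ($2)) (#1 - $0))
  (Seq (Store (addr 9 ($6)) (#j))
  (Seq (Store (addr 10 ($6)) ($2))
  (Seq (Store (addr 18 ($6)) ($0))
  (Assign 6 ($6 + #1))))))))).

(* Register 3 holds rmax, 6 the length of the log, 7 the number of triples.  Arrays
   0, 1, 2 are the characteristic functions of the three sets, 3, 4, 5 their snapshots,
   6, 7, 8 the convolutions, and 9, 10, 18 the log. *)
Definition data_ok (w r : Z) (s : state) : Prop :=
  regs s 3 = r /\ 0 <= regs s 6 /\
  (forall p, 0 <= p < 3 -> zero_one r (arr s p)) /\
  (forall i, 0 <= i < regs s 6 -> 0 <= arr s 10 i <= r) /\
  (forall p t, 0 <= p < 3 -> 0 <= t -> arr s p t = arr s (3 + p) t +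
     sumZ (Z.to_nat (regs s 6)) (log_delta (arr s 9) (arr s 10) (arr s 18) p t)) /\
  (forall j z, 0 <= j < 3 -> 0 <= z <= r ->
     arr s (6 + j) z = conv (arr s (3 + nxt j)) (arr s (3 + prv j)) z) /\
  regs s 7 = wrap w (triples r (arr s 0) (arr s 1) (arr s 2)).

Lemma triples_ext r f f' g g' h h' :
  (forall t, 0 <= t <= r -> f t = f' t) -> (forall t, 0 <= t <= r -> g t = g' t) ->
  (forall t, 0 <= t <= r -> h t = h' t) -> triples r f g h = triples r f' g' h'.
Proof.
  intros Hf Hg Hh; apply sumZ_ext; intros i Hi; rewrite Hf by lia.
  f_equal; apply conv_ext; intros; [apply Hg | apply Hh]; lia.
Qed.

Lemma part_cases j : 0 <= j < 3 -> j = 0 \/ j = 1 \/ j = 2.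
Proof. lia. Qed.

Lemma triples_parts r (f : Z -> Z -> Z) j : 0 <= r -> 0 <= j < 3 ->
  triples r (f 0) (f 1) (f 2) = triples r (f j) (f (nxt j)) (f (prv j)).
Proof.
  intros Hr Hj; destruct (part_cases j Hj) as [-> | [-> | ->]];
    unfold nxt, prv; cbn [Z.add Pos.add].
  - reflexivity.
  - apply Negacyclic.triples_rot; auto.
  - rewrite Negacyclic.triples_rot by auto; apply Negacyclic.triples_rot; auto.
Qed.

(** Rebuilding copies only the positions 0 to r of a set. Beyond r the snapshot has to agree with
    the set already, and it does: no log entry lies there, so both are zero. *)
Lemma old_zero w r s p t : data_ok w r s -> 0 <= p < 3 -> 0 <= r -> r < t -> arr s (3 + p) t = 0.
Proof.
  intros (_ & _ & Hc & Hl & Ho & _) Hp Hr Ht.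
  specialize (Ho p t Hp ltac:(lia)); rewrite sumZ_zero in Ho.
  - rewrite (proj2 (Hc p Hp)) in Ho by lia; lia.
  - intros i Hi; unfold log_delta; specialize (Hl i ltac:(lia)).
    rewrite (proj2 (Z.eqb_neq (arr s 10 i) t)) by lia; rewrite Bool.andb_false_r; reflexivity.
Qed.

Lemma run_rebuild w s r L :
  32 * (256 * 2 ^ L) + 64 < 2 ^ w -> 64 * 2 ^ L * 2 ^ L * (2 ^ L + 1) < 2 ^ w ->
  1 <= L -> 0 <= r <= 2 ^ L -> regs s 4 = 2 ^ L -> data_ok w r s ->
  run w rebuild s (3 * task_cost 0 (L + 3) + 9000 * 2 ^ L + 10) (fun s' =>
    data_ok w r s' /\ regs s' 4 = regs s 4 /\ regs s' 5 = regs s 5 /\ regs s' 6 = 0 /\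
    (forall p t, 0 <= p < 3 -> arr s' p t = arr s p t)).
Proof.
  intros HW HW2 HL Hr H4 HD; pose proof HD as (H3 & H6 & Hc & Hl & Ho & Hv & HT).
  pose (post := fun j s s' =>
    (forall q, (q < 14)%nat -> regs s' q = regs s q) /\
    (forall tag i, 0 <= tag < 32 -> tag <> 6 + j -> tag < 11 \/ 17 < tag ->
        tag <> 3 + j \/ i < 0 \/ r < i -> arr s' tag i = arr s tag i) /\
    (forall t, 0 <= t <= r -> arr s' (3 + j) t = arr s j t) /\
    (forall z, 0 <= z <= r -> arr s' (6 + j) z = conv (arr s (nxt j)) (arr s (prv j)) z)).
  assert (Step : forall j s1, 0 <= j < 3 -> (forall q, (q < 14)%nat -> regs s1 q = regs s q) ->
     (forall p t, 0 <= p < 3 -> arr s1 p t = arr s p t) ->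
     run w (rebuild_part j) s1 (task_cost 0 (L + 3) + 3000 * 2 ^ L) (post j s1)).
  { intros j s1 Hj R A; apply run_rebuild_part; auto; try (rewrite R by lia; auto).
    intros q Hq; destruct (Hc q Hq) as (C1 & C2); split; intros t Ht; rewrite A by lia; auto. }
  set (T := task_cost 0 (L + 3) + 3000 * 2 ^ L) in *.
  unfold rebuild.
  apply run_seq with (n1 := T) (n2 := 2 * T + 8); [|lia].
  eapply run_weaken; [apply Step; auto; lia | lia |].
  intros s1 (R1 & A1 & V1 & W1).
  apply run_seq with (n1 := T) (n2 := T + 6); [|lia].
  eapply run_weaken; [apply Step; auto; [lia | intros; apply A1; lia] | lia |].
  intros s2 (R2 & A2 & V2 & W2).
  apply run_seq with (n1 := T) (n2 := 2); [|lia].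
  eapply run_weaken; [apply Step; auto; [lia | intros; rewrite R2, R1 by lia; auto | intros; rewrite A2, A1 by lia; auto] | lia |].
  intros s3 (R3 & A3 & V3 & W3).
  assert (Cur : forall p t, 0 <= p < 3 -> arr s3 p t = arr s p t).
  { intros; rewrite A3, A2, A1 by lia; auto. }
  assert (Old : forall p t, 0 <= p < 3 -> 0 <= t -> arr s3 (3 + p) t = arr s p t).
  { intros p t Hp Ht; destruct (Z_le_gt_dec t r) as [Htr|Htr].
    - destruct (part_cases p Hp) as [-> | [-> | ->]].
      + rewrite A3, A2, V1 by lia; auto.
      + rewrite A3, V2, A1 by lia; auto.
      + rewrite V3, A2, A1 by lia; auto.
    - rewrite A3, A2, A1 by lia.
      rewrite (old_zero w r s p t HD Hp) by lia; symmetry; apply Hc; lia. }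
  apply run_assign with (v := 0); [ev | cbv; congruence |].
  split; [|split; [|split; [|split]]].
  - unfold data_ok; cbn [regs set_reg Nat.eqb].
    split; [rewrite R3, R2, R1 by lia; auto|]. split; [lia|].
    split.
    { intros p Hp; destruct (Hc p Hp) as (C1 & C2); split; intros t Ht; rewrite arr_set_reg, Cur by lia; auto. }
    split; [intros; lia|]. split.
    { intros p t Hp Ht; rewrite !arr_set_reg, Cur, Old by lia; cbn [sumZ Z.to_nat]; lia. }
    split.
    { intros j z Hj Hz; rewrite arr_set_reg.
      assert (Hn : 0 <= nxt j < 3) by (apply Z.mod_pos_bound; lia).
      assert (Hp : 0 <= prv j < 3) by (apply Z.mod_pos_bound; lia).
      transitivity (conv (arr s (nxt j)) (arr s (prv j)) z).
      - destruct (part_cases j Hj) as [-> | [-> | ->]].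
        + rewrite A3, A2, W1 by lia; auto.
        + rewrite A3, W2 by lia; apply conv_ext; intros; apply A1; lia.
        + rewrite W3 by lia; apply conv_ext; intros; rewrite A2, A1 by lia; auto.
      - apply conv_ext; intros; rewrite arr_set_reg, Old by lia; auto. }
    rewrite R3, R2, R1, HT by lia; f_equal.
    apply triples_ext; intros; rewrite arr_set_reg, Cur by lia; auto.
  - cbn [regs set_reg Nat.eqb]; rewrite R3, R2, R1 by lia; auto.
  - cbn [regs set_reg Nat.eqb]; rewrite R3, R2, R1 by lia; auto.
  - reflexivity.
  - intros; rewrite arr_set_reg; apply Cur; auto.
Qed.

Lemma sumZ_succ n f : 0 <= n -> sumZ (Z.to_nat (n + 1)) f = sumZ (Z.to_nat n) f + f n.
Proof.
  intros Hn; replace (Z.to_nat (n + 1)) with (S (Z.to_nat n)) by lia.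
  cbn [sumZ]; rewrite Z2Nat.id by lia; reflexivity.
Qed.

Lemma eval_test w s e (b : bool) : eval w s e = (if b then 1 else 0) ->
  (eval w s e <> 0 -> b = true) /\ (eval w s e = 0 -> b = false).
Proof. intros ->; destruct b; split; intros; congruence. Qed.

Lemma eval_lt w s a b x y : 1 < 2 ^ w -> eval w s a = x -> eval w s b = y ->
  eval w s (a <? b)%e = (if x <? y then 1 else 0).
Proof.
  intros HW <- <-; cbn [eval]; unfold eval_binop; apply wrap_small; destruct (_ <? _); lia.
Qed.

Lemma eval_eqb w s a b x y : 1 < 2 ^ w -> eval w s a = x -> eval w s b = y ->
  eval w s (a =? b)%e = (if x =? y then 1 else 0).
Proof.
  intros HW <- <-; cbn [eval]; unfold eval_binop; apply wrap_small; destruct (_ =? _); lia.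
Qed.

Definition entry_sum (s : state) (j c i : Z) : Z :=
  log_conv (arr s 9) (arr s 10) (arr s 18) (arr s (prv j)) (nxt j) c i +
  log_conv (arr s 9) (arr s 10) (arr s 18) (arr s (3 + nxt j)) (prv j) c i.

Lemma nxt_prv j : 0 <= j < 3 ->
  0 <= nxt j < 3 /\ 0 <= prv j < 3 /\ nxt j <> prv j /\ nxt j <> j /\ prv j <> j.
Proof. intros H; destruct (part_cases j H) as [-> | [-> | ->]]; cbv; repeat split; congruence. Qed.

Lemma run_scan_entry w s M j r x i v :
  32 * M + 64 < 2 ^ w -> 0 <= j < 3 -> 0 <= x <= r -> 2 * r <= M -> 0 <= i < M ->
  regs s 2 = x -> regs s 3 = r -> regs s 9 = i -> 0 <= arr s 10 i <= r ->
  wrap w (regs s 8) = wrap w v ->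
  run w (scan_entry j) s 120 (fun s' =>
    (forall q, (q < 8)%nat -> regs s' q = regs s q) /\ mem s' = mem s /\ regs s' 9 = i + 1 /\
    wrap w (regs s' 8) = wrap w (v + entry_sum s j (r - x) i)).
Proof.
  intros HM Hj Hx HrM Hi H2 H3 H9 Hy H8.
  destruct (nxt_prv j Hj) as (Hn & Hp & Hnp & _ & _).
  unfold scan_entry.
  apply run_seq with (n1 := 8) (n2 := 110); [|lia].
  apply run_assign with (v := arr s 10 i); [apply eval_cell; auto; lia | costs; lia |].
  set (y := arr s 10 i) in *; set (s1 := set_reg 10 y s).
  apply run_seq with (n1 := 8) (n2 := 100); [|lia].
  apply run_assign with (v := arr s 9 i); [rewrite (eval_cell w _ 9 _ i) by (auto; lia); reflexivity | costs; lia |].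
  set (p := arr s 9 i) in *; set (s2 := set_reg 11 p s1).
  apply run_seq with (n1 := 11) (n2 := 88); [|lia].
  eapply run_assign; [reflexivity | costs; lia |].
  set (d := eval _ _ _).
  assert (Hd : wrap w d = wrap w (1 - 2 * arr s 18 i)).
  { apply eval_sub; [cbn [eval]; apply wrap_wrap|]; apply eval_mul; [cbn [eval]; apply wrap_wrap|].
    rewrite (eval_cell w _ 18 _ i) by (auto; lia); reflexivity. }
  clearbody d; set (s3 := set_reg 12 d s2).
  apply run_seq with (n1 := 80) (n2 := 4); [|lia].
  assert (F : forall s4, (forall q, q <> 8%nat -> q <> 13%nat -> regs s4 q = regs s3 q) -> mem s4 = mem s ->
     wrap w (regs s4 8) = wrap w (v + entry_sum s j (r - x) i) ->
     run w (Assign 9 ($9 + #1)%e) s4 4 (fun s' =>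
    (forall q, (q < 8)%nat -> regs s' q = regs s q) /\ mem s' = mem s /\ regs s' 9 = i + 1 /\
    wrap w (regs s' 8) = wrap w (v + entry_sum s j (r - x) i))).
  { intros s4 R4 M4 V4; assert (G9 : regs s4 9 = i) by (rewrite R4 by discriminate; exact H9).
    apply run_assign with (v := i + 1); [ev | cbv; congruence |].
    split; [|split; [|split]]; [| exact M4 | reflexivity | exact V4].
    intros q Hq; cbn [regs set_reg]; destruct (Nat.eqb_spec q 9); [lia|].
    rewrite R4 by lia; cbn [s3 s2 s1 regs set_reg].
    destruct (Nat.eqb_spec q 12); [lia|]; destruct (Nat.eqb_spec q 11); [lia|]; destruct (Nat.eqb_spec q 10); [lia|]; auto. }
  assert (ES : entry_sum s j (r - x) i =
    if y <=? r - x then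
      if p =? nxt j then (1 - 2 * arr s 18 i) * arr s (prv j) (r - x - y) else
      if p =? prv j then (1 - 2 * arr s 18 i) * arr s (3 + nxt j) (r - x - y) else 0
    else 0).
  { unfold entry_sum, log_conv; fold y p.
    destruct (Z.eqb_spec p (nxt j)), (Z.eqb_spec p (prv j)), (Z.leb_spec y (r - x)); cbn [andb]; lia. }
  destruct (eval_test w s3 ($3 <? $2 + $10)%e (r <? x + y)) as (T1 & T2).
  { apply eval_lt; [lia | exact H3 |].
    apply eval_eq; cbn [safe ueval uop regs set_reg s3 s2 s1 Nat.eqb]; rewrite H2; [repeat split; lia | reflexivity]. }
  apply run_if with (m := 70); [intros E; apply T1 in E | intros E; apply T2 in E | costs; lia].
  - apply Z.ltb_lt in E; rewrite (proj2 (Z.leb_gt y (r - x))) in ES by lia.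
    apply run_straight; [reflexivity | cbn; lia |].
    apply F; auto; cbn [sexec]; rewrite ES, Z.add_0_r; exact H8.
  - apply Z.ltb_ge in E; rewrite (proj2 (Z.leb_le y (r - x))) in ES by lia.
    apply run_seq with (n1 := 6) (n2 := 60); [|lia].
    apply run_assign with (v := r - x - y); [| costs; lia |].
    { apply eval_eq; cbn [safe ueval uop regs set_reg s3 s2 s1 Nat.eqb]; rewrite H2, H3; [repeat split; lia | reflexivity]. }
    set (s4 := set_reg 13 (r - x - y) s3).
    assert (C : forall tag, 0 <= tag < 32 -> eval w s4 (cell tag ($13)) = arr s tag (r - x - y)).
    { intros tag Ht; apply (eval_cell w s4 tag ($13) (r - x - y)); auto; lia. }
    destruct (eval_test w s4 ($11 =? #(nxt j))%e (p =? nxt j)) as (P1 & P2).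
    { apply eval_eqb; [lia | reflexivity | apply wrap_small; lia]. }
    assert (V : forall tag, 0 <= tag < 32 -> wrap w (eval w s4 ($8 + $12 * cell tag ($13))%e) =
       wrap w (v + (1 - 2 * arr s 18 i) * arr s tag (r - x - y))).
    { intros tag Ht; apply eval_add; [exact H8|]; apply eval_mul; [exact Hd|]; rewrite C; auto. }
    assert (R : forall a q, q <> 8%nat -> q <> 13%nat -> regs (set_reg 8 a s4) q = regs s3 q).
    { intros a q Q1 Q2; cbn [regs set_reg s4]; destruct (Nat.eqb_spec q 8); [congruence|]; destruct (Nat.eqb_spec q 13); congruence. }
    apply run_if with (m := 50); [intros E1; apply P1 in E1 | intros E1; apply P2 in E1 | costs; lia].
    + eapply run_assign; [reflexivity | costs; lia |].
      apply F; auto; rewrite ES, E1; apply V; lia.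
    + destruct (eval_test w s4 ($11 =? #(prv j))%e (p =? prv j)) as (P3 & P4).
      { apply eval_eqb; [lia | reflexivity | apply wrap_small; lia]. }
      apply run_if with (m := 40); [intros E2; apply P3 in E2 | intros E2; apply P4 in E2 | costs; lia].
      * eapply run_assign; [reflexivity | costs; lia |].
        apply F; auto; rewrite ES, E1, E2; apply V; lia.
      * apply run_straight; [reflexivity | cbn; lia |].
        apply F; auto; cbn [sexec].
        -- intros q Q1 Q2; cbn [regs set_reg s4]; destruct (Nat.eqb_spec q 13); congruence.
        -- rewrite ES, E1, E2, Z.add_0_r; exact H8.
Qed.

(** [conv_log] is applied twice, with a commutation in between: first [nxt j] goes back to its
    snapshot against the current [prv j], then [prv j] against the snapshot of [nxt j]. *)
Lemma entry_sums w r s j c : data_ok w r s -> 0 <= j < 3 -> 0 <= c <= r ->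
  conv (arr s (nxt j)) (arr s (prv j)) c =
  arr s (6 + j) c + sumZ (Z.to_nat (regs s 6)) (entry_sum s j c).
Proof.
  intros (H3 & H6 & Hc & Hl & Ho & Hv & HT) Hj Hr.
  destruct (nxt_prv j Hj) as (Hn & Hp & _).
  assert (Hl' : forall i, 0 <= i < Z.of_nat (Z.to_nat (regs s 6)) -> 0 <= arr s 10 i).
  { intros i Hi; apply Hl; lia. }
  rewrite (conv_log (arr s 9) (arr s 10) (arr s 18) (nxt j) (arr s (3 + nxt j)) _ _ _ (Z.to_nat (regs s 6)));
    [| auto | intros; apply Ho; auto].
  rewrite Negacyclic.conv_comm.
  rewrite (conv_log (arr s 9) (arr s 10) (arr s 18) (prv j) (arr s (3 + prv j)) _ _ _ (Z.to_nat (regs s 6)));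
    [| auto | intros; apply Ho; auto].
  rewrite Negacyclic.conv_comm, Hv by auto.
  unfold entry_sum; rewrite sumZ_add; lia.
Qed.

Lemma run_update_part w s M j r x b :
  32 * M + 64 < 2 ^ w -> 0 <= j < 3 -> 0 <= x <= r -> 2 * r <= M -> regs s 6 < M ->
  data_ok w r s -> regs s 0 = b -> 0 <= b <= 1 -> regs s 2 = x -> arr s j x = b ->
  run w (update_part j) s (200 + 130 * regs s 6) (fun s' =>
    data_ok w r s' /\ regs s' 4 = regs s 4 /\ regs s' 5 = regs s 5 /\ regs s' 6 = regs s 6 + 1 /\
    (forall p t, 0 <= p < 3 -> arr s' p t = if andb (p =? j) (t =? x) then 1 - b else arr s p t)).
Proof.
  intros HM Hj Hx HrM HcM HD H0 Hb H2 Hjx; pose proof HD as (H3 & H6 & Hc & Hl & Ho & Hv & HT).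
  destruct (nxt_prv j Hj) as (Hn & Hp & Hnp & Hnj & Hpj).
  assert (HW : 1 < 2 ^ w) by lia.
  set (c := regs s 6) in *.
  unfold update_part.
  apply run_seq with (n1 := 10) (n2 := 189 + 130 * c); [|lia].
  apply run_assign with (v := arr s (6 + j) (r - x)); [| costs; lia |].
  { rewrite (eval_cell w s (6 + j) _ (r - x)); [reflexivity | ev | lia | lia | lia]. }
  apply run_seq with (n1 := 2) (n2 := 186 + 130 * c); [|lia].
  apply run_assign with (v := 0); [apply wrap_small; lia | cbv; congruence |].
  set (s1 := set_reg 9 0 _).
  apply run_seq with (n1 := c * (120 + 1 + 3) + 1 + 3) (n2 := 170); [|lia].
  pose (I := fun i s' => (forall q, (q < 8)%nat -> regs s' q = regs s q) /\ mem s' = mem s /\ regs s' 9 = i /\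
    wrap w (regs s' 8) = wrap w (arr s (6 + j) (r - x) + sumZ (Z.to_nat i) (entry_sum s j (r - x)))).
  eapply run_weaken; [apply run_while with (I := I) (N := c) (k := 120) | apply Z.le_refl |]; try (costs; lia).
  { unfold I; split; [|split; [|split]]; try reflexivity.
    - intros q Hq; cbn [s1 regs set_reg]; destruct (Nat.eqb_spec q 9); [lia|]; destruct (Nat.eqb_spec q 8); [lia | auto].
    - cbn [sumZ Z.to_nat]; rewrite Z.add_0_r; reflexivity. }
  { intros i s2 Hi (R2 & M2 & G9 & G8); split.
    - rewrite (eval_lt w s2 ($9)%e ($6)%e i c); [rewrite (proj2 (Z.ltb_lt i c)) by lia; lia | lia | auto | cbn [eval]; rewrite R2 by lia; reflexivity].
    - assert (A2 := arr_mem s s2 M2).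
      eapply run_weaken; [eapply run_scan_entry with (M := M) (r := r) (x := x) (i := i); eauto; try lia; try (rewrite R2 by lia; auto) | lia |].
      { rewrite A2; apply Hl; lia. }
      intros s3 (R3 & M3 & G39 & G38); unfold I; split; [|split; [|split]]; auto.
      + intros q Hq; rewrite R3, R2 by lia; auto.
      + rewrite M3; auto.
      + rewrite G38, sumZ_succ, Z.add_assoc by lia; f_equal; f_equal.
        unfold entry_sum, log_conv; rewrite !A2; reflexivity. }
  { intros s2 (R2 & M2 & G9 & G8).
    rewrite (eval_lt w s2 ($9)%e ($6)%e c c); [rewrite Z.ltb_irrefl; lia | lia | auto | cbn [eval]; rewrite R2 by lia; reflexivity]. }
  intros s2 (R2 & M2 & G9 & G8).
  unfold c in G8; rewrite <- (entry_sums w r s j (r - x) HD Hj) in G8 by lia; fold c in G8.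
  set (T := triples r (arr s 0) (arr s 1) (arr s 2)) in *.
  set (F := conv _ _ _) in *.
  apply run_seq with (n1 := 10) (n2 := 150); [|lia].
  (* With the sign written as 1 - 2b, insertion and deletion share the rest of the argument. *)
  assert (Next : forall s3, (forall q, (q < 8)%nat -> q <> 7%nat -> regs s3 q = regs s q) -> mem s3 = mem s ->
     regs s3 7 = wrap w (T + (1 - 2 * b) * F) ->
     run w (Seq (Store (addr j ($2)) (#1 - $0)%e)
  (Seq (Store (addr 9 ($6)) (#j)%e)
  (Seq (Store (addr 10 ($6)) ($2)%e)
  (Seq (Store (addr 18 ($6)) ($0)%e)
  (Assign 6 ($6 + #1)%e))))) s3 150 (fun s' =>
    data_ok w r s' /\ regs s' 4 = regs s 4 /\ regs s' 5 = regs s 5 /\ regs s' 6 = c + 1 /\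
    (forall p t, 0 <= p < 3 -> arr s' p t = if andb (p =? j) (t =? x) then 1 - b else arr s p t))).
  { intros s3 R3 M3 G7; assert (A3 := arr_mem s s3 M3).
    assert (G0 : regs s3 0 = b) by (rewrite R3 by (lia || discriminate); auto).
    assert (G2 : regs s3 2 = x) by (rewrite R3 by (lia || discriminate); auto).
    assert (G6 : regs s3 6 = c) by (rewrite R3 by (lia || discriminate); auto).
    apply run_seq with (n1 := 10) (n2 := 130); [|lia].
    apply run_store with (i := x) (v := 1 - b); [auto | lia | lia | lia | ev | costs; lia |].
    apply run_seq with (n1 := 10) (n2 := 110); [|lia].
    apply run_store with (i := c) (v := j); [auto | lia | lia | lia | apply wrap_small; lia | costs; lia |].
    apply run_seq with (n1 := 10) (n2 := 90); [|lia].
    apply run_store with (i := c) (v := x); [auto | lia | lia | lia | auto | costs; lia |].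
    apply run_seq with (n1 := 10) (n2 := 70); [|lia].
    apply run_store with (i := c) (v := b); [auto | lia | lia | lia | auto | costs; lia |].
    apply run_assign with (v := c + 1); [ev | costs; lia |].
    set (s4 := set_reg 6 _ _).
    assert (A4 : forall tag i, 0 <= tag < 32 -> arr s4 tag i =
      if andb (tag =? 18) (i =? c) then b else if andb (tag =? 10) (i =? c) then x else
      if andb (tag =? 9) (i =? c) then j else if andb (tag =? j) (i =? x) then 1 - b else arr s tag i).
    { intros tag i Ht; unfold s4; rewrite arr_set_reg.
      rewrite (arr_set_mem _ _ _ _ _ 18 c), (arr_set_mem _ _ _ _ _ 10 c), (arr_set_mem _ _ _ _ _ 9 c),
        (arr_set_mem _ _ _ _ _ j x), A3 by (auto; lia); reflexivity. }
    assert (R4 : forall q, (q < 8)%nat -> q <> 7%nat -> q <> 6%nat -> regs s4 q = regs s q).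
    { intros q Q1 Q2 Q3; cbn [s4 regs set_reg set_mem]; destruct (Nat.eqb_spec q 6); [lia | auto]. }
    assert (G46 : regs s4 6 = c + 1) by reflexivity.
    assert (G47 : regs s4 7 = wrap w (T + (1 - 2 * b) * F)) by exact G7.
    clearbody s4; clear G7 G0 G2 G6 R3 M3 A3 s3.
    assert (Cur : forall p t, 0 <= p < 3 -> arr s4 p t = if andb (p =? j) (t =? x) then 1 - b else arr s p t).
    { intros p t Hp'; rewrite A4 by lia.
      rewrite (proj2 (Z.eqb_neq p 18)), (proj2 (Z.eqb_neq p 10)), (proj2 (Z.eqb_neq p 9)) by lia; reflexivity. }
    assert (Oth : forall p t, 3 <= p < 9 -> arr s4 p t = arr s p t).
    { intros p t Hp'; rewrite A4 by lia.
      rewrite (proj2 (Z.eqb_neq p 18)), (proj2 (Z.eqb_neq p 10)), (proj2 (Z.eqb_neq p 9)), (proj2 (Z.eqb_neq p j)) by lia; reflexivity. }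
    assert (L9 : forall i, arr s4 9 i = if i =? c then j else arr s 9 i).
    { intros i; rewrite A4, (proj2 (Z.eqb_neq 9 j)) by lia; cbn; reflexivity. }
    assert (L10 : forall i, arr s4 10 i = if i =? c then x else arr s 10 i).
    { intros i; rewrite A4, (proj2 (Z.eqb_neq 10 j)) by lia; cbn; reflexivity. }
    assert (L18 : forall i, arr s4 18 i = if i =? c then b else arr s 18 i).
    { intros i; rewrite A4, (proj2 (Z.eqb_neq 18 j)) by lia; cbn; reflexivity. }
    assert (Delta : forall t, 0 <= t -> arr s4 j t = arr s j t + (if t =? x then 1 - 2 * b else 0)).
    { intros t Ht; rewrite Cur, Z.eqb_refl by lia; cbn [andb]; destruct (Z.eqb_spec t x) as [->|]; lia. }
    split; [|split; [|split; [|split]]]; auto; try (apply R4; lia).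
    unfold data_ok; rewrite G46; split; [rewrite R4 by lia; auto|]; split; [lia|].
    split.
    { intros p Hp'; destruct (Hc p Hp') as (C1 & C2); split; intros t Ht; rewrite Cur by lia;
        destruct (Z.eqb_spec p j), (Z.eqb_spec t x); cbn [andb]; auto; lia. }
    split.
    { intros i Hi; rewrite L10; destruct (Z.eqb_spec i c); [lia | apply Hl; lia]. }
    split.
    { intros p t Hp' Ht; rewrite sumZ_succ, (Oth (3 + p)) by lia.
      rewrite (sumZ_ext _ (log_delta (arr s4 9) (arr s4 10) (arr s4 18) p t) (log_delta (arr s 9) (arr s 10) (arr s 18) p t)).
      2: { intros i Hi; unfold log_delta; rewrite L9, L10, L18, (proj2 (Z.eqb_neq i c)) by lia; reflexivity. }
      rewrite Z.add_assoc; fold c in Ho; rewrite <- Ho by auto.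
      unfold log_delta; rewrite L9, L10, L18, Z.eqb_refl.
      destruct (Z.eqb_spec j p) as [->|Hne].
      - rewrite Delta by auto; cbn [andb]; rewrite (Z.eqb_sym x); reflexivity.
      - rewrite Cur by auto; rewrite (proj2 (Z.eqb_neq p j)) by lia; cbn [andb]; lia. }
    split.
    { intros q z Hq Hz; destruct (nxt_prv q Hq) as (Hn' & Hp' & _).
      rewrite Oth by lia; rewrite Hv by auto; apply conv_ext; intros; rewrite Oth by lia; auto. }
    rewrite G47; f_equal; unfold T.
    (* The part being updated is rotated to the front, so that only the first factor changes. *)
    rewrite (triples_parts r (arr s4) j), (triples_parts r (arr s) j) by lia.
    rewrite (triples_update r (arr s j) (arr s4 j) _ _ x (1 - 2 * b)) by (auto; lia).
    f_equal; [|f_equal].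
    - apply triples_ext; intros; auto; rewrite Cur by lia;
        [rewrite (proj2 (Z.eqb_neq (nxt j) j)) by lia | rewrite (proj2 (Z.eqb_neq (prv j) j)) by lia]; reflexivity.
    - unfold F; apply conv_ext; intros; rewrite Cur by lia;
        [rewrite (proj2 (Z.eqb_neq (nxt j) j)) by lia | rewrite (proj2 (Z.eqb_neq (prv j) j)) by lia]; reflexivity. }
  assert (G7 : regs s2 7 = wrap w T) by (rewrite R2 by lia; auto).
  apply run_if with (m := 5); [intros E | intros E | costs; lia]; cbn [eval] in E; rewrite R2 in E by lia.
  - eapply run_assign; [reflexivity | costs; lia |]; apply Next.
    + intros q Q1 Q2; cbn [regs set_reg]; destruct (Nat.eqb_spec q 7); [congruence | auto].
    + exact M2.
    + cbn [regs set_reg Nat.eqb eval]; unfold eval_binop.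
      replace (T + (1 - 2 * b) * F) with (T - F) by (replace b with 1 by lia; ring).
      apply wrap_sub; [rewrite G7; apply wrap_wrap | auto].
  - eapply run_assign; [reflexivity | costs; lia |]; apply Next.
    + intros q Q1 Q2; cbn [regs set_reg]; destruct (Nat.eqb_spec q 7); [congruence | auto].
    + exact M2.
    + cbn [regs set_reg Nat.eqb eval]; unfold eval_binop.
      replace (T + (1 - 2 * b) * F) with (T + F) by (replace b with 0 by lia; ring).
      apply wrap_add; [rewrite G7; apply wrap_wrap | auto].
Qed.

(** * Handling an operation *)

(* Register 5 grows by one per operation until it reaches the rounded-up logarithm of
   rmax: computing the logarithm at once would cost too much when there are few
   operations.  Register 4 is 2 to this power. *)
Definition tick : cmd :=
  If ($4 <? $3)%e (Seq (Assign 4 (#2 * $4)) (Assign 5 ($5 + #1))) Skip.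

Definition dispatch : cmd :=
  If ($0 =? #2)%e Skip
    (If ($1 =? #0)%e (update_part 0)
    (If ($1 =? #1)%e (update_part 1)
    (Seq (Assign 2 ($3 - $2)) (update_part 2)))).

(** Comparing squares avoids computing sqrt(rmax) log(rmax). Until register 4 reaches rmax the
    logarithm in register 5 is not final, and no rebuilding takes place. *)
Definition rebuild_if_due : cmd :=
  If ($4 <? $3)%e Skip (If ($6 * $6 <? $3 * $5 * $5)%e Skip rebuild).

Definition answer : cmd := Assign 0 (#1 - ($7 =? #0))%e.

Definition three_sum : algorithm :=
  Algorithm (Seq (Assign 3 ($0)) (Assign 4 (#1)))
            (Seq (Seq tick dispatch) (Seq rebuild_if_due answer)).

Definition position (r : Z) (p : part) (x : Z) : Z :=
  match p with PC => r - x | _ => x end.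

(** The alternative in the fourth clause covers the initial phase: while register 5 still grows it
    gains one per operation, and the log at most one entry, so the log is no longer than register 5
    and far from due for rebuilding. *)
Definition between_ops (w r : Z) (S : sets) (s : state) : Prop :=
  data_ok w r s /\ 0 <= regs s 5 <= Z.log2_up r /\ regs s 4 = 2 ^ regs s 5 /\
  (regs s 6 <= regs s 5 \/ r <= regs s 4) /\
  (forall p x, In Z (S p) x <-> 0 <= x <= r /\ arr s (part_code p) (position r p x) = 1).

(** With P = 2^ceil(log2 r), the largest quantities are of order P^4, such as the square of the log
    length, which is at most P^2. *)
Definition big_enough (w r : Z) : Prop :=
  2 ^ 14 * (2 ^ Z.log2_up r) ^ 4 < 2 ^ w.

Lemma size_bounds r : 2 <= r ->
  1 <= Z.log2_up r /\ Z.log2_up r < 2 ^ Z.log2_up r /\ r <= 2 ^ Z.log2_up r < 2 * r.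
Proof.
  intros Hr; pose proof (Z.log2_up_spec r ltac:(lia)) as [H1 H2].
  pose proof (Z.log2_up_pos r ltac:(lia)) as H3.
  assert (2 ^ Z.log2_up r = 2 * 2 ^ Z.pred (Z.log2_up r)).
  { rewrite <- Z.pow_succ_r by lia; f_equal; lia. }
  split; [lia|]; split; [apply kl_le_pow; lia | lia].
Qed.

Lemma part_code_range p : 0 <= part_code p < 3.
Proof. destruct p; cbn; lia. Qed.

Lemma position_inj r p x y : position r p x = position r p y -> x = y.
Proof. destruct p; cbn; lia. Qed.

Lemma position_range r p x : 0 <= x <= r -> 0 <= position r p x <= r.
Proof. destruct p; cbn; lia. Qed.

Lemma part_code_inj p q : part_code p = part_code q -> p = q.
Proof. destruct p, q; cbn; congruence. Qed.

Definition op_word (op : operation) : Z :=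
  match op with Insert _ _ => 0 | Delete _ _ => 1 | Query => 2 end.
Definition op_part (op : operation) : Z :=
  match op with Insert p _ | Delete p _ => part_code p | Query => 0 end.
Definition op_value (op : operation) : Z :=
  match op with Insert _ x | Delete _ x => x | Query => 0 end.

Lemma feed_regs w op s : 2 < 2 ^ w -> 0 <= op_value op < 2 ^ w ->
  regs (feed w op s) 0 = op_word op /\ regs (feed w op s) 1 = op_part op /\
  regs (feed w op s) 2 = op_value op /\ mem (feed w op s) = mem s /\
  (forall q, (2 < q)%nat -> regs (feed w op s) q = regs s q).
Proof.
  intros HW Hv.
  assert (0 <= op_part op < 3) by (destruct op; cbn; try apply part_code_range; lia).
  assert (E : feed w op s = set_reg 0 (wrap w (op_word op)) (set_reg 1 (wrap w (op_part op)) (set_reg 2 (wrap w (op_value op)) s))).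
  { destruct op; reflexivity. }
  rewrite E, !wrap_small by (destruct op; cbn in *; lia).
  repeat split; intros q Hq; cbn [regs set_reg].
  destruct (Nat.eqb_spec q 0); [lia|]; destruct (Nat.eqb_spec q 1); [lia|]; destruct (Nat.eqb_spec q 2); [lia|auto].
Qed.

Lemma data_ok_transfer w r s s' :
  data_ok w r s -> mem s' = mem s -> regs s' 3 = regs s 3 -> regs s' 6 = regs s 6 -> regs s' 7 = regs s 7 ->
  data_ok w r s'.
Proof.
  intros HD Hm H3 H6 H7; unfold data_ok, arr in *; rewrite Hm, H3, H6, H7; exact HD.
Qed.

Lemma run_dispatch w r S s op :
  big_enough w r -> 2 <= r -> admissible r S op ->
  data_ok w r s -> regs s 6 < 2 ^ Z.log2_up r * 2 ^ Z.log2_up r ->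
  (forall p x, In Z (S p) x <-> 0 <= x <= r /\ arr s (part_code p) (position r p x) = 1) ->
  regs s 0 = op_word op -> regs s 1 = op_part op -> regs s 2 = op_value op ->
  run w dispatch s (230 + 130 * regs s 6) (fun s' =>
    data_ok w r s' /\ regs s' 4 = regs s 4 /\ regs s' 5 = regs s 5 /\ regs s' 6 <= regs s 6 + 1 /\
    (forall p x, In Z (apply_op S op p) x <-> 0 <= x <= r /\ arr s' (part_code p) (position r p x) = 1)).
Proof.
  intros HB Hr HA HD H6 HM H0 H1 H2.
  destruct (size_bounds r Hr) as (B1 & B2 & B3).
  unfold big_enough in HB; set (P := 2 ^ Z.log2_up r) in *.
  assert (HP : 2 <= P) by lia.
  pose proof HD as (H3 & H60 & Hc & _).
  (* This bound has to cover positions in the log, whose length is known only to be below P^2. *)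
  set (M := 256 * P * P).
  assert (HW : 32 * M + 64 < 2 ^ w).
  { unfold M; replace (P ^ 4) with (P * P * P * P) in HB by ring. change (2 ^ 14) with 16384 in HB.
    assert (4 <= P * P) by nia. nia. }
  assert (HMr : 4 * r <= M) by (unfold M; nia).
  assert (HcM : regs s 6 < M) by (unfold M; lia).
  (* The state [s1] may differ from [s] in register 2, because for the third set the number is
     reflected first. *)
  assert (Upd : forall p x b s1, 0 <= x <= r -> 0 <= b <= 1 ->
     mem s1 = mem s -> (forall q, (q < 8)%nat -> q <> 2%nat -> regs s1 q = regs s q) ->
     regs s 0 = b -> regs s1 2 = position r p x ->
     (In Z (S p) x <-> b = 1) ->
     (forall q y, In Z (apply_op S op q) y <-> if part_eq_dec q p then (y = x /\ b = 0) \/ (y <> x /\ In Z (S q) y) else In Z (S q) y) ->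
     run w (update_part (part_code p)) s1 (200 + 130 * regs s 6) (fun s' =>
    data_ok w r s' /\ regs s' 4 = regs s 4 /\ regs s' 5 = regs s 5 /\ regs s' 6 <= regs s 6 + 1 /\
    (forall p x, In Z (apply_op S op p) x <-> 0 <= x <= r /\ arr s' (part_code p) (position r p x) = 1))).
  { intros p x b s1 Hx Hb Hm HR Hk Hp Hin Hop.
    assert (Ex : arr s (part_code p) (position r p x) = b).
    { pose proof (proj1 (Hc (part_code p) (part_code_range p)) (position r p x) ltac:(apply position_range; auto)).
      destruct (HM p x) as (I1 & I2); destruct (Z.eq_dec b 1) as [->|Hb1].
      - apply I1, Hin; auto.
      - assert (arr s (part_code p) (position r p x) <> 1); [|lia].
        intros E; apply Hb1, Hin, I2; auto. }
    rewrite <- (HR 6%nat) by lia.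
    eapply run_weaken; [apply run_update_part with (M := M) (r := r) (x := position r p x) (b := b) | apply Z.le_refl |];
      try lia; auto.
    - apply part_code_range.
    - apply position_range; auto.
    - rewrite HR by lia; lia.
    - eapply data_ok_transfer; eauto; apply HR; lia.
    - rewrite HR by lia; auto.
    - rewrite (arr_mem s s1) by auto; auto.
    - intros s' (D & R4 & R5 & R6 & A).
      split; [auto|]; split; [rewrite R4; apply HR; lia|]; split; [rewrite R5; apply HR; lia|].
      split; [rewrite R6, HR by lia; lia|].
      intros q y; rewrite Hop, A, (arr_mem s s1) by (auto; apply part_code_range).
      destruct (part_eq_dec q p) as [->|Hqp].
      + rewrite Z.eqb_refl; cbn [andb].
        destruct (Z.eqb_spec (position r p y) (position r p x)) as [E|E].
        * apply position_inj in E; subst y; split.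
          -- intros [(_ & ->)|(F & _)]; [lia | congruence].
          -- intros (_ & F); left; split; [auto | lia].
        * assert (y <> x) by congruence; rewrite HM; tauto.
      + rewrite (proj2 (Z.eqb_neq (part_code q) (part_code p))) by (intros E; apply Hqp, part_code_inj; auto).
        cbn [andb]; apply HM. }
  assert (HW2 : 2 < 2 ^ w) by lia.
  destruct (eval_test w s ($0 =? #2)%e (op_word op =? 2)) as (T1 & T2).
  { apply eval_eqb; [lia | auto | apply wrap_small; lia]. }
  assert (Main : forall p x b, op_word op = b -> op_part op = part_code p -> op_value op = x ->
     0 <= x <= r -> 0 <= b <= 1 -> (In Z (S p) x <-> b = 1) ->
     (forall q y, In Z (apply_op S op q) y <-> if part_eq_dec q p then (y = x /\ b = 0) \/ (y <> x /\ In Z (S q) y) else In Z (S q) y) ->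
     run w (If ($1 =? #0)%e (update_part 0)
    (If ($1 =? #1)%e (update_part 1)
    (Seq (Assign 2 ($3 - $2)%e) (update_part 2)))) s (225 + 130 * regs s 6) (fun s' =>
    data_ok w r s' /\ regs s' 4 = regs s 4 /\ regs s' 5 = regs s 5 /\ regs s' 6 <= regs s 6 + 1 /\
    (forall p x, In Z (apply_op S op p) x <-> 0 <= x <= r /\ arr s' (part_code p) (position r p x) = 1))).
  { intros p x b E0 E1 E2 Hx Hb Hin Hop.
    destruct (eval_test w s ($1 =? #0)%e (op_part op =? 0)) as (P1 & P2).
    { apply eval_eqb; [lia | auto | apply wrap_small; lia]. }
    destruct (eval_test w s ($1 =? #1)%e (op_part op =? 1)) as (P3 & P4).
    { apply eval_eqb; [lia | auto | apply wrap_small; lia]. }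
    rewrite E1 in *.
    apply run_if with (m := 218 + 130 * regs s 6); [intros E; apply P1 in E | intros E; apply P2 in E | costs; lia].
    { destruct p; try discriminate.
      eapply run_weaken; [apply (Upd PA x b s); auto; [rewrite H0; auto | rewrite H2; auto] | lia | auto]. }
    apply run_if with (m := 210 + 130 * regs s 6); [intros F; apply P3 in F | intros F; apply P4 in F | costs; lia].
    { destruct p; try discriminate.
      eapply run_weaken; [apply (Upd PB x b s); auto; [rewrite H0; auto | rewrite H2; auto] | lia | auto]. }
    destruct p; try discriminate.
    apply run_seq with (n1 := 5) (n2 := 200 + 130 * regs s 6); [|lia].
    apply run_assign with (v := r - x); [rewrite E2 in H2; ev | costs; lia |].
    apply (Upd PC x b); auto; [| rewrite H0; auto].
    intros q Q1 Q2; cbn [regs set_reg]; destruct (Nat.eqb_spec q 2); [congruence | auto]. }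
  unfold dispatch; apply run_if with (m := 225 + 130 * regs s 6); [intros E; apply T1 in E | intros E; apply T2 in E | costs; lia].
  { destruct op; try discriminate.
    apply run_straight; [reflexivity | cbn [scost]; lia |]; cbn [sexec apply_op].
    split; [auto|]; split; [auto|]; split; [auto|]; split; [lia | exact HM]. }
  destruct op as [p x|p x|]; [| |discriminate].
  - destruct HA as (Hx & Hn).
    apply (Main p x 0); auto; try lia.
    + split; [intros F; contradiction | lia].
    + intros q y; cbn [apply_op]; unfold update; destruct (part_eq_dec q p) as [->|_]; [|tauto].
      split.
      * intros F; destruct F as [y F | y F].
        -- right; split; [|exact F]. intros ->; contradiction.
        -- left; destruct F; auto.
      * intros [(-> & _)|(_ & F)]; [right; constructor | left; exact F].
  - assert (Hin : In Z (S p) x) by exact HA.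
    apply (Main p x 1); auto; try lia.
    + apply HM in Hin; tauto.
    + tauto.
    + intros q y; cbn [apply_op]; unfold update; destruct (part_eq_dec q p) as [->|_]; [|tauto].
      split.
      * intros (F & G); right; split; [|exact F]. intros ->; apply G; constructor.
      * intros [(_ & F)|(G & F)]; [lia|]. split; [exact F|]. intros E1; destruct E1; congruence.
Qed.

(** Three products of length 8P cost at most 72000 P * 2 (L + 3)^2, where P <= 2 r and 2 (L + 3)^2
    <= 32 L^2. This is 4608000 r L^2, and the remainder pays for the linear passes. *)
Definition rebuild_constant : Z := 5000000.

Lemma admissible_value r S s w op : 0 <= r -> between_ops w r S s -> admissible r S op -> 0 <= op_value op <= r.
Proof.
  intros Hr (_ & _ & _ & _ & HM) HA; destruct op as [p x|p x|]; cbn in *; [tauto | apply HM in HA; tauto | lia].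
Qed.

(** The right side is at most m^3, whereas c >= m^2 would give c^2 >= m^4. This bounds the length of
    the log by the square of 2^ceil(log2 r). *)
Lemma square_below_cube c r l m :
  0 <= r <= m -> 0 <= l <= m -> c * c < r * (l * l) -> c < m * m.
Proof.
  intros Hr Hl H.
  assert (l * l <= m * m) by (apply Z.mul_le_mono_nonneg; lia).
  assert (r * (l * l) <= m * (m * m)) by (apply Z.mul_le_mono_nonneg; nia).
  destruct (Z_lt_le_dec c (m * m)) as [|Hc]; [auto|].
  assert ((m * m) * (m * m) <= c * c) by (apply Z.mul_le_mono_nonneg; nia).
  nia.
Qed.

Lemma run_front w r S s op :
  big_enough w r -> 2 <= r -> admissible r S op -> between_ops w r S s ->
  regs s 6 * regs s 6 < r * (Z.log2_up r * Z.log2_up r) ->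
  run w (Seq tick dispatch) (feed w op s) (260 + 130 * regs s 6) (fun s' =>
    between_ops w r (apply_op S op) s' /\ regs s' 6 <= regs s 6 + 1).
Proof.
  intros HB Hr HA HI Hc.
  pose proof (admissible_value r S s w op ltac:(lia) HI HA) as Hv.
  destruct (size_bounds r Hr) as (B1 & B2 & B3).
  pose proof HB as HB'; unfold big_enough in HB'; set (P := 2 ^ Z.log2_up r) in *.
  assert (HW : 16 * P < 2 ^ w).
  { replace (P ^ 4) with (P * P * P * P) in HB' by ring. change (2 ^ 14) with 16384 in HB'.
    assert (P * 1 <= P * (P * P * P)) by (apply Z.mul_le_mono_nonneg_l; nia). lia. }
  destruct HI as (HD & HL & HP & HcL & HM); pose proof HD as (H3 & H6 & _).
  destruct (feed_regs w op s) as (F0 & F1 & F2 & FM & FR); [lia | lia |].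
  set (s0 := feed w op s) in *; clearbody s0.
  assert (H6P : regs s 6 < P * P).
  { apply (square_below_cube _ r (Z.log2_up r)); auto; lia. }
  assert (Hpow : 0 < 2 ^ regs s 5 <= P).
  { split; [apply Z.pow_pos_nonneg; lia | apply Z.pow_le_mono_r; lia]. }
  apply run_seq with (n1 := 25) (n2 := 232 + 130 * regs s 6); [|lia].
  assert (Go : forall s1, (forall q, q <> 4%nat -> q <> 5%nat -> regs s1 q = regs s0 q) -> mem s1 = mem s ->
    0 <= regs s1 5 <= Z.log2_up r -> regs s1 4 = 2 ^ regs s1 5 ->
    (regs s 6 + 1 <= regs s1 5 \/ r <= regs s1 4) ->
    run w dispatch s1 (232 + 130 * regs s 6) (fun s' =>
      between_ops w r (apply_op S op) s' /\ regs s' 6 <= regs s 6 + 1)).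
  { intros s1 R1 M1 L1 P1 C1.
    assert (G6 : regs s1 6 = regs s 6) by (rewrite R1, FR by (lia || discriminate); auto).
    rewrite <- G6.
    eapply run_weaken; [apply run_dispatch with (r := r) (S := S) (op := op) | lia |]; auto.
    - eapply data_ok_transfer; eauto; rewrite R1, FR by (lia || discriminate); auto.
    - rewrite G6; exact H6P.
    - intros p x; rewrite (arr_mem s s1) by auto; apply HM.
    - rewrite R1 by discriminate; auto.
    - rewrite R1 by discriminate; auto.
    - rewrite R1 by discriminate; auto.
    - intros s' (D & R4 & R5 & R6 & A); rewrite G6 in R6; split; [|lia].
      split; [auto|]; rewrite R4, R5; split; [lia|]; split; [auto|]; split; [lia | auto]. }
  unfold tick; assert (G3 : regs s0 3 = r) by (rewrite FR by lia; auto).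
  assert (G4 : regs s0 4 = 2 ^ regs s 5) by (rewrite FR by lia; auto).
  assert (G5 : regs s0 5 = regs s 5) by (rewrite FR by lia; auto).
  destruct (eval_test w s0 ($4 <? $3)%e (2 ^ regs s 5 <? r)) as (T1 & T2).
  { apply eval_lt; [lia | auto | auto]. }
  apply run_if with (m := 12); [intros E; apply T1 in E; apply Z.ltb_lt in E | intros E; apply T2 in E; apply Z.ltb_ge in E | costs; lia].
  - assert (HLt : regs s 5 < Z.log2_up r).
    { apply (Z.pow_lt_mono_r_iff 2); [lia | lia |]; fold P; lia. }
    apply run_seq with (n1 := 4) (n2 := 4); [|lia].
    apply run_assign with (v := 2 * 2 ^ regs s 5); [ev | costs; lia |].
    apply run_assign with (v := regs s 5 + 1); [ev | costs; lia |].
    apply Go; auto.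
    + intros q Q4 Q5; cbn [regs set_reg]; destruct (Nat.eqb_spec q 5); [congruence|]; destruct (Nat.eqb_spec q 4); congruence.
    + cbn [regs set_reg Nat.eqb]; lia.
    + cbn [regs set_reg Nat.eqb]; rewrite Z.pow_add_r by lia; lia.
    + cbn [regs set_reg Nat.eqb]; destruct HcL; [left; lia | lia].
  - apply run_straight; [reflexivity | cbn; lia |]; cbn [sexec].
    apply Go; auto; rewrite ?G4, ?G5; auto; lia.
Qed.

Lemma answer_correct w r S s s' op :
  big_enough w r -> 2 <= r -> between_ops w r S s ->
  s' = set_reg 0 (eval w s (#1 - ($7 =? #0))%e) s -> op = Query ->
  has_3sum S /\ regs s' 0 = 1 \/ ~ has_3sum S /\ regs s' 0 = 0.
Proof.
  intros HB Hr (HD & _ & _ & _ & HM) -> _.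
  destruct (size_bounds r Hr) as (B1 & B2 & B3).
  unfold big_enough in HB; set (P := 2 ^ Z.log2_up r) in *.
  assert (HW : (r + 1) * (r + 1) < 2 ^ w /\ 2 < 2 ^ w).
  { replace (P ^ 4) with (P * P * (P * P)) in HB by ring. change (2 ^ 14) with 16384 in HB.
    assert (4 <= P * P) by nia. assert (4 * (P * P) <= (P * P) * (P * P)) by nia.
    assert ((r + 1) * (r + 1) <= 4 * (P * P)) by nia. lia. }
  destruct HD as (H3 & H6 & Hc & _ & _ & _ & HT).
  assert (Z01 : forall p, 0 <= p < 3 -> forall t, 0 <= t -> 0 <= arr s p t <= 1) by (intros p Hp; apply Hc; auto).
  pose proof (triples_bounds r (arr s 0) (arr s 1) (arr s 2) ltac:(lia) (Z01 0 ltac:(lia)) (Z01 1 ltac:(lia)) (Z01 2 ltac:(lia))) as TB.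
  pose proof (triples_nonzero r (arr s 0) (arr s 1) (arr s 2) ltac:(lia) (Z01 0 ltac:(lia)) (Z01 1 ltac:(lia)) (Z01 2 ltac:(lia))) as TN.
  set (T := triples _ _ _ _) in *.
  rewrite wrap_small in HT by lia.
  cbn [regs set_reg Nat.eqb].
  assert (HS : has_3sum S <-> T <> 0).
  { rewrite TN; split.
    - intros (a & b & c & Ia & Ib & Ic & E).
      apply HM in Ia, Ib, Ic; cbn [part_code position] in *.
      exists a, b; replace (r - a - b) with (r - c) by lia; repeat split; lia.
    - intros (x & y & Hx & Hy & Hxy & E1 & E2 & E3); exists x, y, (x + y).
      repeat split; [apply (HM PA) | apply (HM PB) | apply (HM PC)]; cbn [part_code position]; (split; [lia|]); auto.
      rewrite <- E3; f_equal; lia. }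
  rewrite (eval_eq w s _ (if T =? 0 then 0 else 1)).
  - destruct (Z.eqb_spec T 0); [right | left]; split; auto; tauto.
  - cbn [safe ueval uop]; rewrite HT; destruct (T =? 0); repeat split; lia.
  - cbn [safe ueval uop]; rewrite HT; destruct (T =? 0); lia.
Qed.

Lemma run_rebuild_if_due w r S s :
  big_enough w r -> 2 <= r -> between_ops w r S s ->
  let D := r * (Z.log2_up r * Z.log2_up r) in
  regs s 6 < 2 ^ Z.log2_up r * 2 ^ Z.log2_up r + 1 ->
  (regs s 6 * regs s 6 < D /\ run w rebuild_if_due s 30 (fun s' => s' = s)) \/
  (D <= regs s 6 * regs s 6 /\ run w rebuild_if_due s (30 + rebuild_constant * D)
     (fun s' => between_ops w r S s' /\ regs s' 6 = 0)).
Proof.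
  intros HB Hr HI D Hc6.
  destruct (size_bounds r Hr) as (B1 & B2 & B3).
  pose proof HI as (HD & HL & HP & HcL & HM).
  pose proof HD as (H3 & H6 & _).
  unfold big_enough in HB; set (P := 2 ^ Z.log2_up r) in *.
  set (Lm := Z.log2_up r) in *.
  assert (HW : 32 * (256 * P) + 64 < 2 ^ w /\ 64 * P * P * (P + 1) < 2 ^ w /\ (P * P) * (P * P) < 2 ^ w /\ P * (P * P) < 2 ^ w /\ (P * P + 1) * (P * P + 1) < 2 ^ w).
  { replace (P ^ 4) with (P * P * (P * P)) in HB by ring. change (2 ^ 14) with 16384 in HB.
    assert (4 <= P * P) by nia. assert (P * 4 <= P * (P * P)) by nia.
    assert (P * (P * P) * 2 <= P * (P * P) * P) by nia. repeat split; nia. }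
  destruct HW as (W1 & W2 & W3 & W4 & W5).
  destruct (eval_test w s ($4 <? $3)%e (regs s 4 <? r)) as (T1 & T2).
  { apply eval_lt; [lia | auto | auto]. }
  unfold rebuild_if_due.
  destruct (Z_lt_le_dec (regs s 4) r) as [Hlt|Hge].
  - left; split.
    (* In the initial phase the log is at most as long as the logarithm, so its square is below D
       even though the program has not compared them. *)
    { assert (regs s 6 <= regs s 5) by lia. unfold D.
      assert (regs s 6 * regs s 6 <= Lm * Lm) by nia. nia. }
    apply run_if with (m := 20); [intros _ | intros E; apply T2 in E; apply Z.ltb_ge in E; lia | costs; lia].
    apply run_straight; [reflexivity | cbn; lia | reflexivity].
  - assert (EL : regs s 5 = Lm).
    { destruct (Z_lt_le_dec (regs s 5) Lm) as [Hlt|]; [|lia].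
      pose proof (Z.log2_up_spec r ltac:(lia)) as [S1 _]; fold Lm in S1.
      assert (2 ^ regs s 5 <= 2 ^ Z.pred Lm) by (apply Z.pow_le_mono_r; lia). lia. }
    assert (E5 : 0 <= r * regs s 5 * regs s 5 < 2 ^ w /\ 0 <= r * regs s 5 < 2 ^ w).
    { rewrite EL. assert (r * Lm <= P * P) by nia. assert (r * Lm * Lm <= P * P * P) by nia. split; split; nia. }
    assert (DE : r * regs s 5 * regs s 5 = D) by (unfold D; rewrite EL; ring).
    assert (E6 : 0 <= regs s 6 * regs s 6 < 2 ^ w) by (split; nia).
    destruct (eval_test w s ($6 * $6 <? $3 * $5 * $5)%e (regs s 6 * regs s 6 <? D)) as (T3 & T4).
    { apply eval_lt; [lia | |].
      - apply eval_eq; cbn [safe ueval uop]; [repeat split; lia | auto].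
      - apply eval_eq; cbn [safe ueval uop]; rewrite H3; [repeat split; lia | auto]. }
    destruct (Z_lt_le_dec (regs s 6 * regs s 6) D) as [Hlt|Hge2].
    + left; split; [auto|].
      apply run_if with (m := 20); [intros E; apply T1 in E; apply Z.ltb_lt in E; lia | intros _ | costs; lia].
      apply run_if with (m := 2); [intros _ | intros E; apply T4 in E; apply Z.ltb_ge in E; lia | costs; lia].
      apply run_straight; [reflexivity | cbn; lia | reflexivity].
    + right; split; [auto|].
      apply run_if with (m := 20 + rebuild_constant * D); [intros E; apply T1 in E; apply Z.ltb_lt in E; lia | intros _ | costs; lia].
      apply run_if with (m := 2 + rebuild_constant * D); [intros E; apply T3 in E; apply Z.ltb_lt in E; lia | intros _ | costs; lia].
      eapply run_weaken; [apply run_rebuild with (r := r) (L := Lm) | |]; auto; fold P; try lia.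
      * rewrite HP, EL; reflexivity.
      * unfold rebuild_constant, task_cost, D.
        replace (0 + (Lm + 3)) with (Lm + 3) by lia; rewrite Z.pow_add_r by lia; fold P; change (2 ^ 3) with 8.
        assert (2 * (Lm + 3) * (Lm + 3) <= 32 * (Lm * Lm)) by nia.
        assert (P * (2 * (Lm + 3) * (Lm + 3)) <= 2 * r * (32 * (Lm * Lm))) by nia.
        assert (1 <= Lm * Lm) by (clear - B1; nia).
        assert (r * 1 <= r * (Lm * Lm)) by (apply Z.mul_le_mono_nonneg_l; lia).
        lia.
      * intros s' (D' & R4 & R5 & R6 & A); split; [|auto].
        split; [auto|]; rewrite R4, R5, R6; split; [lia|]; split; [auto|]; split; [lia|].
        intros p x; rewrite A by apply part_code_range; apply HM.
Qed.

Lemma between_ops_set_reg0 w r S s v : between_ops w r S s -> between_ops w r S (set_reg 0 v s).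
Proof.
  intros (HD & H); split; [|exact H].
  eapply data_ok_transfer; eauto.
Qed.

(** In the case of a rebuilding, D <= (c + 1)^2 is recorded. It is what charges the cost of order D
    to the operations since the previous rebuilding, in both of the bounds that follow. *)
Lemma handle_step w r S s op :
  big_enough w r -> 2 <= r -> admissible r S op -> between_ops w r S s ->
  let D := r * (Z.log2_up r * Z.log2_up r) in let c := regs s 6 in
  c * c < D ->
  exists t s', exec w (handle three_sum) (feed w op s) t s' /\
    between_ops w r (apply_op S op) s' /\ regs s' 6 * regs s' 6 < D /\
    (op = Query -> (has_3sum (apply_op S op) /\ regs s' 0 = 1) \/ (~ has_3sum (apply_op S op) /\ regs s' 0 = 0)) /\
    ((Z.of_nat t <= 310 + 130 * c /\ regs s' 6 <= c + 1) \/
     (Z.of_nat t <= 310 + 130 * c + rebuild_constant * D /\ regs s' 6 = 0 /\ D <= (c + 1) * (c + 1))).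
Proof.
  intros HB Hr HA HI D c Hc.
  destruct (run_front w r S s op HB Hr HA HI Hc) as (t1 & s1 & X1 & C1 & I1 & R1).
  pose proof (size_bounds r Hr) as (B1 & B2 & B3).
  assert (H60 : 0 <= regs s 6) by (destruct HI as ((_ & ? & _) & _); auto).
  assert (H61 : 0 <= regs s1 6) by (destruct I1 as ((_ & ? & _) & _); auto).
  set (P := 2 ^ Z.log2_up r) in *.
  assert (H6P : regs s 6 < P * P).
  { apply (square_below_cube _ r (Z.log2_up r)); auto; lia. }
  assert (HD0 : 0 < D) by (unfold D; nia).
  assert (Fin : forall t2 s2, exec w rebuild_if_due s1 t2 s2 -> between_ops w r (apply_op S op) s2 ->
    exists t s', exec w (handle three_sum) (feed w op s) t s' /\
    Z.of_nat t = Z.of_nat t1 + Z.of_nat t2 + 8 /\ regs s' 6 = regs s2 6 /\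
    between_ops w r (apply_op S op) s' /\
    (op = Query -> (has_3sum (apply_op S op) /\ regs s' 0 = 1) \/ (~ has_3sum (apply_op S op) /\ regs s' 0 = 0))).
  { intros t2 s2 X2 I2; eexists _, _; split.
    - eapply exec_seq; [exact X1 | eapply exec_seq; [exact X2 | apply exec_assign]].
    - split; [cbn [expr_cost]; lia|]; split; [reflexivity|].
      split; [apply between_ops_set_reg0; auto|].
      apply (answer_correct w r (apply_op S op) s2); auto. }
  destruct (run_rebuild_if_due w r (apply_op S op) s1 HB Hr I1) as [(Hlt & t2 & s2 & X2 & C2 & ->) | (Hge & t2 & s2 & X2 & C2 & I2 & Z2)]; [fold P; lia | |].
  - destruct (Fin t2 s1 X2 I1) as (t & s' & X & Ht & E6 & I' & O).
    exists t, s'; split; [auto|]; split; [auto|]; rewrite E6; split; [auto|]; split; [auto|].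
    left; split; [lia | auto].
  - destruct (Fin t2 s2 X2 I2) as (t & s' & X & Ht & E6 & I' & O).
    exists t, s'; split; [auto|]; split; [auto|]; rewrite E6, Z2; split; [lia|]; split; [auto|].
    right; split; [lia|]; split; [auto|].
    fold D in Hge; unfold c; nia.
Qed.

(* [q * q] is about rmax (log rmax)^2: a snapshot lasts about [q] updates. The
   term in [c], the length of the current log, pays for the next rebuilding. *)
Lemma handle_all_bounds w r ops : big_enough w r -> 2 <= r -> forall S s,
  let D := r * (Z.log2_up r * Z.log2_up r) in let q := Z.sqrt D in
  let c := regs s 6 in let n := Z.of_nat (length ops) in
  valid_ops r S ops -> between_ops w r S s -> c * c < D ->
  exists t outs, handle_all w (handle three_sum) s ops t outs /\ correct_outputs S ops outs /\
    Z.of_nat t <= n * ((440 + 2 * rebuild_constant) * q) + 2 * rebuild_constant * (c * q) /\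
    Z.of_nat t <= n * (310 + 130 * (n + c)) + rebuild_constant * ((n + c) * (n + c)).
Proof.
  intros HB Hr; induction ops as [|op ops IH]; intros S s D q c n HV HI Hc.
  - assert (0 <= c) by (destruct HI as ((_ & ? & _) & _); auto).
    assert (0 <= q) by apply Z.sqrt_nonneg.
    exists 0%nat, []; unfold n, rebuild_constant; cbn [length Z.of_nat]; repeat split; [constructor | nia | nia].
  - destruct HV as (HA & HV).
    destruct (handle_step w r S s op HB Hr HA HI Hc) as (t1 & s1 & X1 & I1 & C1 & O1 & Ht1).
    fold D c in C1, Ht1.
    destruct (IH (apply_op S op) s1 HV I1 C1) as (t2 & outs & X2 & O2 & Ht2 & Ht2').
    fold D in Ht2, Ht2'; fold q in Ht2, Ht2'.
    assert (Hc0 : 0 <= c) by (destruct HI as ((_ & ? & _) & _); auto).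
    assert (Hc1 : 0 <= regs s1 6) by (destruct I1 as ((_ & ? & _) & _); auto).
    destruct (size_bounds r Hr) as (B1 & _ & _).
    assert (HD : 1 <= D) by (unfold D; apply (Z.mul_le_mono_nonneg 1 r 1); [lia | lia | lia | nia]).
    destruct (Z.sqrt_spec D ltac:(lia)) as (Q1 & Q2); fold q in Q1, Q2.
    assert (Hq : 1 <= q) by (apply Z.sqrt_le_square; lia).
    assert (Hcq : c <= q) by (apply Z.sqrt_le_square; lia).
    assert (EN : n = Z.of_nat (length ops) + 1) by (unfold n; cbn [length]; lia).
    set (m := Z.of_nat (length ops)) in *.
    assert (Hm : 0 <= m) by (unfold m; lia).
    clearbody m n; subst n.
    exists (t1 + t2)%nat, (regs s1 0%nat :: outs).
    split; [econstructor; eauto|]. split.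
    { split; [|exact O2]. intros ->; exact (O1 eq_refl). }
    set (c1 := regs s1 6) in *; unfold rebuild_constant in *; clearbody c1 c q D.
    clear - Ht1 Ht2 Ht2' Hc0 Hc1 HD Hq Hcq Hm Q1 Q2.
    destruct Ht1 as [(Ht1 & Hc2) | (Ht1 & Hc2 & HDc)].
    + split.
      (* Without rebuilding the potential grows by at most one multiple of q, which the operation
         pays; the scan costs 310 + 130 c <= 440 q. *)
      * assert (c1 * q <= (c + 1) * q) by (apply Z.mul_le_mono_nonneg_r; lia). lia.
      (* The number of remaining operations plus the length of the log never increases. *)
      * assert ((m + c1) * (m + c1) <= (m + 1 + c) * (m + 1 + c)) by (apply Z.mul_le_mono_nonneg; lia).
        assert (m * (310 + 130 * (m + c1)) <= m * (310 + 130 * (m + 1 + c))) by (apply Z.mul_le_mono_nonneg_l; lia).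
        lia.
    + subst c1; split.
      (* Since c + 1 <= 2 q, the rebuilding costs at most a constant times 2 q (c + 1): the
         potential pays the share of c and the operation that of 1. *)
      * assert ((c + 1) * (c + 1) <= (c + 1) * (2 * q)) by (apply Z.mul_le_mono_nonneg_l; lia). lia.
      * assert (m * (310 + 130 * (m + 0)) <= m * (310 + 130 * (m + 1 + c))) by (apply Z.mul_le_mono_nonneg_l; lia).
        (* The log is empty afterwards, so m^2 for the future and (c + 1)^2 for the rebuilding must
           fit in (m + 1 + c)^2; the cross term is nonnegative. *)
        assert (0 <= m * (c + 1)) by (apply Z.mul_nonneg_nonneg; lia).
        lia.
Qed.

(** * Initial state and passage to real logarithms *)

Lemma big_enough_of_log r w : 2 <= r -> 20 * Z.log2_up r <= w -> big_enough w r.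
Proof.
  intros Hr Hw; destruct (size_bounds r Hr) as (B & _).
  unfold big_enough; rewrite <- Z.pow_mul_r, <- Z.pow_add_r by lia.
  apply Z.pow_lt_mono_r; lia.
Qed.

Lemma between_ops_initial w r :
  0 < r < 2 ^ w -> between_ops w r empty_sets (set_reg 4 1 (set_reg 3 r (set_reg 0 r zero_state))).
Proof.
  intros Hr; set (s := set_reg 4 1 _).
  assert (A : forall tag i, arr s tag i = 0) by reflexivity.
  assert (C : forall p q c, conv (arr s p) (arr s q) c = 0).
  { intros p q c; apply sumZ_zero; intros; rewrite ?A; lia. }
  split; [|split; [|split; [|split]]].
  - unfold data_ok; split; [reflexivity|]; split; [apply Z.le_refl|]; split.
    { intros p Hp; split; intros t Ht; rewrite A; lia. }
    split; [intros i Hi; rewrite A; lia|].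
    split; [intros p t Hp Ht; rewrite !A; reflexivity|].
    split; [intros j z Hj Hz; rewrite A, C; reflexivity|].
    unfold triples; rewrite sumZ_zero; [reflexivity|].
    intros; rewrite A; lia.
  - split; [apply Z.le_refl | apply Z.log2_up_nonneg].
  - reflexivity.
  - left; apply Z.le_refl.
  - intros p x; rewrite A; split; [intros F; destruct F | lia].
Qed.

(** With k + 1 the rounded-up logarithm, 2^k < r gives k ln 2 < ln r. As ln 2 > 1/2, both k and 1
    are below 2 ln r, whence the factor 4. *)
Lemma log2_up_le_ln r : (2 <= r)%Z -> (IZR (Z.log2_up r) <= 4 * ln (IZR r))%R.
Proof.
  intros Hr; pose proof (Z.log2_up_spec r ltac:(lia)) as [H _].
  pose proof (Z.log2_up_pos r ltac:(lia)) as Hp.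
  set (k := Z.to_nat (Z.pred (Z.log2_up r))).
  assert (Hk : Z.log2_up r = (Z.of_nat k + 1)%Z) by (unfold k; lia).
  replace (Z.pred (Z.log2_up r)) with (Z.of_nat k) in H by lia.
  assert (H2 : (2 ^ k < IZR r)%R).
  { rewrite pow_IZR; apply IZR_lt; exact H. }
  assert (L : (INR k * ln 2 < ln (IZR r))%R).
  { rewrite <- ln_pow by lra; apply ln_increasing; [apply pow_lt; lra | exact H2]. }
  assert (L2 : (ln 2 <= ln (IZR r))%R).
  { destruct (Z.eq_dec r 2) as [->|]; [apply Rle_refl|].
    apply Rlt_le, ln_increasing; [lra | apply IZR_lt; lia]. }
  pose proof ln_lt_2; rewrite Hk, plus_IZR, <- INR_IZR_INZ.
  pose proof (pos_INR k); nra.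
Qed.

Lemma sqrt_le_sqrt_ln r : (2 <= r)%Z ->
  (IZR (Z.sqrt (r * (Z.log2_up r * Z.log2_up r))) <= 4 * (sqrt (IZR r) * ln (IZR r)))%R.
Proof.
  intros Hr; pose proof (log2_up_le_ln r Hr) as HL.
  set (l := Z.log2_up r) in *.
  assert (Hl : (0 <= l)%Z) by apply Z.log2_up_nonneg.
  assert (0 <= IZR l)%R by (apply IZR_le; auto).
  assert (0 <= IZR r)%R by (apply IZR_le; lia).
  destruct (Z.sqrt_spec (r * (l * l))) as [Q _]; [apply Z.mul_nonneg_nonneg; nia|].
  set (q := Z.sqrt _) in *.
  apply IZR_le in Q; rewrite !mult_IZR in Q.
  assert (0 <= IZR q)%R by (apply IZR_le, Z.sqrt_nonneg).
  pose proof (sqrt_pos (IZR r)); pose proof (sqrt_sqrt (IZR r) ltac:(auto)) as SS.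
  assert (IZR q <= sqrt (IZR r) * IZR l)%R.
  { apply Rsqr_incr_0_var; [unfold Rsqr | apply Rmult_le_pos; auto].
    replace (sqrt (IZR r) * IZR l * (sqrt (IZR r) * IZR l))%R
      with (sqrt (IZR r) * sqrt (IZR r) * (IZR l * IZR l))%R by ring.
    rewrite SS; exact Q. }
  apply Rle_trans with (1 := H3).
  replace (4 * (sqrt (IZR r) * ln (IZR r)))%R with (sqrt (IZR r) * (4 * ln (IZR r)))%R by ring.
  apply Rmult_le_compat_l; auto.
Qed.

Theorem theorem4 :
  exists (alg : algorithm) (k : Z) (K : R),
    0 < k /\
    forall (rmax w : Z) (ops : list operation),
      2 <= rmax ->
      k * Z.log2_up rmax <= w ->
      valid_ops rmax empty_sets ops ->
      (0 < length ops)%nat ->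
      exists (t : nat) (outs : list Z),
        runs alg w rmax ops t outs /\
        correct_outputs empty_sets ops outs /\
        (amortized t ops <=
           K * Rmin (INR (length ops)) (sqrt (IZR rmax) * ln (IZR rmax)))%R.
Proof.
  (* Word size 20 log suffices since 14 + 4 L < 20 L for L >= 1. The constant is 4 times 25000000,
     the latter bounding the time per operation in units of q and the 4 coming from
     [sqrt_le_sqrt_ln]. *)
  exists three_sum, 20, (IZR 100000000); split; [lia|].
  intros rmax w ops Hr Hw HV Hlen.
  pose proof (big_enough_of_log rmax w Hr Hw) as HB.
  destruct (size_bounds rmax Hr) as (B1 & B2 & B3).
  assert (HW : 0 < rmax < 2 ^ w).
  { split; [lia|]; apply Z.le_lt_trans with (2 ^ Z.log2_up rmax); [lia|].
    apply Z.pow_lt_mono_r; lia. }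
  set (s0 := set_reg 4 1 (set_reg 3 rmax (set_reg 0 rmax zero_state))).
  assert (X0 : exec w (preprocess three_sum) (set_reg 0 (wrap w rmax) zero_state) 5 s0).
  { rewrite wrap_small by lia.
    assert (E1 : eval w (set_reg 3 rmax (set_reg 0 rmax zero_state)) (#1)%e = 1) by (apply wrap_small; lia).
    unfold s0; rewrite <- E1 at 1.
    apply (exec_seq w _ _ _ 2 (set_reg 3 rmax (set_reg 0 rmax zero_state)) 2).
    - apply (exec_assign w 3 ($0)%e (set_reg 0 rmax zero_state)).
    - apply exec_assign. }
  set (D := rmax * (Z.log2_up rmax * Z.log2_up rmax)).
  assert (HD : 1 <= D) by (unfold D; apply (Z.mul_le_mono_nonneg 1 rmax 1); [lia | lia | lia | nia]).
  destruct (handle_all_bounds w rmax ops HB Hr empty_sets s0 HV) as (t & outs & X & O & T1 & T2).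
  { apply between_ops_initial; auto. }
  { change (0 * 0 < D); lia. }
  exists (5 + t)%nat, outs; split; [|split; [exact O|]].
  { exists 5%nat, s0, t; auto. }
  fold D in T1; change (regs s0 6) with 0 in T1, T2.
  assert (Hq : 1 <= Z.sqrt D) by (apply Z.sqrt_le_square; lia).
  pose proof (sqrt_le_sqrt_ln rmax Hr) as HS; fold D in HS.
  set (q := Z.sqrt D) in *; set (n := Z.of_nat (length ops)) in *.
  assert (Hn : 1 <= n) by lia.
  unfold rebuild_constant in *.
  assert (Hnq : 1 <= n * q) by nia.
  assert (N1 : Z.of_nat (5 + t) <= 25000000 * (n * q)) by lia.
  assert (N2 : Z.of_nat (5 + t) <= 100000000 * (n * n)) by nia.
  apply IZR_le in N1, N2; rewrite !mult_IZR in N1, N2; rewrite <- INR_IZR_INZ in N1, N2.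
  unfold n in N1, N2; rewrite <- INR_IZR_INZ in N1, N2.
  assert (Hl : (0 < INR (length ops))%R) by (apply lt_0_INR; auto).
  unfold amortized; apply Rmult_le_reg_r with (INR (length ops)); [auto|].
  unfold Rdiv; rewrite Rmult_assoc, Rinv_l, Rmult_1_r by lra.
  apply Rmin_case.
  - lra.
  - apply Rle_trans with (1 := N1).
    assert (INR (length ops) * IZR q <= INR (length ops) * (4 * (sqrt (IZR rmax) * ln (IZR rmax))))%R
      by (apply Rmult_le_compat_l; lra).
    lra.
Qed.
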